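(* Let $d\ge 2$ and $A\in(0,1)$. For every $c_0\in(0,2\sqrt{1-A})$ there exist $N_0>0$, $\psi_0\in 1+H_0^1(\Omega_{N_0})$ and $\chi(c_0)>0$ such that for every $N\ge N_0$ and every $c\in[c_0,2\sqrt{1-A})$: (a) $I_N^c(\psi_0)<0$; (b) $0<\gamma_N(c)\le\chi(c_0)$, where $$\gamma_N(c):=\inf_{g\in\Gamma(N)}\max_{t\in[0,1]}I_N^c(g(t)),\qquad \Gamma(N):=\{g\in C([0,1],1+H_0^1(\Omega_N)) : g(0)=1,\ g(1)=\psi_0\}.$$
   Context: For $N\in\mathbb{N}$, $\Omega_N:=\{(x_1,\tilde x)\in\mathbb{R}\times\mathbb{R}^{d-1} : -N<x_1<N\}$. Functions are complex valued, and $1+H_0^1(\Omega_N)$ is the affine space of functions $\psi$ with $\psi-1\in H_0^1(\Omega_N)$ (here $1$ is the constant function); elements of $1+H_0^1(\Omega_{N_0})$ are regarded as elements of $1+H_0^1(\Omega_N)$ for $N\ge N_0$ by extending them by $1$. The Lagrangian on $\Omega_N$ is $$I_N^c(\psi)=\frac12\int_{\Omega_N}|\nabla\psi|^2\,dx+\frac12\int_{\Omega_N}(|\psi|^2-1)^2(|\psi|^2-A)\,dx+c\int_{\Omega_N}\partial_{x_1}(\mathrm{Im}\,\psi)\,(\mathrm{Re}\,\psi-1)\,dx.$$ *)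

(* Defs.v *)
From HB Require Import structures.
From mathcomp Require Import all_boot all_order all_algebra.
From mathcomp Require Import complex.
From mathcomp Require Import all_classical all_reals all_analysis.

Set Implicit Arguments.
Unset Strict Implicit.
Unset Printing Implicit Defensive.

Import Order.TTheory GRing.Theory Num.Theory.
Import numFieldNormedType.Exports.

Local Open Scope classical_set_scope.
Local Open Scope ring_scope.

Definition measure_rV_display : measure_display -> measure_display.
Proof. exact. Qed.

(* 'rV[T]_n carries the sigma-algebra generated by the coordinates, as
   n.-tuple T does in the library. *)
Section measurable_rV.
Context {d} {T : sigmaRingType d}.
Variable n : nat.

Let coord : 'I_n -> 'rV[T]_n -> T := fun i x => x ord0 i.

Let rV_set0 : g_sigma_preimage coord set0.
Proof. exact: sigma_algebra0. Qed.

Let rV_setC A : g_sigma_preimage coord A -> g_sigma_preimage coord (~` A).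
Proof. exact: sigma_algebraC. Qed.

Let rV_bigcup (F : _^nat) : (forall i, g_sigma_preimage coord (F i)) ->
  g_sigma_preimage coord (\bigcup_i (F i)).
Proof. exact: sigma_algebra_bigcup. Qed.

HB.instance Definition _ := @isMeasurable.Build (measure_rV_display d)
  'rV[T]_n (g_sigma_preimage coord) rV_set0 rV_setC rV_bigcup.

End measurable_rV.

Lemma measurable_coord_rV d (T : measurableType d) n (i : 'I_n) :
  measurable_fun [set: 'rV[T]_n] (fun x : 'rV[T]_n => x ord0 i).
Proof.
move=> _ Y mY; rewrite setTI; apply: sub_sigma_algebra => /=.
rewrite -bigcup_seq/=; exists i => /=; first by rewrite mem_index_enum.
by exists Y => //; rewrite setTI.
Qed.

Lemma measurable_fun_rVP d1 d2 (T1 : measurableType d1) (T2 : measurableType d2)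
    n (f : T1 -> 'rV[T2]_n) :
  (forall i, measurable_fun [set: T1] (fun x => f x ord0 i)) ->
  measurable_fun [set: T1] f.
Proof.
move=> mf _ A mA; rewrite setTI.
have : g_sigma_preimage (fun i x => f x ord0 i) (f @^-1` A).
  rewrite (@g_sigma_preimage_comp _ _ _ _ (fun i (x : 'rV[T2]_n) => x ord0 i)).
  by exists A => //; rewrite setTI.
move: (f @^-1` A).
apply: smallest_sub; first exact: sigma_algebra_measurable.
case: n => [|n] in f mf A mA *; first by rewrite big_ord0.
rewrite -bigcup_mkord_ord; apply: bigcup_sub => i Ii.
by move=> B [C mC <-]; exact: mf.
Qed.

Section cons_rV.
Context {R : realType} {n : nat}.

Definition cons_rV (p : R * 'rV[R]_n) : 'rV[R]_n.+1 :=
  \row_i (if unlift ord0 i is Some j then p.2 ord0 j else p.1).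

Lemma cons_rV0 p : cons_rV p ord0 ord0 = p.1.
Proof. by rewrite mxE unlift_none. Qed.

Lemma cons_rVS p j : cons_rV p ord0 (lift ord0 j) = p.2 ord0 j.
Proof. by rewrite mxE liftK. Qed.

Definition uncons_rV (x : 'rV[R]_n.+1) : R * 'rV[R]_n :=
  (x ord0 ord0, \row_j x ord0 (lift ord0 j)).

Lemma cons_rVK : cancel cons_rV uncons_rV.
Proof.
move=> [a y]; rewrite /uncons_rV cons_rV0; congr pair.
by apply/rowP => j; rewrite mxE cons_rVS.
Qed.

Lemma measurable_cons_rV : measurable_fun [set: R * 'rV[R]_n] cons_rV.
Proof.
apply: measurable_fun_rVP => i.
case: (unliftP ord0 i) => [j ->|->].
  rewrite (_ : (fun x => _) = (fun y : 'rV[R]_n => y ord0 j) \o snd).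
    exact: (measurableT_comp (measurable_coord_rV j)).
  by apply/funext => p /=; rewrite cons_rVS.
by rewrite (_ : (fun x => _) = fst)//; apply/funext => p; rewrite cons_rV0.
Qed.

Lemma measurable_uncons_rV : measurable_fun [set: 'rV[R]_n.+1] uncons_rV.
Proof.
apply: measurable_fun_pair; first exact: measurable_coord_rV.
apply: measurable_fun_rVP => j.
rewrite (_ : (fun x => _) =
  (fun x : 'rV[R]_n.+1 => x ord0 (lift ord0 j))); last first.
  by apply/funext => x; rewrite mxE.
exact: measurable_coord_rV.
Qed.

End cons_rV.

Section lebesgue_cons.
Context {R : realType} {n : nat}.
Variable mu : {sigma_finite_measure set 'rV[R]_n -> \bar R}.
Local Open Scope ereal_scope.

Definition lebesgue_cons : set 'rV[R]_n.+1 -> \bar R :=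
  pushforward (@lebesgue_measure R \x mu) cons_rV.

Let lebesgue_cons0 : lebesgue_cons set0 = 0.
Proof. by rewrite /lebesgue_cons /pushforward preimage_set0 measure0. Qed.

Let lebesgue_cons_ge0 A : 0 <= lebesgue_cons A.
Proof. by rewrite /lebesgue_cons /pushforward measure_ge0. Qed.

Let lebesgue_cons_sigma_additive : semi_sigma_additive lebesgue_cons.
Proof.
move=> F mF tF mUF; rewrite /lebesgue_cons /pushforward preimage_bigcup.
apply: measure_semi_sigma_additive.
- by move=> k; rewrite -[X in measurable X]setTI; exact: measurable_cons_rV.
- apply/trivIsetP => /= i j _ _ ij; rewrite -preimage_setI.
  by move/trivIsetP : tF => /(_ _ _ _ _ ij) ->//; rewrite preimage_set0.
- rewrite -preimage_bigcup -[X in measurable X]setTI.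
  exact: measurable_cons_rV.
Qed.

HB.instance Definition _ := isMeasure.Build _ _ _ lebesgue_cons
  lebesgue_cons0 lebesgue_cons_ge0 lebesgue_cons_sigma_additive.

Let lebesgue_cons_sigma_finite : sigma_finite setT lebesgue_cons.
Proof.
have /sigma_finiteP[F [TF ndF Foo]] := sigma_finiteT (@lebesgue_measure R).
have /sigma_finiteP[G [TG ndG Goo]] := sigma_finiteT mu.
exists (fun k => uncons_rV @^-1` (F k `*` G k)).
  apply/seteqP; split => // x _.
  have [n1 _ Fx] : (\bigcup_i F i) (uncons_rV x).1 by rewrite -TF.
  have [n2 _ Gx] : (\bigcup_i G i) (uncons_rV x).2 by rewrite -TG.
  exists (maxn n1 n2) => //; split.
  - by move: Fx; exact/subsetPset/ndF/leq_maxl.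
  - by move: Gx; exact/subsetPset/ndG/leq_maxr.
move=> k; have [mF Fk] := Foo k; have [mG Gk] := Goo k; split.
  rewrite -[X in measurable X]setTI; apply: measurable_uncons_rV => //.
  exact: measurableX.
rewrite /lebesgue_cons /pushforward -comp_preimage.
rewrite (_ : _ \o _ = id); last by apply/funext => p /=; rewrite cons_rVK.
by rewrite preimage_id product_measure1E// lte_mul_pinfty// ge0_fin_numE.
Qed.

HB.instance Definition _ := Measure_isSigmaFinite.Build _ _ _ lebesgue_cons
  lebesgue_cons_sigma_finite.

Definition lebesgue_cons_measure :
  {sigma_finite_measure set 'rV[R]_n.+1 -> \bar R} := lebesgue_cons.

End lebesgue_cons.

(* Lebesgue measure on R^n: the n-fold product of the one-dimensional one. *)
Fixpoint lebesgue_rV (R : realType) (n : nat) :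
    {sigma_finite_measure set 'rV[R]_n -> \bar R} :=
  if n is n'.+1 then lebesgue_cons_measure (lebesgue_rV R n')
  else dirac (0 : 'rV[R]_0).

Lemma lebesgue_rV_prod (R : realType) (n : nat) (A : 'I_n -> set R) :
  (forall i, measurable (A i)) ->
  lebesgue_rV R n [set x | forall i, A i (x ord0 i)] =
  (\prod_(i < n) lebesgue_measure (A i))%E.
Proof.
elim: n A => [|n IHn] A mA.
  rewrite big_ord0 /= diracE mem_set// => i.
  by case: i.
have mAS : measurable [set y : 'rV[R]_n | forall j, A (lift ord0 j) (y ord0 j)].
  rewrite [X in measurable X](_ : _ = \bigcap_(j in [set: 'I_n])
      ((fun y : 'rV[R]_n => y ord0 j) @^-1` A (lift ord0 j))).
    apply: fin_bigcap_measurable => // j _; rewrite -[X in measurable X]setTI.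
    by apply: measurable_coord_rV => //; exact: mA.
  by apply/seteqP; split => x /=; [move=> + j _; exact|move=> + j; exact].
rewrite big_ord_recl -(IHn (fun j => A (lift ord0 j))); last first.
  by move=> j; exact: mA.
transitivity ((@lebesgue_measure R \x lebesgue_rV R n)%E
    (A ord0 `*` [set y : 'rV[R]_n | forall j, A (lift ord0 j) (y ord0 j)]));
  last by rewrite product_measure1E//; exact: mA.
rewrite /= /lebesgue_cons /pushforward.
congr (product_measure1 _ _ _); apply/seteqP; split => -[a y] /=.
  move=> AA; split; first by have := AA ord0; rewrite cons_rV0.
  by move=> j; have := AA (lift ord0 j); rewrite cons_rVS.
move=> [Aa Ay] i; case: (unliftP ord0 i) => [j ->|->].
  by rewrite cons_rVS.
by rewrite cons_rV0.
Qed.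

Section sobolev.
Context {R : realType} {n : nat}.
Implicit Types (Omega : set 'rV[R]_n) (i : 'I_n).

Local Notation mu := (lebesgue_rV R n).

Definition partial i (f : 'rV[R]_n -> R) : 'rV[R]_n -> R :=
  fun x => 'D_(delta_mx ord0 i) f x.

(* C^infty: every iterated partial derivative exists and is continuous. *)
Definition smooth (f : 'rV[R]_n -> R) : Prop :=
  forall s : seq 'I_n, let g := foldr partial f s in
    continuous g /\ forall x i, derivable g x (delta_mx ord0 i).

Definition test_function Omega (phi : 'rV[R]_n -> R) : Prop :=
  [/\ smooth phi, compact (closure [set x | phi x != 0]) &
      closure [set x | phi x != 0] `<=` Omega].

Definition test_functionC Omega (phi : 'rV[R]_n -> R[i]) : Prop :=
  test_function Omega (fun x => complex.Re (phi x)) /\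
  test_function Omega (fun x => complex.Im (phi x)).

Definition square_integrable Omega (f : 'rV[R]_n -> R) : Prop :=
  measurable_fun Omega f /\ (\int[mu]_(x in Omega) (f x ^+ 2)%:E < +oo)%E.

Definition is_weak_partial Omega i (f g : 'rV[R]_n -> R) : Prop :=
  forall phi, test_function Omega phi ->
    (\int[mu]_(x in Omega) (f x * partial i phi x)%:E =
     - \int[mu]_(x in Omega) (g x * phi x)%:E)%E.

(* A square-integrable weak derivative is unique up to a null set; a
   representative is chosen (and it is 0 when there is none). *)
Definition weak_partial Omega i (f : 'rV[R]_n -> R) : 'rV[R]_n -> R :=
  xget (fun=> 0) [set g | square_integrable Omega g /\
                          is_weak_partial Omega i f g].

Definition weak_partialC Omega i (u : 'rV[R]_n -> R[i]) : 'rV[R]_n -> R[i] :=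
  fun x => Complex (weak_partial Omega i (fun y => complex.Re (u y)) x)
                   (weak_partial Omega i (fun y => complex.Im (u y)) x).

Definition sqnorm_grad Omega (u : 'rV[R]_n -> R[i]) (x : 'rV[R]_n) : R :=
  \sum_(i < n) Normc.normc (weak_partialC Omega i u x) ^+ 2.

Definition sobolev_H1_real Omega (f : 'rV[R]_n -> R) : Prop :=
  square_integrable Omega f /\
  forall i, exists2 g, square_integrable Omega g & is_weak_partial Omega i f g.

Definition sobolev_H1 Omega (u : 'rV[R]_n -> R[i]) : Prop :=
  sobolev_H1_real Omega (fun x => complex.Re (u x)) /\
  sobolev_H1_real Omega (fun x => complex.Im (u x)).

Definition H1_norm Omega (u : 'rV[R]_n -> R[i]) : \bar R :=
  ((\int[mu]_(x in Omega) (Normc.normc (u x) ^+ 2 + sqnorm_grad Omega u x)%:E)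
    `^ 2^-1)%E.

(* H^1_0: the closure in H^1 of the complex valued C^infty_c functions. *)
Definition sobolev_H10 Omega (u : 'rV[R]_n -> R[i]) : Prop :=
  sobolev_H1 Omega u /\
  forall e : R, 0 < e -> exists2 phi, test_functionC Omega phi &
    (H1_norm Omega (fun x => (u x - phi x)%R) < e%:E)%E.

Definition one_plus_H10 Omega (psi : 'rV[R]_n -> R[i]) : Prop :=
  sobolev_H10 Omega (fun x => psi x - 1).

(* Equality of elements of a function space over Omega, whose elements are
   represented by functions on R^n with irrelevant values outside Omega. *)
Definition ae_eq_on Omega (u v : 'rV[R]_n -> R[i]) : Prop :=
  {ae mu, forall x, Omega x -> u x = v x}.

Definition extend_by_one Omega (psi : 'rV[R]_n -> R[i]) : 'rV[R]_n -> R[i] :=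
  fun x => if x \in Omega then psi x else 1.

(* Continuity [0,1] -> 1 + H^1_0 is for the distance induced by H1_norm. *)
Definition path_between Omega (psi0 psi1 : 'rV[R]_n -> R[i])
    (g : R -> 'rV[R]_n -> R[i]) : Prop :=
  [/\ forall t : R, t \in `[0, 1] -> one_plus_H10 Omega (g t),
      forall t : R, t \in `[0, 1] ->
        H1_norm Omega (fun x => g s x - g t x) @[s --> within `[0, 1] (nbhs t)]
          --> 0%E,
      ae_eq_on Omega (g 0) psi0 &
      ae_eq_on Omega (g 1) psi1].

End sobolev.

Section lagrangian.
Context {R : realType} {m : nat}.

Local Notation mu := (lebesgue_rV R m.+1).

(* Points of R^d, d = m.+1, are row vectors; x_1 is coordinate ord0. *)
Definition slab (N : nat) : set 'rV[R]_m.+1 :=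
  [set x | - N%:R < x ord0 ord0 < N%:R].

(* Extended real valued: when d >= 4 the potential term can be +oo. *)
Definition lagrangian (A : R) (N : nat) (c : R)
    (psi : 'rV[R]_m.+1 -> R[i]) : \bar R :=
  ((2^-1)%:E * \int[mu]_(x in slab N) (sqnorm_grad (slab N) psi x)%:E
   + (2^-1)%:E * \int[mu]_(x in slab N)
       ((Normc.normc (psi x) ^+ 2 - 1) ^+ 2 *
        (Normc.normc (psi x) ^+ 2 - A))%:E
   + c%:E * \int[mu]_(x in slab N)
       (weak_partial (slab N) ord0 (fun y => complex.Im (psi y)) x *
        (complex.Re (psi x) - 1))%:E)%E.

(* The maximum along a path is a supremum in the extended reals: it need not
   be attained when d >= 4. *)
Definition mountain_pass_level (A : R) (N : nat) (c : R)
    (psi0 : 'rV[R]_m.+1 -> R[i]) : \bar R :=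
  ereal_inf [set ereal_sup [set lagrangian A N c (g t) | t in `[0, 1]]
    | g in [set g | path_between (slab N) (fun=> 1) psi0 g]].

End lagrangian.

(* Main.v *)
(* The path psi(t) = 1 - t * eta is real valued, so the momentum term of the
   energy vanishes along it and all bounds are uniform in c and N. When eta is a
   smooth plateau equal to about 1 on a large cube of side L, the potential
   contributes a negative amount of order L^d and the gradient O(L^(d-2)), so
   the energy at t = 1 is negative.

   For the lower bound, write psi = 1 + u + i v. Since c^2 < 4 (1 - A), the
   quadratic part of the energy at 1 is positive definite on H^1_0, by Young's
   inequality and the Poincare inequality on the slab. The potential may be
   negative only where |u| or |v| exceeds a fixed d; it is bounded below, and
   the measure of this set is o(||psi - 1||^2) by a weak-type Sobolev inequality
   |{|phi| >= d}|^(n+1) <= C (||phi||^2)^(n+2), which has a short proof by slicing and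
   works in every dimension. Hence the energy is at least a positive constant
   on a small H^1-sphere around 1. Paths are continuous for the H^1 norm and
   end at a point of negative energy, outside the corresponding ball, so they
   all cross that sphere. *)

(* The potential has degree six in [psi], so in high dimension H^1 does not control its integral.
   What makes this work is that the exponent (n+2)/(n+1) of the weak Sobolev inequality exceeds 1.

   The two bounds differ in uniformity. The radius and height of the barrier around 1 depend on N
   and c: the Poincare constant grows with N, and coercivity degenerates as c tends to 2 sqrt(1 -
   A). This is harmless since only positivity of the level is claimed, while the upper bound must be
   the same for all N and c.

   [weak_partial] is a chosen representative, additive only almost everywhere. Computations thus
   carry explicit gradients through [weak_grad] and [h1sq], and return to [weak_partial] by
   uniqueness, which rests on the fundamental lemma of the calculus of variations. *)
Require Import Defs.
From HB Require Import structures.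
From mathcomp Require Import all_boot all_order all_algebra.
From mathcomp Require Import complex.
From mathcomp Require Import all_classical all_reals all_analysis.
From mathcomp Require Import measurable_realfun ring lra.

Set Implicit Arguments.
Unset Strict Implicit.
Unset Printing Implicit Defensive.

Import Order.TTheory GRing.Theory Num.Theory.
Import numFieldNormedType.Exports.

Local Open Scope classical_set_scope.
Local Open Scope ring_scope.

(** * Slicing and weak-type inequalities *)

Section iterated_integration.
Context {R : realType}.
Local Notation mu := (lebesgue_rV R).
Local Notation leb := (@lebesgue_measure R).
Local Open Scope ereal_scope.
Let leb_mu n : {measure set (measurableTypeR R * 'rV[R]_n) -> \bar R} :=
  leb \x mu n.

Let measurable_cons n :
  measurable_fun [set: measurableTypeR R * 'rV[R]_n] cons_rV.
Proof. exact: measurable_cons_rV. Qed.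

Let measurableT_comp_cons n (f : 'rV[R]_n.+1 -> \bar R) :
  measurable_fun setT f ->
  measurable_fun [set: measurableTypeR R * 'rV[R]_n] (f \o cons_rV).
Proof. by move=> mf; apply: (measurableT_comp mf); exact: measurable_cons. Qed.

(** [lebesgue_rV] is built by pushing a product forward along [cons_rV], so Tonelli and Fubini only
    split off the first coordinate. Other directions are reached by induction on the dimension. *)
Lemma ge0_integral_cons n (f : 'rV[R]_n.+1 -> \bar R) :
  measurable_fun setT f -> (forall x, 0 <= f x) ->
  \int[mu n.+1]_x f x = \int[leb]_a \int[mu n]_y f (cons_rV (a, y)).
Proof.
move=> mf f0.
rewrite [LHS](ge0_integral_pushforward (@measurable_cons n) (leb_mu n))//.
rewrite preimage_setT fubini_tonelli1//; first exact: measurableT_comp_cons.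
by move=> x; exact: f0.
Qed.

Lemma ge0_integral_cons_swap n (f : 'rV[R]_n.+1 -> \bar R) :
  measurable_fun setT f -> (forall x, 0 <= f x) ->
  \int[mu n.+1]_x f x = \int[mu n]_y \int[leb]_a f (cons_rV (a, y)).
Proof.
move=> mf f0; rewrite ge0_integral_cons//.
rewrite (fubini_tonelli (m1 := leb) (m2 := mu n) (f \o cons_rV))//.
  exact: measurableT_comp_cons.
by move=> x; exact: f0.
Qed.

Lemma integrable_comp_cons n (f : 'rV[R]_n.+1 -> \bar R) :
  measurable_fun setT f ->
  (mu n.+1).-integrable setT f ->
  (leb \x mu n).-integrable setT (f \o cons_rV).
Proof.
move=> mf /integrableP[_ fi]; apply/integrableP; split.
  exact: measurableT_comp_cons.
apply: le_lt_trans fi.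
rewrite [leRHS](ge0_integral_pushforward (@measurable_cons n) (leb_mu n))//.
exact: measurableT_comp.
Qed.

Lemma integral_cons n (f : 'rV[R]_n.+1 -> \bar R) :
  (mu n.+1).-integrable setT f ->
  \int[mu n.+1]_x f x = \int[leb]_a \int[mu n]_y f (cons_rV (a, y)).
Proof.
move=> fi; have mf := measurable_int _ fi.
have fci := integrable_comp_cons mf fi.
rewrite [LHS](integral_pushforward (@measurable_cons n) (mu := leb_mu n))//.
by rewrite preimage_setT -integral12_prod_meas1.
Qed.

Lemma integral_cons_swap n (f : 'rV[R]_n.+1 -> \bar R) :
  (mu n.+1).-integrable setT f ->
  \int[mu n.+1]_x f x = \int[mu n]_y \int[leb]_a f (cons_rV (a, y)).
Proof.
move=> fi; have mf := measurable_int _ fi.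
rewrite integral_cons//; apply: (Fubini (m1 := leb) (m2 := mu n) (f := f \o cons_rV)).
exact: integrable_comp_cons.
Qed.

Lemma measurable_cons_rV_slice n (a : R) :
  measurable_fun setT (fun y : 'rV[R]_n => cons_rV (a, y)).
Proof.
exact: (measurableT_comp measurable_cons_rV (measurable_pair1 a)).
Qed.

Lemma measurable_cons_rV_line n (y : 'rV[R]_n) :
  measurable_fun setT (fun a : R => cons_rV (a, y)).
Proof.
exact: (measurableT_comp measurable_cons_rV (measurable_pair2 y)).
Qed.

Definition upd n (x : 'rV[R]_n) (i : 'I_n) (t : R) : 'rV[R]_n :=
  \row_j (if j == i then t else x ord0 j).

Lemma upd_cons0 n a (y : 'rV[R]_n) t :
  upd (cons_rV (a, y)) ord0 t = cons_rV (t, y).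
Proof.
apply/rowP => j; rewrite !mxE; case: (unliftP ord0 j) => [k ->|->].
  by rewrite eq_sym (negbTE (neq_lift _ _)).
by rewrite eqxx.
Qed.

Lemma upd_consS n a (y : 'rV[R]_n) i t :
  upd (cons_rV (a, y)) (lift ord0 i) t = cons_rV (a, upd y i t).
Proof.
apply/rowP => j; rewrite !mxE; case: (unliftP ord0 j) => [k ->|->].
  by rewrite (inj_eq lift_inj) !mxE.
by rewrite (negbTE (neq_lift _ _)).
Qed.

End iterated_integration.

Section weak_loomis_whitney.
Context {R : realType}.
Local Notation mu := (lebesgue_rV R).
Local Notation leb := (@lebesgue_measure R).
Local Open Scope ereal_scope.

Lemma measurable_superlevel d (T : measurableType d) (f : T -> R) (e : R) :
  measurable_fun setT f -> measurable [set x | (e <= f x)%R].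
Proof.
move=> mf; rewrite -[X in measurable X]setTI.
rewrite [X in _ `&` X](_ : _ = f @^-1` `[e, +oo[%classic).
  by apply: mf => //; exact: measurable_itv.
by apply/seteqP; split => x /=; rewrite in_itv/= andbT.
Qed.

Lemma measure_superlevel1_le d (T : measurableType d)
    (m : {measure set T -> \bar R}) (f : T -> R) :
  measurable_fun setT f -> (forall x, (0 <= f x)%R) ->
  m [set x | (1 <= f x)%R] <= \int[m]_x (f x)%:E.
Proof.
move=> mf f0; have mE := measurable_superlevel 1 mf.
rewrite -[X in m X]setIT -integral_indic//; apply: ge0_le_integral => //.
- exact/measurable_EFinP/measurable_indic.
- exact/measurable_EFinP.
- move=> x _; rewrite lee_fin indicE; case: (boolP (_ \in _)) => //.
  by rewrite inE.
Qed.

(* Slicing along the first coordinate: the slice of [f >= 1] has measure at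
   most [T], and at most [S(a)^((n+2)/(n+1))] by induction, where [S] has
   integral at most [T]; interpolating gives [T^(1/(n+2)) S(a)]. *)
Lemma weak_loomis_whitney n (f : 'rV[R]_n -> R) (h : 'I_n -> 'rV[R]_n -> R) T :
  measurable_fun setT f -> (forall x, (0 <= f x)%R) ->
  (forall i, measurable_fun setT (h i)) -> (forall i x, (0 <= h i x)%R) ->
  (forall x i, (f x)%:E <= \int[leb]_t (h i (upd x i t))%:E) ->
  \int[mu n]_x (f x)%:E + \sum_(i < n) \int[mu n]_x (h i x)%:E <= T%:E ->
  mu n [set x | (1 <= f x)%R] < +oo /\
  (fine (mu n [set x | (1 <= f x)%R]) ^+ n.+1 <= T ^+ n.+2)%R.
Proof.
elim: n f h T => [|n IH] f h T mf f0 mh h0 fh leT.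
  (* In dimension 0 the measure is a Dirac mass, so the superlevel set has measure 0 or 1; in the
     latter case Markov's inequality gives 1 <= T. *)
  have := measure_superlevel1_le (mu 0) mf f0; move: leT.
  rewrite big_ord0 adde0 => leT leI.
  have le1 := le_trans leI leT.
  split; first exact: le_lt_trans (ltry T).
  have T0 : (0 <= T)%R by rewrite -lee_fin (le_trans _ le1).
  rewrite expr1; move: le1; rewrite /= /dirac indicE; case: (_ \in _) => /=.
    by rewrite lee_fin => T1; rewrite exprn_ege1.
  by rewrite sqr_ge0.
have mE := measurable_superlevel 1 mf.
have sum0 m' (g : 'I_m' -> 'rV[R]_n.+1 -> R) : (forall i x, (0 <= g i x)%R) ->
    0 <= \sum_(i < m') \int[mu n.+1]_x (g i x)%:E.
  move=> g0; apply: sume_ge0 => i _; apply: integral_ge0 => x _.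
  by rewrite lee_fin.
have If0 : 0 <= \int[mu n.+1]_x (f x)%:E.
  by apply: integral_ge0 => x _; rewrite lee_fin.
have T0 : (0 <= T)%R by rewrite -lee_fin (le_trans _ leT)// adde_ge0// sum0.
have mfc a : measurable_fun setT (fun y => f (cons_rV (a, y))).
  exact: (measurableT_comp mf (measurable_cons_rV_slice a)).
have mhc i a : measurable_fun setT (fun y => h i (cons_rV (a, y))).
  exact: (measurableT_comp (mh i) (measurable_cons_rV_slice a)).
pose S a := \int[mu n]_y (f (cons_rV (a, y)))%:E +
  \sum_(i < n) \int[mu n]_y (h (lift ord0 i) (cons_rV (a, y)))%:E.
pose M a := mu n [set y | (1 <= f (cons_rV (a, y)))%R].
(* The integral of [h ord0] along a line in the first direction dominates [f] on the whole line,
   which gives a bound of the slice independent of [a]. *)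
have MT a : M a <= T%:E.
  apply: le_trans (measure_superlevel1_le _ (mfc a) _) _ => //.
  apply: (@le_trans _ _ (\int[mu n.+1]_x (h ord0 x)%:E)).
    rewrite ge0_integral_cons_swap; first last.
    - by move=> x; rewrite lee_fin.
    - exact/measurable_EFinP.
    apply: ge0_le_integral => //.
    - by move=> y _; rewrite lee_fin.
    - exact/measurable_EFinP.
    - apply: (measurable_fun_fubini_tonelli_G (m1 := leb)
        (EFin \o h ord0 \o cons_rV)).
        apply: measurableT_comp; last exact: measurable_cons_rV.
        exact/measurable_EFinP.
      by move=> x; rewrite /= lee_fin.
    - move=> y _; apply: le_trans (fh _ ord0) _.
      by under eq_integral do rewrite upd_cons0.
  by apply: le_trans leT; rewrite big_ord_recl/= addeCA leeDl// adde_ge0// sum0.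
have MS a s : S a <= s%:E -> (fine (M a) ^+ n.+1 <= s ^+ n.+2)%R.
  move=> Ss; have [] // := IH (fun y => f (cons_rV (a, y)))
    (fun i y => h (lift ord0 i) (cons_rV (a, y))) s.
  move=> y i; apply: le_trans (fh _ (lift ord0 i)) _.
  by under eq_integral do rewrite upd_consS.
pose tau := (T `^ (n.+2%:R^-1))%R.
have tau0 : (0 <= tau)%R by exact: powR_ge0.
have tauX : (tau ^+ n.+2 = T)%R.
  by rewrite -powR_mulrn// -powRrM mulVf ?powRr1// pnatr_eq0.
have Mfin a : M a \is a fin_num.
  by rewrite ge0_fin_numE ?measure_ge0// (le_lt_trans (MT a)) ?ltry.
have S0 a : 0 <= S a.
  rewrite adde_ge0//; first by apply: integral_ge0 => y _; rewrite lee_fin.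
  by apply: sume_ge0 => i _; apply: integral_ge0 => y _; rewrite lee_fin.
(* M^(n+2) = M * M^(n+1) is at most T * S^(n+2), whose root is tau * S. The case T = 0 is treated
   apart because tau has to be positive when S is infinite. *)
have MtS a : M a <= tau%:E * S a.
  case: (eqVneq T 0%R) => [T00|TN0].
    by apply: le_trans (MT a) _; rewrite T00 mule_ge0.
  have tau_gt0 : (0 < tau)%R by rewrite powR_gt0// lt_neqAle eq_sym TN0.
  have [Soo|SN] := eqVneq (S a) +oo.
    by rewrite Soo gt0_muley ?lte_fin// leey.
  have Sfin : S a \is a fin_num by rewrite ge0_fin_numE// lt_neqAle SN leey.
  rewrite -(fineK Sfin) -(fineK (Mfin a)) -EFinM lee_fin.
  have /= := MS a (fine (S a)); rewrite fineK// => /(_ (lexx _)) MSa.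
  rewrite -(@ler_pXn2r _ n.+2)// ?nnegrE ?mulr_ge0 ?fine_ge0 ?measure_ge0//.
  rewrite exprMn tauX exprS ler_pM ?exprn_ge0 ?fine_ge0 ?measure_ge0//.
  by rewrite -lee_fin fineK.
have mFc (g : 'rV[R]_n.+1 -> R) : measurable_fun setT g -> (forall x, (0 <= g x)%R) ->
    measurable_fun setT (fun a => \int[mu n]_y (g (cons_rV (a, y)))%:E).
  move=> mg g0.
  apply: (measurable_fun_fubini_tonelli_F (m2 := mu n) (EFin \o g \o cons_rV)).
    apply: measurableT_comp; last exact: measurable_cons_rV.
    exact/measurable_EFinP.
  by move=> x; rewrite /= lee_fin.
have mS : measurable_fun setT S.
  apply: emeasurable_funD; first exact: mFc.
  by apply: emeasurable_sum => i; exact: mFc.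
have IS : \int[leb]_a S a <= T%:E.
  rewrite /S ge0_integralD//; last 4 first.
  - by move=> a _; apply: integral_ge0 => y _; rewrite lee_fin.
  - exact: mFc.
  - by move=> a _; apply: sume_ge0 => i _; apply: integral_ge0 => y _; rewrite lee_fin.
  - by apply: emeasurable_sum => i; exact: mFc.
  rewrite ge0_integral_sum//; last 2 first.
  - by move=> i; exact: mFc.
  - by move=> i a _; apply: integral_ge0 => y _; rewrite lee_fin.
  apply: le_trans leT.
  have cE (g : 'rV[R]_n.+1 -> R) : measurable_fun setT g ->
      (forall x, (0 <= g x)%R) ->
      \int[leb]_a \int[mu n]_y (g (cons_rV (a, y)))%:E =
      \int[mu n.+1]_x (g x)%:E.
    by move=> mg g0; rewrite ge0_integral_cons//; exact/measurable_EFinP.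
  rewrite (cE f)// leeD2l// big_ord_recl/=.
  under eq_bigr => i _ do rewrite (cE (h (lift ord0 i)))//.
  by rewrite leeDr// integral_ge0// => x _; rewrite lee_fin.
have ME a : M a = \int[mu n]_y
    (\1_[set x : 'rV[R]_n.+1 | (1 <= f x)%R] (cons_rV (a, y)))%:E.
  rewrite /M -[X in mu n X]setIT -integral_indic//.
  exact: measurable_superlevel.
have muE : mu n.+1 [set x | (1 <= f x)%R] = \int[leb]_a M a.
  rewrite -[X in mu n.+1 X]setIT -integral_indic// ge0_integral_cons//; last first.
    exact/measurable_EFinP/measurable_indic.
  by apply: eq_integral => a _; rewrite ME.
have muEle : mu n.+1 [set x | (1 <= f x)%R] <= (tau * T)%:E.
  rewrite muE; apply: (@le_trans _ _ (\int[leb]_a (tau%:E * S a))).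
    apply: ge0_le_integral => //.
    - rewrite (_ : M = fun a => \int[mu n]_y
          (\1_[set x : 'rV[R]_n.+1 | (1 <= f x)%R] (cons_rV (a, y)))%:E).
        by apply: mFc => //; exact: measurable_indic.
      by apply/funext => a; exact: ME.
    - exact: measurable_funeM.
  rewrite ge0_integralZl_EFin// EFinM.
  by apply: lee_wpmul2l => //; rewrite lee_fin.
split; first exact: le_lt_trans muEle (ltry _).
have -> : (T ^+ n.+3 = (tau * T) ^+ n.+2)%R by rewrite exprMn tauX -exprS.
rewrite ler_pXn2r// ?nnegrE ?mulr_ge0 ?fine_ge0 ?measure_ge0//.
rewrite -lee_fin fineK// ge0_fin_numE ?measure_ge0//.
exact: le_lt_trans muEle (ltry _).
Qed.

End weak_loomis_whitney.

(** * Borel sets and smooth functions *)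

Section rV_borel.
Context {R : realType} {n : nat}.
Implicit Types (U : set 'rV[R]_n) (x : 'rV[R]_n).

(** A countable base of open cubes. The dilation [r] leaves room: the cubes with [r = 1] cover an
    open set while their doubles, and hence their closures, stay inside it. *)
Definition rat_ball (p : 'rV[rat]_n * nat) (r : R) : set 'rV[R]_n :=
  ball (\row_i ratr (p.1 ord0 i) : 'rV[R]_n) (r * p.2.+1%:R^-1).

Lemma ball_rVP (c x : 'rV[R]_n) (e : R) :
  ball c e x <-> 0 < e /\ forall i, `|c ord0 i - x ord0 i| < e.
Proof.
split=> [[e0 cx]|[e0 cx]]; split=> // i; first exact: cx.
by move=> j; rewrite ord1; exact: cx.
Qed.

Lemma open_rat_ball U x : open U -> U x ->
  exists p, rat_ball p 2 `<=` U /\ rat_ball p 1 x.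
Proof.
rewrite openE => /(_ x) /[apply] /nbhs_ballP[e /= e0 eU].
(* One third is spent on the distance from [x] to the rational centre, two thirds on the doubled
   radius. *)
have [k ke] : exists k : nat, k.+1%:R^-1 < e / 3.
  have /ltr_add_invr[k] : (0:R) < e / 3 by rewrite divr_gt0.
  by rewrite add0r => ?; exists k.
pose d : R := k.+1%:R^-1.
have d0 : 0 < d by rewrite invr_gt0 ltr0n.
have /choice[q qx] : forall i, exists q : rat, `|ratr q - x ord0 i| < d.
  move=> i; have /rat_in_itvoo[q] : x ord0 i - d < x ord0 i + d by lra.
  by rewrite in_itv/= => /andP[? ?]; exists q; rewrite ltr_norml; lra.
exists (\row_i q i, k); split.
  move=> y /ball_rVP[_ qy]; apply: eU; apply/ball_rVP; split=> // i.
  rewrite -(subrKA (ratr (q i))).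
  apply: le_lt_trans (ler_normD _ _) _.
  have := qy i; have := qx i; rewrite !mxE/= distrC -/d.
  by move: ke; rewrite -/d => ? ? ?; lra.
apply/ball_rVP; split; first by rewrite mul1r.
by move=> i; rewrite !mxE mul1r.
Qed.

Lemma measurable_rV_forall (A : 'I_n -> set R) :
  (forall i, measurable (A i)) ->
  measurable [set x : 'rV[R]_n | forall i, A i (x ord0 i)].
Proof.
move=> mA; rewrite [X in measurable X](_ : _ = \bigcap_(j in [set: 'I_n])
    ((fun y : 'rV[R]_n => y ord0 j) @^-1` A j)).
  apply: fin_bigcap_measurable => // j _; rewrite -[X in measurable X]setTI.
  by apply: measurable_coord_rV => //; exact: mA.
by apply/seteqP; split => x /=; [move=> + j _; exact|move=> + j; exact].
Qed.

Lemma measurable_ball_rV (c : 'rV[R]_n) (e : R) : measurable (ball c e).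
Proof.
have [e0|e0] := ltP 0 e; last first.
  rewrite (_ : ball _ _ = set0); first exact: measurable0.
  by rewrite -subset0 => x /ball_rVP[]; rewrite ltNge e0.
rewrite (_ : ball c e = [set x | forall i, (ball (c ord0 i) e) (x ord0 i)]).
  by apply: (@measurable_rV_forall (fun i => ball (c ord0 i) e)) => i; exact: measurable_ball.
by apply/seteqP; split=> x; [move=> /ball_rVP[]|move=> cx; apply/ball_rVP].
Qed.

Lemma open_rVE U : open U ->
  U = \bigcup_(p in [set p | rat_ball p 2 `<=` U]) rat_ball p 1.
Proof.
move=> oU; apply/seteqP; split=> x.
  by move=> /(open_rat_ball oU)[p [pU px]]; exists p.
move=> [p pU /ball_rVP[d0 px]]; apply: pU; apply/ball_rVP.
split; first by rewrite mul1r in d0; rewrite mulr_gt0.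
by move=> i; apply: lt_le_trans (px i) _; rewrite ler_pM2r ?ler1n// -[p.2.+1%:R^-1]mul1r.
Qed.

Lemma countable_bigcup_measurable d (T : measurableType d) (I : countType)
    (P : set I) (F : I -> set T) :
  (forall i, measurable (F i)) -> measurable (\bigcup_(i in P) F i).
Proof.
move=> mF; rewrite bigcup_mkcond; apply: countable_bigcupT_measurable => //.
by move=> i; case: ifP.
Qed.

(** The sigma-algebra is generated by the coordinates, so a countable cover by cubes is what links
    it to the topology. *)
Lemma open_measurable_rV U : open U -> measurable U.
Proof.
move=> oU; rewrite (open_rVE oU); apply: countable_bigcup_measurable => p.
exact: measurable_ball_rV.
Qed.

Lemma continuous_measurable_rV (f : 'rV[R]_n -> R) :
  continuous f -> measurable_fun setT f.
Proof.
move=> /continuousP cf mD; apply: (measurability _ (RGenOpens.measurableE R)) => //.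
move=> _ [_ [a [b ->] <-]]; rewrite setTI.
by apply: open_measurable_rV; apply: cf; exact: interval_open.
Qed.

End rV_borel.

Section smooth_functions.
Context {R : realType} {n : nat}.
Implicit Types (f g phi : 'rV[R]_n -> R) (i : 'I_n) (x : 'rV[R]_n).

Local Notation e_ i := (delta_mx ord0 i : 'rV[R]_n).

Lemma updE x i t : upd x i t = x + (t - x ord0 i) *: e_ i.
Proof.
apply/rowP => j; rewrite !mxE eqxx/=; case: eqVneq => [->|_].
  by rewrite mulr1 addrC subrK.
by rewrite mulr0 addr0.
Qed.

Lemma updD x i t h : upd x i (h + t) = h *: e_ i + upd x i t.
Proof. by rewrite !updE -addrA scalerDl addrCA. Qed.

Lemma upd_same x i : upd x i (x ord0 i) = x.
Proof. by rewrite updE subrr scale0r addr0. Qed.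

Lemma upd_coord x i t : upd x i t ord0 i = t.
Proof. by rewrite mxE eqxx. Qed.

Lemma is_derive_upd f x i (t : R) :
  (forall y, derivable f y (e_ i)) ->
  is_derive t (1 : R) (fun s => f (upd x i s)) (partial i f (upd x i t)).
Proof.
move=> df.
have E : (fun h => h^-1 *: (((fun s => f (upd x i s)) \o shift t) (h *: 1) - f (upd x i t))) =
   (fun h => h^-1 *: ((f \o shift (upd x i t)) (h *: e_ i) - f (upd x i t))).
  by apply/funext => h /=; rewrite -updD [h *: 1]mulr1.
split; first by rewrite /derivable E; exact: df.
by rewrite /partial /derive E.
Qed.

Lemma continuous_upd x i : continuous (fun t : R => upd x i t).
Proof.
move=> t; rewrite (_ : (fun _ => _) = (fun t => x + (t - x ord0 i) *: e_ i)).
  by apply: cvgD; [exact: cvg_cst|apply: cvgZl; apply: cvgB; [exact: cvg_id|exact: cvg_cst]].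
by apply/funext => s; rewrite updE.
Qed.

(** [smooth] speaks of all iterated partial derivatives at once; it is proved by exhibiting a class
    of functions stable under [partial]. *)
Lemma smooth_coind (S : set ('rV[R]_n -> R)) :
  (forall g, S g -> [/\ continuous g, forall x i, derivable g x (e_ i) &
    forall i, S (partial i g)]) ->
  forall f, S f -> smooth f.
Proof.
move=> HS f Sf s /=; have : S (foldr (@partial R n) f s).
  by elim: s => //= i s IH; have [_ _ ] := HS _ IH; exact.
by move=> /HS[].
Qed.

Lemma smooth_continuous f : smooth f -> continuous f.
Proof. by move=> /(_ [::])[]. Qed.

Lemma smooth_derivable f x i : smooth f -> derivable f x (e_ i).
Proof. by move=> /(_ [::])[]. Qed.

Lemma smooth_partial f i : smooth f -> smooth (partial i f).
Proof. by move=> sf s; have := sf (rcons s i); rewrite foldr_rcons. Qed.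

Lemma partial_cst (c : R) i : partial i (cst c) = cst 0.
Proof. by apply/funext => x; rewrite /partial derive_cst. Qed.

Lemma partialM f g i : smooth f -> smooth g ->
  partial i (f \* g) = (partial i f \* g) \+ (f \* partial i g).
Proof.
move=> sf sg; apply/funext => x; rewrite /partial deriveM//=;
  [|exact: smooth_derivable..].
by rewrite addrC; congr +%R; rewrite -[_ *: _]/(_ * _) mulrC.
Qed.

Lemma smooth_cst (c : R) : smooth (cst c : 'rV[R]_n -> R).
Proof.
apply: (@smooth_coind [set g | exists c : R, g = cst c]); last by exists c.
move=> _ [k ->]; split; first by move=> x; exact: cst_continuous.
  by move=> x i; exact: derivable_cst.
by move=> i; rewrite partial_cst; exists 0.
Qed.

(* Products of smooth functions are not stable under [partial i], finite sums
   of such products are. *)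
Inductive sum_of_products : ('rV[R]_n -> R) -> Prop :=
| sum_of_products1 f g : smooth f -> smooth g -> sum_of_products (f \* g)
| sum_of_productsD f g : sum_of_products f -> sum_of_products g ->
    sum_of_products (f \+ g).

Lemma sum_of_products_smooth f : sum_of_products f -> smooth f.
Proof.
apply: smooth_coind => {}f; elim=> {f} [f g sf sg|f g _ [cf df pf] _ [cg dg pg]].
  split.
  - by move=> x; apply: continuousM;
      [exact: (smooth_continuous sf)|exact: (smooth_continuous sg)].
  - by move=> x i; apply: derivableM; exact: smooth_derivable.
  - move=> i; rewrite partialM//; apply: sum_of_productsD;
      apply: sum_of_products1 => //; exact: smooth_partial.
split.
- by move=> x; apply: continuousD; [exact: cf|exact: cg].
- by move=> x i; apply: derivableD.
- move=> i; rewrite (_ : partial i _ = partial i f \+ partial i g).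
    exact: sum_of_productsD.
  by apply/funext => x; rewrite /partial deriveD.
Qed.

Lemma smoothM f g : smooth f -> smooth g -> smooth (f \* g).
Proof. by move=> sf sg; exact/sum_of_products_smooth/sum_of_products1. Qed.

Lemma smoothZ (c : R) f : smooth f -> smooth (fun x => c * f x).
Proof. by move=> sf; exact: (smoothM (smooth_cst c)). Qed.

(** A coordinatewise form of compact support, which passes to the slices [cons_rV (a, y)] and to
    lines [upd x i t]. *)
Definition bounded_support (M : R) f := forall x i, M <= `|x ord0 i| -> f x = 0.

Lemma bounded_supportM M f g : bounded_support M f -> bounded_support M (f \* g).
Proof. by move=> fM x i Mx /=; rewrite (fM x i)// mul0r. Qed.

Lemma bounded_supportMr M f g : bounded_support M g -> bounded_support M (f \* g).
Proof. by move=> gM x i Mx /=; rewrite (gM x i)// mulr0. Qed.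

(** The margin 1 provides a whole neighbourhood of the point on which [f] vanishes. *)
Lemma bounded_support_partial M f j : bounded_support M f ->
  bounded_support (M + 1) (partial j f).
Proof.
move=> fM x i Mx; rewrite /partial.
have -> : 'D_(e_ j) f x = 'D_(e_ j) (cst 0) x; last by rewrite derive_cst.
apply: near_eq_derive.
have : nbhs x [set y : 'rV[R]_n | ball (x ord0 i) 1 (y ord0 i)].
  exact: (@coord_continuous R 1 n ord0 i x _ (nbhsx_ballx _ _ ltr01)).
apply: filterS => y; rewrite /ball/= => xy; apply: (fM y i).
by have := ler_normD (x ord0 i - y ord0 i) (y ord0 i); rewrite subrK; lra.
Qed.

Lemma bounded_support_out M f x : bounded_support M f ->
  ~ (forall i, `[-M, M]%classic (x ord0 i)) -> f x = 0.
Proof.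
move=> fM nK; case: ((existsNP _).2 nK) => i; rewrite /= in_itv/= => /negP xi; apply: (fM x i).
by move: xi; rewrite -ler_norml -ltNge => /ltW.
Qed.

Lemma bounded_support_bounded M f : continuous f -> bounded_support M f ->
  exists2 C, 0 <= C & forall x, `|f x| <= C.
Proof.
move=> cf fM; pose K := [set x : 'rV[R]_n | forall i, `[-M, M]%classic (x ord0 i)].
have cK : compact K.
  by apply: (@rV_compact _ _ (fun=> `[-M, M]%classic)) => i; exact: segment_compact.
have /compact_bounded[B [_ HB]] : compact (f @` K).
  by apply: continuous_compact => //; exact: continuous_subspaceT.
exists (`|B| + 1) => [|x]; first by rewrite addr_ge0.
have [Kx|nKx] := pselect (K x).
  apply: (HB (`|B| + 1)); first by rewrite (le_lt_trans (ler_norm _))// ltrDl.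
  by exists x.
by rewrite (bounded_support_out fM nKx) normr0 addr_ge0.
Qed.

Local Notation mu := (lebesgue_rV R n).

Lemma integrable_bounded_support C M f : measurable_fun setT f ->
  (forall x, `|f x| <= C) -> bounded_support M f ->
  mu.-integrable setT (EFin \o f).
Proof.
move=> mf fC fM; pose K := [set x : 'rV[R]_n | forall i, `[-M, M]%classic (x ord0 i)].
have mK : measurable K.
  by apply: (@measurable_rV_forall R n (fun=> `[-M, M]%classic)).
have C0 : 0 <= C by exact: le_trans (fC 0).
have muK : (mu K < +oo)%E.
  rewrite (lebesgue_rV_prod (A := fun=> `[-M, M]%classic))//.
  have [M0|M0] := leP 0 (M - - M).
    under eq_bigr do rewrite lebesgue_measure_itv/=.
    under eq_bigr do rewrite lte_fin.
    case: ifP => _.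
      under eq_bigr do rewrite -EFinB.
      by rewrite prodEFin ltry.
    by rewrite (_ : (0%E : \bar R) = 0%:E)// prodEFin ltry.
  under eq_bigr do rewrite lebesgue_measure_itv/=.
  under eq_bigr do rewrite lte_fin ltNge -subr_le0 (ltW M0)/=.
  by rewrite (_ : (0%E : \bar R) = 0%:E)// prodEFin ltry.
apply/integrableP; split; first exact/measurable_EFinP.
apply: (@le_lt_trans _ _ (\int[mu]_x (C%:E * (\1_K x)%:E))%E).
  apply: ge0_le_integral => //.
  - by apply: measurableT_comp => //; exact/measurable_EFinP.
  - by apply: measurable_funeM; exact/measurable_EFinP/measurable_indic.
  - move=> x _; rewrite -EFinM lee_fin indicE.
    have [Kx|nKx] := pselect (K x).
      by rewrite mem_set// mulr1.
    by rewrite (bounded_support_out fM nKx) normr0 mulr_ge0.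
rewrite ge0_integralZl_EFin//; last exact/measurable_EFinP/measurable_indic.
by rewrite integral_indic// setIT lte_mul_pinfty.
Qed.

End smooth_functions.

(** * Integrals along coordinate lines and integration by parts *)

Section line_integrals.
Context {R : realType}.
Local Notation leb := (@lebesgue_measure R).

Lemma integral_derive (F f : R -> R) (a b : R) : a < b ->
  (forall t : R, is_derive t (1:R) F (f t)) -> continuous f ->
  (\int[leb]_(t in `[a, b]) (f t)%:E = (F b - F a)%:E)%E.
Proof.
move=> ab dF cf.
have cF : continuous F.
  by move=> t; apply/differentiable_continuous/derivable1_diffP; case: (dF t).
rewrite EFinB; apply: continuous_FTC2 => //.
- exact: continuous_subspaceT.
- split; first by move=> t _; case: (dF t).
  + exact/cvg_at_right_filter/cF.
  + exact/cvg_at_left_filter/cF.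
- by move=> t _; rewrite derive1E; case: (dF t).
Qed.

Lemma integral_derive_support0 (F f : R -> R) (M : R) :
  (forall t : R, is_derive t (1:R) F (f t)) -> continuous f ->
  (forall t, M <= `|t| -> F t = 0) -> (forall t, M <= `|t| -> f t = 0) ->
  (\int[leb]_t (f t)%:E = 0)%E.
Proof.
move=> dF cf FM fM; pose L : R := `|M| + 1.
have L0 : 0 < L by rewrite ltr_pwDr.
have ML : M <= L by rewrite (le_trans (ler_norm _))// lerDl.
rewrite -(_ : (\int[leb]_(t in `[(- L)%R, L]) (f t)%:E = 0)%E).
  rewrite [RHS]integral_mkcond/=; apply: eq_integral => t _.
  rewrite patchE; case: ifPn => //; rewrite notin_setE/= in_itv/= => /negP.
  rewrite -ler_norml -ltNge => Lt; rewrite fM// (le_trans ML)// ltW//.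
rewrite (integral_derive _ dF cf); last by rewrite gtrN.
by rewrite !FM ?subrr// ?normrN gtr0_norm.
Qed.

Lemma le_integral_derive (F f : R -> R) (M t : R) :
  (forall t : R, is_derive t (1:R) F (f t)) -> continuous f ->
  (forall t, M <= `|t| -> F t = 0) ->
  (`|F t|%:E <= \int[leb]_s `|f s|%:E)%E.
Proof.
(* The point [- L] is both to the left of [t] and outside the support, so F(t) is the integral of
   [f] from [- L] to [t]. *)
move=> dF cf FM; pose L : R := `|M| + `|t| + 1.
have Lt : - L < t.
  rewrite ltrNl /L; have := ler_norm (- t); rewrite normrN.
  by have := normr_ge0 M; lra.
have -> : F t = F t - F (- L).
  rewrite (FM (- L)) ?subr0// normrN (le_trans _ (ler_norm _))//.
  by rewrite /L; have := ler_norm M; have := normr_ge0 t; lra.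
have mf : measurable_fun setT f by exact: continuous_measurable_fun.
have := integral_derive Lt dF cf.
rewrite -[(`|_|)%:E]/(`|(_)%:E|)%E => <-.
apply: le_trans (le_abse_integral _ _ _) _ => //.
  by apply/measurable_EFinP; exact: measurable_funTS.
apply: ge0_subset_integral => //.
by apply/measurable_EFinP; exact: measurableT_comp.
Qed.

(** Fubini in the direction [i]: the coordinates before [i] are split off one at a time, and the
    swapped order of integration is used once [i] has come first. *)
Lemma integral_lines0 n (F : 'rV[R]_n -> R) (C M : R) (i : 'I_n) :
  measurable_fun setT F -> (forall x, `|F x| <= C) -> bounded_support M F ->
  (forall x, (\int[leb]_t (F (upd x i t))%:E = 0)%E) ->
  (\int[lebesgue_rV R n]_x (F x)%:E = 0)%E.
Proof.
elim: n F i => [F []//|n IH] F i mF FC FM F0.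
have iF := integrable_bounded_support mF FC FM.
case: (unliftP ord0 i) => [j ij|i0].
  rewrite (integral_cons iF); apply: integral0_eq => a _ /=.
  apply: (IH (fun y => F (cons_rV (a, y))) j).
  - exact: (measurableT_comp mF (measurable_cons_rV_slice a)).
  - by move=> y.
  - by move=> y k yk; apply: (FM _ (lift ord0 k)); rewrite cons_rVS.
  - move=> y; rewrite -[RHS](F0 (cons_rV (a, y))) ij.
    by under [RHS]eq_integral do rewrite upd_consS.
rewrite (integral_cons_swap iF); apply: integral0_eq => y _ /=.
rewrite -[RHS](F0 (cons_rV (0, y))) i0.
by under [RHS]eq_integral do rewrite upd_cons0.
Qed.

End line_integrals.

Section compact_smooth.
Context {R : realType} {n : nat}.
Implicit Types (f g phi : 'rV[R]_n -> R) (i : 'I_n).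
Local Notation leb := (@lebesgue_measure R).
Local Notation mu := (lebesgue_rV R n).

Lemma continuous_line f (x : 'rV[R]_n) i :
  continuous f -> continuous (fun t : R => f (upd x i t)).
Proof.
by move=> cf t; apply: continuous_comp; [exact: continuous_upd|exact: cf].
Qed.

Lemma le_norm_line_integral phi M x i : smooth phi -> bounded_support M phi ->
  (`|phi x|%:E <= \int[leb]_t `|partial i phi (upd x i t)|%:E)%E.
Proof.
move=> sp pM; rewrite -[in leLHS](upd_same x i).
apply: (@le_integral_derive _ (fun t => phi (upd x i t))
  (fun t => partial i phi (upd x i t)) M).
- by move=> t; apply: is_derive_upd => y; exact: smooth_derivable.
- exact/continuous_line/smooth_continuous/smooth_partial.
- by move=> t Mt; apply: (pM _ i); rewrite upd_coord.
Qed.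

Lemma smooth_support_bounded phi M : smooth phi -> bounded_support M phi ->
  exists2 C, 0 <= C & forall x, `|phi x| <= C.
Proof. by move=> /smooth_continuous; exact: bounded_support_bounded. Qed.

Lemma smooth_measurable phi : smooth phi -> measurable_fun setT phi.
Proof. by move=> /smooth_continuous; exact: continuous_measurable_rV. Qed.

Lemma smooth_integrable phi M : smooth phi -> bounded_support M phi ->
  mu.-integrable setT (EFin \o phi).
Proof.
move=> sp pM; have [C _ pC] := smooth_support_bounded sp pM.
exact: (integrable_bounded_support (smooth_measurable sp) pC pM).
Qed.

Lemma integral_partial0 phi M i : smooth phi -> bounded_support M phi ->
  (\int[mu]_x (partial i phi x)%:E = 0)%E.
Proof.
move=> sp pM; have sp' := smooth_partial i sp.
have pM' := bounded_support_partial i pM.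
have [C _ pC] := smooth_support_bounded sp' pM'.
apply: (integral_lines0 (smooth_measurable sp') pC pM' (i := i)) => x.
apply: (@integral_derive_support0 _ (fun t => phi (upd x i t)) _ (M + 1)).
- by move=> t; apply: is_derive_upd => y; exact: smooth_derivable.
- exact/continuous_line/smooth_continuous.
- by move=> t Mt; apply: (pM _ i); rewrite upd_coord; lra.
- by move=> t Mt; apply: (pM' _ i); rewrite upd_coord.
Qed.

Lemma integration_by_parts f phi M i :
  smooth f -> smooth phi -> bounded_support M phi ->
  (\int[mu]_x (f x * partial i phi x)%:E =
   - \int[mu]_x (partial i f x * phi x)%:E)%E.
Proof.
move=> sf sp pM.
have M1 : bounded_support (M + 1) phi by move=> x j Mx; apply: (pM x j); lra.
have s1 : smooth (partial i f \* phi) by apply: smoothM => //; exact: smooth_partial.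
have s2 : smooth (f \* partial i phi) by apply: smoothM => //; exact: smooth_partial.
have i1 := smooth_integrable s1 (bounded_supportMr _ M1).
have i2 := smooth_integrable s2
  (bounded_supportMr _ (bounded_support_partial i pM)).
have := integral_partial0 i (smoothM sf sp) (bounded_supportMr _ pM).
rewrite partialM//.
under eq_integral do rewrite EFinD.
rewrite integralD//.
have := integrable_fin_num measurableT i1.
have := integrable_fin_num measurableT i2.
move=> /fineK <- /fineK <-; rewrite -EFinD => -[] /eqP.
by rewrite addrC addr_eq0 => /eqP ->; rewrite EFinN.
Qed.

Lemma test_function_bounded_support (Omega : set 'rV[R]_n) phi :
  test_function Omega phi -> exists M, bounded_support M phi.
Proof.
move=> [_ cK _]; have [B [_ HB]] := compact_bounded cK.
exists (`|B| + 2) => x i xi; apply: contrapT => /eqP px.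
have : `|x| <= `|B| + 1.
  apply: (HB (`|B| + 1)); first by rewrite (le_lt_trans (ler_norm _))// ltrDl.
  exact: subset_closure.
suff : `|x ord0 i| <= `|x| by lra.
rewrite [leRHS]mx_normrE.
exact: (le_bigmax _ (fun ij : 'I_1 * 'I_n => `|x ij.1 ij.2|) (ord0, i)).
Qed.

End compact_smooth.

(** * Poincare and Sobolev inequalities for test functions *)

Section sobolev_inequalities.
Context {R : realType}.
Local Notation leb := (@lebesgue_measure R).
Local Notation mu := (lebesgue_rV R).
Local Open Scope ereal_scope.

(** Young's inequality for 2 * phi * partial phi. The weight [e] is taken small in the Poincare
    inequality, to absorb a term, and equal to 1 in [weak_sobolev]. *)
Lemma le_norm_partial_sqr n (phi : 'rV[R]_n -> R) (i : 'I_n) (e : R) x :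
  smooth phi -> (0 < e)%R ->
  (`|partial i (phi \* phi)%R x| <= e * phi x ^+ 2 + e^-1 * partial i phi x ^+ 2)%R.
Proof.
move=> sp e0; rewrite partialM//=; set a := phi x; set b := partial i phi x.
have -> : (b * a + a * b = 2 * (a * b))%R by ring.
have ie0 : (0 < e^-1)%R by rewrite invr_gt0.
have ei : (e * e^-1 = 1)%R by rewrite divff// gt_eqF.
have h1 : (0 <= e * (a - e^-1 * b) ^+ 2)%R by rewrite mulr_ge0 ?sqr_ge0// ltW.
have h2 : (0 <= e * (a + e^-1 * b) ^+ 2)%R by rewrite mulr_ge0 ?sqr_ge0// ltW.
have E1 : (e * (a - e^-1 * b) ^+ 2 = e * a ^+ 2
    - 2 * (e * e^-1) * (a * b) + (e * e^-1) * e^-1 * b ^+ 2)%R by ring.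
have E2 : (e * (a + e^-1 * b) ^+ 2 = e * a ^+ 2
    + 2 * (e * e^-1) * (a * b) + (e * e^-1) * e^-1 * b ^+ 2)%R by ring.
rewrite E1 ei in h1; rewrite E2 ei in h2.
by rewrite ler_norml; apply/andP; split; lra.
Qed.

Lemma smooth_sqr n (phi : 'rV[R]_n -> R) : smooth phi ->
  smooth (fun x => (phi x ^+ 2)%R).
Proof.
move=> sp; rewrite (_ : (fun _ => _) = (phi \* phi)%R); first exact: smoothM.
by apply/funext => x; rewrite expr2.
Qed.

Lemma bounded_support_sqr n M (phi : 'rV[R]_n -> R) : bounded_support M phi ->
  bounded_support M (fun x => (phi x ^+ 2)%R).
Proof. by move=> pM x i Mx; rewrite (pM x i)// expr0n. Qed.

(** phi^2 at a point is at most the integral of its derivative's absolute value over the line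
    through the point; integrating over a width 2L costs a factor 2L. With the weight 1/(4L) in
    Young's inequality this yields half of the integral of phi^2, which is finite and can be
    absorbed on the left, plus 8 L^2 times that of the squared derivative. *)
Lemma poincare_slab m (phi : 'rV[R]_m.+1 -> R) (M L : R) :
  smooth phi -> bounded_support M phi -> (0 < L)%R ->
  (forall x : 'rV[R]_m.+1, (L <= `|x ord0 ord0|)%R -> phi x = 0%R) ->
  \int[mu m.+1]_x (phi x ^+ 2)%:E <=
  (16 * L ^+ 2)%:E * \int[mu m.+1]_x (partial ord0 phi x ^+ 2)%:E.
Proof.
move=> sp pM L0 pL.
have spp : smooth (phi \* phi)%R by exact: smoothM.
have ppM : bounded_support M (phi \* phi)%R by exact: bounded_supportM.
set p := partial ord0 (phi \* phi)%R.
have sp' := smooth_partial ord0 sp.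
have pM' := bounded_support_partial ord0 pM.
have mp : measurable_fun setT p := smooth_measurable (smooth_partial _ spp).
have mphi := smooth_measurable sp.
have mphi2 := smooth_measurable (smooth_sqr sp).
pose H y := \int[leb]_t `|p (cons_rV (t, y))|%:E.
have H0 y : 0 <= H y by apply: integral_ge0 => t _; rewrite lee_fin normr_ge0.
have lebI : leb `](- L)%R, L[%classic = (2 * L)%:E.
  rewrite lebesgue_measure_itv/= lte_fin gtrN//= -EFinB opprK.
  by congr EFin; ring.
have le1 : \int[mu m.+1]_x (phi x ^+ 2)%:E <=
    (2 * L)%:E * \int[mu m.+1]_x `|p x|%:E.
  rewrite ge0_integral_cons_swap; last 2 first.
  - exact/measurable_EFinP.
  - by move=> x; rewrite lee_fin sqr_ge0.
  rewrite [in leRHS]ge0_integral_cons_swap; last 2 first.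
  - by apply/measurable_EFinP; exact: measurableT_comp.
  - by move=> x; rewrite lee_fin.
  have mH : measurable_fun setT H.
    apply: (measurable_fun_fubini_tonelli_G (m1 := leb)
      (EFin \o (fun x => `|p x|%R) \o cons_rV)).
      apply: measurableT_comp; last exact: measurable_cons_rV.
      by apply/measurable_EFinP; exact: measurableT_comp.
    by move=> x; rewrite /= lee_fin.
  rewrite -ge0_integralZl_EFin//; last 2 first.
  - by move=> y _; apply: integral_ge0 => t _; rewrite lee_fin normr_ge0.
  - by rewrite mulr_ge0// ltW.
  apply: ge0_le_integral => //.
  - by move=> y _; apply: integral_ge0 => t _; rewrite lee_fin sqr_ge0.
  - apply: (measurable_fun_fubini_tonelli_G (m1 := leb)
      (EFin \o (fun x => (phi x ^+ 2)%R) \o cons_rV)).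
      apply: measurableT_comp; last exact: measurable_cons_rV.
      exact/measurable_EFinP.
    by move=> x; rewrite /= lee_fin sqr_ge0.
  - exact: measurable_funeM.
  move=> y _; apply: (@le_trans _ _
      (\int[leb]_a (H y * (\1_(`](- L)%R, L[%classic) a)%:E))).
    apply: ge0_le_integral => //.
    + by move=> a _; rewrite lee_fin sqr_ge0.
    + apply/measurable_EFinP.
      exact: (measurableT_comp mphi2 (measurable_cons_rV_line y)).
    + by apply: measurable_funeM; exact/measurable_EFinP/measurable_indic.
    + move=> a _; rewrite indicE; case: (boolP (_ \in _)) => /= [_|].
        rewrite mule1 /H.
        have := le_norm_line_integral (cons_rV (a, y)) ord0 spp ppM.
        under eq_integral do rewrite upd_cons0.
        by rewrite /= -expr2 ger0_norm// sqr_ge0.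
      rewrite notin_setE/= in_itv/= => /negP; rewrite -ltr_norml -leNgt => La.
      by rewrite pL ?cons_rV0// expr0n/= mule0.
  rewrite ge0_integralZl//; last first.
    exact/measurable_EFinP/measurable_indic.
  by rewrite integral_indic// setIT [X in H y * X]lebI muleC.
have i1 := smooth_integrable (smooth_sqr sp) (bounded_support_sqr pM).
have i2 := smooth_integrable (smooth_sqr sp') (bounded_support_sqr pM').
have f1 : \int[mu m.+1]_x (phi x ^+ 2)%:E \is a fin_num.
  exact: (integrable_fin_num measurableT i1).
have f2 : \int[mu m.+1]_x (partial ord0 phi x ^+ 2)%:E \is a fin_num.
  exact: (integrable_fin_num measurableT i2).
have le2 : \int[mu m.+1]_x `|p x|%:E <=
    ((4 * L)^-1)%:E * \int[mu m.+1]_x (phi x ^+ 2)%:E +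
    (4 * L)%:E * \int[mu m.+1]_x (partial ord0 phi x ^+ 2)%:E.
  have mp2 := smooth_measurable (smooth_sqr sp').
  have L40 : (0 < (4 * L)^-1)%R by rewrite invr_gt0 mulr_gt0.
  rewrite -ge0_integralZl_EFin//; last 3 first.
  - by move=> x _; rewrite lee_fin sqr_ge0.
  - exact/measurable_EFinP.
  - exact: ltW.
  rewrite -ge0_integralZl_EFin//; last 3 first.
  - by move=> x _; rewrite lee_fin sqr_ge0.
  - exact/measurable_EFinP.
  - by rewrite mulr_ge0// ltW.
  rewrite -ge0_integralD//; last 4 first.
  - by move=> x _; rewrite -EFinM lee_fin mulr_ge0 ?sqr_ge0// ltW.
  - by apply: measurable_funeM; exact/measurable_EFinP.
  - by move=> x _; rewrite -EFinM lee_fin mulr_ge0 ?sqr_ge0// ?mulr_ge0// ltW.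
  - by apply: measurable_funeM; exact/measurable_EFinP.
  apply: ge0_le_integral => //.
  - by apply/measurable_EFinP; exact: measurableT_comp.
  - by apply: emeasurable_funD; apply: measurable_funeM; exact/measurable_EFinP.
  move=> x _; rewrite -!EFinM -EFinD lee_fin.
  by have := le_norm_partial_sqr ord0 x sp L40; rewrite invrK.
move: le1 le2; rewrite -(fineK f1) -(fineK f2) => le1 le2.
have := le_trans le1 (@lee_wpmul2l _ (2 * L)%:E _ _ _ le2).
rewrite -!EFinM !lee_fin mulr_ge0 ?(ltW L0)// => /(_ isT).
set a := fine _; set b := fine _.
have -> : (2 * L * ((4 * L)^-1 * a + 4 * L * b) = a / 2 + 8 * L ^+ 2 * b)%R.
  by field; rewrite gt_eqF.
by lra.
Qed.

(** Slicing is applied to phi^2 / d^2, dominated on each line by the integral of its own derivative.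
    The factor n+1 counts the integral of phi^2, which occurs once for the function and once in each
    of the n Young inequalities. *)
Lemma weak_sobolev n (phi : 'rV[R]_n -> R) (M d q : R) :
  smooth phi -> bounded_support M phi -> (0 < d)%R ->
  \int[mu n]_x (phi x ^+ 2)%:E +
    \sum_(i < n) \int[mu n]_x (partial i phi x ^+ 2)%:E <= q%:E ->
  mu n [set x | (d <= `|phi x|)%R] < +oo /\
  (fine (mu n [set x | (d <= `|phi x|)%R]) ^+ n.+1 <=
    (n.+1%:R / d ^+ 2 * q) ^+ n.+2)%R.
Proof.
move=> sp pM d0 leq.
have spp : smooth (phi \* phi)%R by exact: smoothM.
have ppM : bounded_support M (phi \* phi)%R by exact: bounded_supportM.
have -> : [set x | (d <= `|phi x|)%R] =
    [set x | (1 <= d ^- 2 * (phi x ^+ 2))%R].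
  apply/seteqP; split=> x /=;
    rewrite mulrC ler_pdivlMr ?exprn_gt0// mul1r -[(phi x ^+ 2)%R]real_normK ?num_real//;
    by rewrite ler_pXn2r// nnegrE ltW.
have d2 : (0 < d ^- 2)%R by rewrite invr_gt0 exprn_gt0.
have mphi2 := smooth_measurable (smooth_sqr sp).
apply: (@weak_loomis_whitney _ _ _
  (fun i x => (d ^- 2 * `|partial i (phi \* phi)%R x|)%R)).
- exact: measurable_funM.
- by move=> x; rewrite mulr_ge0 ?sqr_ge0// ltW.
- move=> i; apply: measurable_funM => //; apply: measurableT_comp => //.
  exact: (smooth_measurable (smooth_partial i spp)).
- by move=> i x; rewrite mulr_ge0// ltW.
- move=> x i; under eq_integral do rewrite EFinM.
  rewrite ge0_integralZl_EFin//; last 2 first.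
  + apply/measurable_EFinP; apply: measurableT_comp => //.
    apply: continuous_measurable_fun.
    by apply: continuous_line; exact: (smooth_continuous (smooth_partial i spp)).
  + exact: ltW.
  rewrite EFinM; apply: lee_wpmul2l; first by rewrite lee_fin ltW.
  have := le_norm_line_integral x i spp ppM.
  by rewrite /= -expr2 ger0_norm// sqr_ge0.
have mp i : measurable_fun setT (fun x => (partial i phi x ^+ 2)%R).
  exact: (smooth_measurable (smooth_sqr (smooth_partial i sp))).
have iZ (g : 'rV[R]_n -> R) : measurable_fun setT g -> (forall x, (0 <= g x)%R) ->
    \int[mu n]_x (d ^- 2 * g x)%:E = (d ^- 2)%:E * \int[mu n]_x (g x)%:E.
  move=> mg g0; under eq_integral do rewrite EFinM.
  rewrite ge0_integralZl_EFin//; [|exact/measurable_EFinP|exact: ltW].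
  by move=> x _; rewrite lee_fin.
rewrite iZ//; last by move=> x; exact: sqr_ge0.
have le_h i : \int[mu n]_x (d ^- 2 * `|partial i (phi \* phi)%R x|)%:E <=
   (d ^- 2)%:E * (\int[mu n]_x (phi x ^+ 2)%:E + \int[mu n]_x (partial i phi x ^+ 2)%:E).
  rewrite iZ//; last first.
    by apply: measurableT_comp => //; exact: (smooth_measurable (smooth_partial i spp)).
  apply: lee_wpmul2l; first by rewrite lee_fin ltW.
  rewrite -ge0_integralD//; last 4 first.
  - by move=> x _; rewrite lee_fin sqr_ge0.
  - exact/measurable_EFinP.
  - by move=> x _; rewrite lee_fin sqr_ge0.
  - exact/measurable_EFinP.
  apply: ge0_le_integral => //.
  - apply/measurable_EFinP; apply: measurableT_comp => //.
    exact: (smooth_measurable (smooth_partial i spp)).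
  - by apply: emeasurable_funD; exact/measurable_EFinP.
  move=> x _; rewrite -EFinD lee_fin.
  by have := le_norm_partial_sqr i x sp ltr01; rewrite invr1 !mul1r.
apply: le_trans (leeD2l _ (lee_sum _ (fun i _ => le_h i))) _.
move: leq; set a := \int[mu n]_x (phi x ^+ 2)%:E.
have a0 : 0 <= a by apply: integral_ge0 => x _; rewrite lee_fin sqr_ge0.
pose b i := \int[mu n]_x (partial i phi x ^+ 2)%:E.
have b0 i : 0 <= b i by apply: integral_ge0 => x _; rewrite lee_fin sqr_ge0.
change (a + \sum_(i < n) b i <= q%:E ->
  (d ^- 2)%:E * a + \sum_(i < n) ((d ^- 2)%:E * (a + b i)) <=
  (n.+1%:R / d ^+ 2 * q)%:E) => leq.
have aq : a <= q%:E by apply: le_trans leq; rewrite leeDl// sume_ge0.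
have bfin i : b i \is a fin_num.
  rewrite ge0_fin_numE//; apply: le_lt_trans (ltry q); apply: le_trans leq.
  by rewrite (bigD1 i)//= addeCA leeDl// adde_ge0// sume_ge0.
have afin : a \is a fin_num by rewrite ge0_fin_numE// (le_lt_trans aq)// ltry.
have bE : b = (fun i => (fine (b i))%:E) by apply/funext => i; rewrite fineK.
move: aq leq; rewrite -(fineK afin) bE.
under [X in _ -> _ -> _ + X <= _]eq_bigr do rewrite -EFinD -EFinM.
rewrite !sumEFin -!EFinM -!EFinD !lee_fin => aq leq.
rewrite -mulr_sumr big_split/= sumr_const card_ord -mulrDr.
rewrite [leRHS]mulrAC [leRHS]mulrC ler_pM2l//.
have : (fine a *+ n <= n%:R * q)%R by rewrite -[leLHS]mulr_natl ler_wpM2l.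
by rewrite -natr1 mulrDl mul1r; lra.
Qed.

End sobolev_inequalities.

(** * Smooth cut-off functions *)

Section bump_functions.
Context {R : realType}.
Implicit Types (p : {poly R}) (t : R).

(* [flat 1] is the usual smooth function [exp(-1/t)]; the polynomial makes the
   family stable under derivation. *)
Definition flat p t : R := if 0 < t then p.[t^-1] * expR (- t^-1) else 0.

(** With s = 1/t, the chain rule turns p(s) exp(-s) into s^2 (p(s) - p'(s)) exp(-s). *)
Definition flat' p : {poly R} := 'X^2 * (p - p^`()).

(** Term by term, from s^k <= k! exp(s). *)
Lemma horner_le_expR p : exists2 C, 0 <= C &
  forall s : R, 0 <= s -> `|p.[s]| <= C * expR s.
Proof.
exists (\sum_(i < size p) `|p`_i| * i`!%:R) => [|s s0].
  by apply: sumr_ge0 => i _; rewrite mulr_ge0.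
rewrite horner_coef (le_trans (ler_norm_sum _ _ _))// mulr_suml.
apply: ler_sum => i _; rewrite normrM -mulrA ler_wpM2l// normrX ger0_norm//.
case: (i : nat) => [|k]; first by rewrite expr0 mul1r -expR0 ler_expR.
have := expR_ge1Dxn k s0; have f0 : (0:R) < k.+1`!%:R by rewrite ltr0n fact_gt0.
move=> h; rewrite mulrC -ler_pdivrMr//; apply: le_trans h.
by rewrite lerDr.
Qed.

Lemma flat_le0 p t : t <= 0 -> flat p t = 0.
Proof. by move=> t0; rewrite /flat ltNge t0. Qed.

Lemma flat_bounded p : exists2 C, 0 <= C & forall t, `|flat p t| <= C.
Proof.
have [C C0 pC] := horner_le_expR p; exists C => // t.
have [t0|t0] := leP t 0; first by rewrite flat_le0// normr0.
rewrite /flat t0 normrM (ger0_norm (expR_ge0 _)) expRN ler_pdivrMr ?expR_gt0//.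
by apply: pC; rewrite invr_ge0 ltW.
Qed.

Lemma flat_mulX p t : flat p t = t * flat ('X * p) t.
Proof.
rewrite /flat; case: ifPn => [t0|_]; last by rewrite mulr0.
by rewrite hornerM hornerX !mulrA divff ?mul1r// gt_eqF.
Qed.

Lemma is_derive_flat p t : is_derive t (1 : R) (flat p) (flat (flat' p) t).
Proof.
have [t0|t0|->] := ltgtP t 0.
- rewrite flat_le0 ?ltW//.
  apply: (near_eq_is_derive (f := cst (0:R))).
  by near=> s; rewrite flat_le0// ltW//; near: s; exact: lt_nbhsl.
- pose G s := p.[s] * expR (- s).
  apply: (near_eq_is_derive (f := G \o GRing.inv)).
    by near=> s; rewrite /G /flat /= ifT//; near: s; exact: lt_nbhsr.
  have dG s : is_derive s (1:R) G (p^`().[s] * expR (- s) - p.[s] * expR (- s)).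
    have : is_derive s (1:R) (horner p * (expR \o -%R))
      (p.[s] *: (expR (- s) * (- 1)) + expR (- s) *: p^`().[s]).
      apply: is_deriveM; apply: is_derive1_comp.
    by move=> h; apply: (is_derive_eq h); rewrite /GRing.scale/=; ring.
  have dV : is_derive t (1:R) (@GRing.inv R) (- t ^- 2).
    have := @is_deriveV R id t 1 1; rewrite gt_eqF// => /(_ isT (is_derive_id _ _)) h.
    by apply: (is_derive_eq h); rewrite /GRing.scale/= mulr1.
  have h := is_derive1_comp (dG t^-1) dV.
  apply: (is_derive_eq h); rewrite /flat t0 /flat' hornerM hornerXn hornerD hornerN exprVn.
  by ring.
(* At 0, extracting a factor h twice by [flat_mulX] leaves a bounded function of the same family, so
   the difference quotient is O(h). The constant C + 1 avoids dividing by zero. *)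
- rewrite flat_le0//; have [C C0 fC] := flat_bounded ('X * ('X * p)).
  have C1 : 0 < C + 1 by rewrite ltr_pwDr.
  have q0 : h^-1 *: ((flat p \o shift 0) (h *: 1) - flat p 0) @[h --> (0:R)^'] --> (0:R).
    apply/cvgr0Pnorm_lt => e e0; near=> h.
    have h0 : h != 0 by near: h; exact: nbhs_dnbhs_neq.
    rewrite /= addr0 [h *: 1]mulr1 [flat p 0]flat_le0// subr0.
    rewrite flat_mulX [flat ('X * p) h]flat_mulX [_ *: _]mulrA mulVf// mul1r.
    rewrite normrM (@le_lt_trans _ _ (`|h| * C))// ?ler_wpM2l//.
    rewrite (@le_lt_trans _ _ (`|h| * (C + 1)))// ?ler_wpM2l ?lerDl//.
    rewrite -ltr_pdivlMr//; near: h; apply: dnbhs0_lt.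
    by rewrite divr_gt0.
  split; first by apply/cvg_ex; exists 0.
  exact: cvg_lim q0.
Unshelve. all: by end_near. Qed.

Lemma flat1E t : 0 < t -> flat 1 t = expR (- t^-1).
Proof. by move=> t0; rewrite /flat t0 hornerC mul1r. Qed.

Lemma flat1_ge0 t : 0 <= flat 1 t.
Proof.
have [t0|t0] := leP t 0; first by rewrite flat_le0.
by rewrite flat1E// expR_ge0.
Qed.

Lemma flat1_le1 t : flat 1 t <= 1.
Proof.
have [t0|t0] := leP t 0; first by rewrite flat_le0.
by rewrite flat1E// -expR0 ler_expR oppr_le0 invr_ge0 ltW.
Qed.

Section rV.
Context {n : nat}.
Local Notation e_ i := (delta_mx ord0 i : 'rV[R]_n).

Lemma is_derive_coord (G : R -> R) (dG : R) (i j : 'I_n) (x : 'rV[R]_n) :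
  is_derive (x ord0 i) (1:R) G dG ->
  is_derive x (e_ j) (fun y : 'rV[R]_n => G (y ord0 i)) (if i == j then dG else 0).
Proof.
move=> HG.
pose q (h : R) := h^-1 *:
  (((fun y : 'rV[R]_n => G (y ord0 i)) \o shift x) (h *: e_ j) - G (x ord0 i)).
have qE : q = (fun h => h^-1 *:
    ((G \o shift (x ord0 i)) ((if i == j then h else 0) *: (1:R)) - G (x ord0 i))).
  apply/funext => h; rewrite /q /= !mxE eqxx/=.
  by case: eqVneq => _; rewrite ?mulr1 ?mulr0 ?scale0r// [_ *: 1]mulr1.
have : q h @[h --> (0:R)^'] --> (if i == j then dG else 0).
  rewrite qE; case: eqVneq => _; first by case: HG => + <-.
  rewrite (_ : (fun _ => _) = cst 0); first exact: cvg_cst.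
  by apply/funext => h; rewrite scale0r /= add0r subrr scaler0.
move=> cq; split; first by apply/cvg_ex; eexists; exact: cq.
by rewrite /derive; exact: cvg_lim cq.
Qed.

Lemma smooth_flat_coord p (i : 'I_n) (a b : R) :
  smooth (fun x : 'rV[R]_n => flat p (a * x ord0 i + b)).
Proof.
pose S := [set g : 'rV[R]_n -> R | exists p (c : R),
  g = fun x => c * flat p (a * x ord0 i + b)].
have dF q (c : R) t : is_derive t (1:R) (fun s => c * flat q (a * s + b))
    (c * a * flat (flat' q) (a * t + b)).
  have d1 : is_derive t (1:R) (fun s : R => a * s + b) a.
    have : is_derive t (1:R) ((a \*: id) + cst b) (a *: 1 + 0).
      by apply: is_deriveD.
    by move=> h; apply: (is_derive_eq h); rewrite addr0 [_ *: _]mulr1.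
  have d2 := @is_derive1_comp R (flat q) (fun s => a * s + b) t _ a
    (is_derive_flat q (a * t + b)) d1.
  have h := is_deriveZ c d2; apply: (is_derive_eq h).
  by rewrite /GRing.scale/=; ring.
apply: (@smooth_coind _ _ S); last first.
  by exists p, 1; apply/funext => x; rewrite mul1r.
move=> _ [q [c ->]].
have dq j (x : 'rV[R]_n) := is_derive_coord j (dF q c (x ord0 i)).
split.
- move=> x.
  have cq : continuous (fun s => c * flat q (a * s + b)).
    move=> t; apply/differentiable_continuous/derivable1_diffP.
    by case: (dF q c t).
  exact: (continuous_comp (@coord_continuous R 1 n ord0 i x) (cq _)).
- by move=> x j; case: (dq j x).
- move=> j; exists (flat' q), (if i == j then c * a else 0).
  apply/funext => x; rewrite /partial; case: (dq j x) => _ ->.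
  by case: eqP; rewrite ?mul0r.
Qed.

Definition box (a b : 'rV[R]_n) : set 'rV[R]_n :=
  [set x | forall i, `]a ord0 i, b ord0 i[%classic (x ord0 i)].

Definition cbox (a b : 'rV[R]_n) : set 'rV[R]_n :=
  [set x | forall i, `[a ord0 i, b ord0 i]%classic (x ord0 i)].

(** Since exp(-1/(k t)) tends to 1, increasing [k] makes these functions converge to the indicator
    of the open box. They serve both to test weak identities on boxes and as the plateau of the test
    path. *)
Definition bump (k : R) (a b x : 'rV[R]_n) : R :=
  \prod_i (flat 1 (k * (x ord0 i - a ord0 i)) * flat 1 (k * (b ord0 i - x ord0 i))).

Lemma smooth_bump k a b : smooth (bump k a b).
Proof.
rewrite /bump (_ : (fun x => _) = \big[(fun f g => f \* g)/cst 1]_i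
  ((fun x : 'rV[R]_n => flat 1 (k * x ord0 i + - k * a ord0 i)) \*
   (fun x : 'rV[R]_n => flat 1 (- k * x ord0 i + k * b ord0 i)))); last first.
  apply/funext => x; rewrite (big_morph (fun f : 'rV[R]_n -> R => f x) (id1 := 1) (op1 := *%R))//.
  apply: eq_bigr => i _ /=; congr (flat 1 _ * flat 1 _); ring.
elim/big_ind: _ => [|f g|i _]; [exact: smooth_cst|exact: smoothM|].
by apply: smoothM; exact: smooth_flat_coord.
Qed.

Lemma bump_ge0 k a b x : 0 <= bump k a b x.
Proof. by apply: prodr_ge0 => i _; rewrite mulr_ge0 ?flat1_ge0. Qed.

Lemma bump_le1 k a b x : bump k a b x <= 1.
Proof.
apply: prodr_ile1 => i _; rewrite mulr_ge0 ?flat1_ge0//=.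
by rewrite -[leRHS]mulr1 ler_pM ?flat1_ge0 ?flat1_le1.
Qed.

Lemma bump_out k a b x : 0 < k -> ~ box a b x -> bump k a b x = 0.
Proof.
move=> k0 nx; case: ((existsNP _).2 nx) => i /=; rewrite in_itv/= => /negP.
rewrite negb_and -!leNgt => h; rewrite /bump (bigD1 i)//=.
suff -> : flat 1 (k * (x ord0 i - a ord0 i)) * flat 1 (k * (b ord0 i - x ord0 i)) = 0.
  by rewrite mul0r.
case/orP: h => h; first by rewrite flat_le0 ?mul0r// pmulr_rle0// subr_le0.
by rewrite mulrC flat_le0 ?mul0r// pmulr_rle0// subr_le0.
Qed.

Lemma compact_cbox a b : compact (cbox a b).
Proof.
apply: (@rV_compact _ _ (fun i => `[a ord0 i, b ord0 i]%classic)) => i.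
exact: segment_compact.
Qed.

Lemma closed_cbox a b : closed (cbox a b).
Proof.
by apply: compact_closed; [exact: norm_hausdorff|exact: compact_cbox].
Qed.

Lemma test_function_supported (Omega : set 'rV[R]_n) phi a b : smooth phi ->
  (forall x, ~ cbox a b x -> phi x = 0) -> cbox a b `<=` Omega ->
  test_function Omega phi.
Proof.
move=> sp pab abO.
have cab : closure [set x | phi x != 0] `<=` cbox a b.
  rewrite [X in _ `<=` X](closure_id _).1; last exact: closed_cbox.
  by apply: closure_subset => x /= px; apply: contrapT => /pab /eqP; rewrite (negbTE px).
split=> //; last exact: subset_trans abO.
by apply: subclosed_compact cab; [exact: closed_closure|exact: compact_cbox].
Qed.

Lemma box_cbox a b : box a b `<=` cbox a b.
Proof.
by move=> x /= xab i; have := xab i; rewrite /= !in_itv/= => /andP[/ltW-> /ltW->].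
Qed.

Lemma test_function_bump (Omega : set 'rV[R]_n) k a b : 0 < k ->
  cbox a b `<=` Omega -> test_function Omega (bump k a b).
Proof.
move=> k0 abO; apply: test_function_supported abO; first exact: smooth_bump.
by move=> x nx; rewrite bump_out// => /box_cbox.
Qed.

Lemma bump_cvg a b x : box a b x -> bump k.+1%:R a b x @[k --> \oo] --> (1:R).
Proof.
move=> xab; rewrite -[X in _ --> X](_ : \prod_(i < n) 1 = 1 :> R); last first.
  by rewrite big1.
have flat_cvg (t : R) : 0 < t -> flat 1 (k.+1%:R * t) @[k --> \oo] --> (1:R).
  move=> t0; rewrite -(_ : (fun k => expR (- (t^-1 * k.+1%:R^-1))) =
    (fun k : nat => flat 1 (k.+1%:R * t))).
    rewrite -[X in _ --> X]expR0; apply: continuous_cvg; first exact: continuous_expR.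
    rewrite -[X in _ --> X]oppr0; apply: cvgN; rewrite -[X in _ --> X](mulr0 t^-1).
    by apply: cvgMr; exact: cvg_harmonic.
  by apply/funext => k; rewrite flat1E ?mulr_gt0// invfM mulrC.
apply: (@cvg_big R _ *%R 1 xpredT (@mul_continuous R)).
move=> i _; rewrite -[X in _ --> X]mul1r.
have := xab i; rewrite /= in_itv/= => /andP[xa xb].
by apply: cvgM; apply: flat_cvg; rewrite subr_gt0.
Qed.

End rV.
End bump_functions.

(** * Weak derivatives and their uniqueness *)

Section square_integrable.
Context {R : realType} {n : nat}.
Implicit Types (Omega : set 'rV[R]_n) (f g h : 'rV[R]_n -> R).
Local Notation mu := (lebesgue_rV R n).

Lemma square_integrableP Omega f : measurable Omega ->
  square_integrable Omega f <-> measurable_fun Omega f /\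
    mu.-integrable Omega (fun x => (f x ^+ 2)%:E).
Proof.
move=> mO; split=> -[mf]; last first.
  move=> /integrableP[_ fi]; split => //; apply: le_lt_trans fi.
  apply: ge0_le_integral => //.
  - by move=> x _; rewrite lee_fin sqr_ge0.
  - by apply/measurable_EFinP; exact: measurable_funX.
  - by apply: measurableT_comp => //; apply/measurable_EFinP; exact: measurable_funX.
  - by move=> x _; exact: lee_abs.
move=> fi; split=> //; apply/integrableP; split.
  by apply/measurable_EFinP; exact: measurable_funX.
apply: le_lt_trans fi; apply: ge0_le_integral => //.
- by apply: measurableT_comp => //; apply/measurable_EFinP; exact: measurable_funX.
- by apply/measurable_EFinP; exact: measurable_funX.
- by move=> x _; rewrite /= lee_fin ger0_norm// sqr_ge0.
Qed.

Lemma integrable_mul_L2 Omega f g : measurable Omega ->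
  square_integrable Omega f -> square_integrable Omega g ->
  mu.-integrable Omega (fun x => (f x * g x)%:E).
Proof.
move=> mO /(square_integrableP _ mO)[mf fi] /(square_integrableP _ mO)[mg gi].
apply: (le_integrable mO _ _ (integrableD mO fi gi)).
  by apply/measurable_EFinP; exact: measurable_funM.
move=> x _; rewrite -EFinD /= lee_fin [leRHS]ger0_norm ?addr_ge0 ?sqr_ge0//.
have h1 : 0 <= (f x - g x) ^+ 2 by exact: sqr_ge0.
have h2 : 0 <= (f x + g x) ^+ 2 by exact: sqr_ge0.
have h3 : 0 <= f x ^+ 2 by exact: sqr_ge0.
have h4 : 0 <= g x ^+ 2 by exact: sqr_ge0.
by rewrite ler_norml; apply/andP; split; rewrite -subr_ge0; nra.
Qed.

Lemma square_integrableD Omega f g : measurable Omega ->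
  square_integrable Omega f -> square_integrable Omega g ->
  square_integrable Omega (f \+ g).
Proof.
move=> mO sf sg; have ifg := integrable_mul_L2 mO sf sg.
move/(square_integrableP _ mO) : sf => [mf fi].
move/(square_integrableP _ mO) : sg => [mg gi].
apply/square_integrableP => //; split; first exact: measurable_funD.
have i2 := integrableZl mO 2 ifg.
have := integrableD mO (integrableD mO fi gi) i2.
apply: eq_integrable => // x _ /=; rewrite -EFinM -!EFinD; congr EFin; ring.
Qed.

Lemma square_integrableZ Omega (c : R) f : measurable Omega ->
  square_integrable Omega f -> square_integrable Omega (fun x => c * f x).
Proof.
move=> mO /(square_integrableP _ mO)[mf fi].
apply/square_integrableP => //; split; first exact: measurable_funM.
have := integrableZl mO (c ^+ 2) fi.
by apply: eq_integrable => // x _; rewrite /= exprMn EFinM.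
Qed.

Lemma square_integrableB Omega f g : measurable Omega ->
  square_integrable Omega f -> square_integrable Omega g ->
  square_integrable Omega (f \- g).
Proof.
move=> mO sf sg; rewrite (_ : f \- g = f \+ (fun x => -1 * g x)).
  by apply: square_integrableD => //; exact: square_integrableZ.
by apply/funext => x /=; rewrite mulN1r.
Qed.

Lemma square_integrable_smooth Omega phi M : measurable Omega ->
  smooth phi -> bounded_support M phi -> square_integrable Omega phi.
Proof.
move=> mO sp pM; apply/square_integrableP => //.
split; first exact: (measurable_funTS (smooth_measurable sp)).
apply: (@integrableS _ _ _ _ setT) => //.
exact: (smooth_integrable (smooth_sqr sp) (bounded_support_sqr pM)).
Qed.

Lemma square_integrable_test Omega phi : measurable Omega ->
  test_function Omega phi -> square_integrable Omega phi.
Proof.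
move=> mO tp; have [M pM] := test_function_bounded_support tp.
by case: tp => sp _ _; exact: square_integrable_smooth pM.
Qed.

Lemma square_integrable_test_partial Omega phi i : measurable Omega ->
  test_function Omega phi -> square_integrable Omega (partial i phi).
Proof.
move=> mO tp; have [M pM] := test_function_bounded_support tp.
case: tp => sp _ _.
exact: (square_integrable_smooth mO (smooth_partial i sp)
  (bounded_support_partial i pM)).
Qed.

End square_integrable.

Section boxes.
Context {R : realType} {n : nat}.
Implicit Types (Omega : set 'rV[R]_n) (f g h : 'rV[R]_n -> R).
Local Notation mu := (lebesgue_rV R n).

Definition boxes : set (set 'rV[R]_n) := [set B | exists a b, B = box a b].

Lemma measurable_box (a b : 'rV[R]_n) : measurable (box a b).
Proof.
by apply: (@measurable_rV_forall _ _ (fun i => `]a ord0 i, b ord0 i[%classic)).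
Qed.

Lemma box_setI (a b a' b' : 'rV[R]_n) : box a b `&` box a' b' =
  box (\row_i Num.max (a ord0 i) (a' ord0 i)) (\row_i Num.min (b ord0 i) (b' ord0 i)).
Proof.
apply/seteqP; split=> x /=.
  move=> [ab ab'] i; have := ab i; have := ab' i; rewrite /= !in_itv/= !mxE.
  by rewrite gt_max lt_min => /andP[-> ->] /andP[-> ->].
move=> xab; split=> i; have := xab i; rewrite /= !in_itv/= !mxE gt_max lt_min.
  by move=> /andP[/andP[-> _] /andP[-> _]].
by move=> /andP[/andP[_ ->] /andP[_ ->]].
Qed.

Lemma boxes_setI : setI_closed boxes.
Proof.
by move=> _ _ [a [b ->]] [a' [b' ->]]; rewrite box_setI; eexists; eexists.
Qed.

(** A strip in one coordinate is a countable union of boxes whose other sides are []-k, k[]. As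
    boxes are stable under intersection, Dynkin's theorem applies to them. *)
Lemma boxesE : @measurable _ 'rV[R]_n = <<s boxes >>.
Proof.
apply/seteqP; split; last first.
  apply: smallest_sub; first exact: sigma_algebra_measurable.
  by move=> _ [a [b ->]]; exact: measurable_box.
move=> A mA.
pose id' : g_sigma_algebraType boxes -> 'rV[R]_n := id.
suff mid : measurable_fun setT id'.
  by have := mid measurableT _ mA; rewrite setTI.
apply: measurable_fun_rVP => i.
move=> mT; apply: (measurability _ (RGenOpens.measurableE R)) => //.
move=> _ [_ [a [b ->] <-]]; rewrite setTI.
rewrite [X in measurable X](_ : _ = \bigcup_k
   box (\row_j if j == i then a else - k%:R) (\row_j if j == i then b else k%:R)).
  by apply: bigcupT_measurable => k; apply: sub_sigma_algebra; eexists; eexists.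
apply/seteqP; split=> x /=.
  move=> xab; pose k := Num.bound (\sum_j `|x ord0 j|).
  exists k => // j; rewrite /= !mxE; case: eqVneq => [->//|ji].
  rewrite in_itv/= -ltr_norml.
  apply: le_lt_trans (archi_boundP _); last by rewrite sumr_ge0.
  by rewrite (bigD1 j)//= lerDl sumr_ge0.
by move=> [k _] /(_ i); rewrite /= !mxE eqxx.
Qed.

Lemma integrable_L2_finite Omega g (K : set 'rV[R]_n) : measurable Omega ->
  square_integrable Omega g -> measurable K -> K `<=` Omega ->
  (mu K < +oo)%E -> mu.-integrable K (EFin \o g).
Proof.
move=> mO /(square_integrableP _ mO)[mg gi] mK KO Kfin.
have c1 : mu.-integrable K (cst 1%:E).
  apply/integrableP; split; first exact: measurable_cst.
  under eq_integral do rewrite /= normr1.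
  by rewrite integral_cst// mul1e.
have i2 := integrableS mO mK KO gi.
apply: (le_integrable mK _ _ (integrableD mK c1 i2)).
  by apply/measurable_EFinP; exact: measurable_funS mg.
move=> x _; rewrite /= lee_fin [leRHS]ger0_norm ?addr_ge0 ?sqr_ge0//.
have h1 : 0 <= (`|g x| - 1) ^+ 2 by exact: sqr_ge0.
have h2 : 0 <= `|g x| by [].
rewrite -[in leRHS](real_normK (num_real (g x))); nra.
Qed.

End boxes.

(** * The fundamental lemma of the calculus of variations *)

Section fundamental_lemma.
Context {R : realType} {n : nat}.
Implicit Types (Omega : set 'rV[R]_n) (f g h : 'rV[R]_n -> R).
Local Notation mu := (lebesgue_rV R n).

Lemma box_measure_fin (a b : 'rV[R]_n) : (mu (box a b) < +oo)%E.
Proof.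
rewrite (lebesgue_rV_prod (A := fun i => `]a ord0 i, b ord0 i[%classic))//.
rewrite (eq_bigr (fun i => (Num.max 0 (b ord0 i - a ord0 i))%:E)).
  by rewrite prodEFin ltry.
move=> i _; rewrite lebesgue_measure_itv/= lte_fin.
case: ltP => ab; last by rewrite max_l// subr_le0.
by rewrite max_r ?subr_ge0 ?ltW// EFinB.
Qed.

(** Bumps are admissible test functions and converge to the indicator of the box; [g] restricted to
    the box dominates, being L^2 on a set of finite measure. *)
Lemma integral_box_eq0 Omega g (a b : 'rV[R]_n) : measurable Omega ->
  square_integrable Omega g ->
  (forall phi, test_function Omega phi ->
    (\int[mu]_(x in Omega) (g x * phi x)%:E = 0)%E) ->
  cbox a b `<=` Omega -> (\int[mu]_(x in box a b) (g x)%:E = 0)%E.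
Proof.
move=> mO sg g0 abO.
have mB := measurable_box a b.
have BO : box a b `<=` Omega by apply: subset_trans abO; exact: box_cbox.
have iB := integrable_L2_finite mO sg mB BO (box_measure_fin a b).
pose f := (EFin \o g) \_ (box a b).
have fi : mu.-integrable Omega f.
  by apply/integrable_restrict => //; rewrite setIC setIidl.
pose f_ (k : nat) x := (g x * bump k.+1%:R a b x)%:E.
have mf_ k : measurable_fun Omega (f_ k).
  apply/measurable_EFinP; apply: measurable_funM; first by case: sg.
  exact: (measurable_funTS (smooth_measurable (smooth_bump _ _ _))).
have cf : {ae mu, forall x, Omega x -> f_ ^~ x @ \oo --> f x}.
  apply: aeW => x Ox; rewrite /f patchE; case: ifPn.
    rewrite inE => xab /=; rewrite -[g x in X in _ --> X]mulr1.
    apply: cvg_EFin; first exact: nearW.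
    by apply: cvgMr; exact: bump_cvg.
  rewrite notin_setE => xab; apply: cvg_near_cst; apply: nearW => k.
  by rewrite /f_ bump_out// mulr0.
have df : {ae mu, forall x k, Omega x -> (`|f_ k x| <= `|f x|)%E}.
  apply: aeW => x k Ox; rewrite /f patchE; case: ifPn.
    rewrite inE => xab /=; rewrite lee_fin normrM.
    by rewrite ler_piMr// ger0_norm ?bump_ge0 ?bump_le1.
  by rewrite notin_setE => xab; rewrite /f_ bump_out// mulr0.
have [_ _] := dominated_convergence mO mf_ (measurable_int _ fi) cf
  (integrable_abse fi) df.
rewrite (_ : (fun k => _) = cst 0%E); last first.
  by apply/funext => k; apply: g0; exact: test_function_bump.
rewrite /f -integral_mkcondr (setIidr BO) => /cvg_lim <-//.
by apply: lim_cst.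
Qed.

(** The sets S such that [g] has integral 0 on the intersection of S with the box form a Dynkin
    system containing all boxes, hence all measurable sets. *)
Lemma fundamental_lemma_box Omega g (a b : 'rV[R]_n) : measurable Omega ->
  square_integrable Omega g ->
  (forall phi, test_function Omega phi ->
    (\int[mu]_(x in Omega) (g x * phi x)%:E = 0)%E) ->
  cbox a b `<=` Omega -> {ae mu, forall x, box a b x -> g x = 0}.
Proof.
move=> mO sg g0 abO.
have mB := measurable_box a b.
have BO : box a b `<=` Omega by apply: subset_trans abO; exact: box_cbox.
have iB := integrable_L2_finite mO sg mB BO (box_measure_fin a b).
have iS S : measurable S -> mu.-integrable (box a b `&` S) (EFin \o g).
  move=> mS; apply: (integrableS _ _ _ iB) => //; exact: measurableI.
have HP S : measurable S -> (\int[mu]_(x in box a b `&` S) (g x)%:E = 0)%E.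
  move=> mS; have : <<s @boxes R n >> S by rewrite -boxesE.
  move: S {mS}; apply: (dynkin_induction boxesE boxes_setI).
  - by rewrite setIT; exact: integral_box_eq0 abO.
  - move=> _ [a' [b' ->]]; rewrite box_setI.
    apply: integral_box_eq0 sg g0 _ => //.
    apply: subset_trans abO => x xab i; have := xab i.
    rewrite /= !in_itv/= !mxE ge_max le_min.
    by move=> /andP[/andP[-> _] /andP[-> _]].
  - move=> S mS S0; have := integral_box_eq0 mO sg g0 abO.
    rewrite -{1}(setUIDK (box a b) S) integral_setU.
    + by rewrite S0 add0e setDE.
    + exact: measurableI.
    + exact: measurableD.
    + by rewrite setUIDK; exact: measurable_int iB.
    + by apply/disj_setPS => x [[_ Sx] [_]].
  - move=> F mF tF F0; rewrite setI_bigcupr integral_bigcup.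
    + by apply: eseries0 => k _ _; exact: F0.
    + exact: trivIset_setIl.
    + by move=> k; exact: measurableI.
    + by rewrite -setI_bigcupr; apply: iS; exact: bigcupT_measurable.
have : ae_eq mu (box a b) (EFin \o g) (cst 0%E).
  apply: integral_ae_eq => // E EB mE.
  by rewrite integral0; have := HP E mE; rewrite (setIidr EB).
by apply: filterS => x h /h [].
Qed.

Lemma rat_ball_box p : exists a b : 'rV[R]_n,
  rat_ball p 1 = box a b /\ cbox a b `<=` rat_ball p 2.
Proof.
pose c : 'rV[R]_n := \row_i ratr (p.1 ord0 i); pose r : R := p.2.+1%:R^-1.
have r0 : 0 < r by rewrite invr_gt0 ltr0n.
exists (\row_i (c ord0 i - r)), (\row_i (c ord0 i + r)); split.
  apply/seteqP; split=> x.
    move=> /ball_rVP[_ cx] i; have := cx i; rewrite mul1r -/r -/c.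
    by rewrite /= in_itv/= mxE [X in _ -> _ < _ < X]mxE ltr_norml => ?; lra.
  move=> xab; apply/ball_rVP; split; first by rewrite mul1r.
  move=> i; have := xab i; rewrite /= in_itv/= mxE [X in _ < _ < X -> _]mxE.
  by rewrite mul1r -/r -/c ltr_norml => ?; lra.
move=> x xab; apply/ball_rVP; split; first by rewrite mulr_gt0.
move=> i; have := xab i; rewrite /= in_itv/= mxE [X in _ <= _ <= X -> _]mxE.
by rewrite -/r -/c ltr_norml => ?; lra.
Qed.

Lemma ae_countable (I : countType) (P : I -> 'rV[R]_n -> Prop) :
  (forall i, {ae mu, forall x, P i x}) -> {ae mu, forall x, forall i, P i x}.
Proof.
move=> H.
pose F (k : nat) := if unpickle k is Some i then ~` [set x | P i x] else set0.
apply: (@negligibleS _ _ _ _ (\bigcup_k F k)).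
  move=> x /= nP; case: ((existsNP _).2 nP) => i Pi.
  by exists (pickle i) => //; rewrite /F pickleK.
apply: negligible_bigcup => k; rewrite /F; case: unpickle => [i|].
  exact: H.
exact: negligible_set0.
Qed.

(** Countably many rational cubes cover [Omega], so the null sets of the local statement add up to a
    null set. *)
Lemma fundamental_lemma Omega g : open Omega ->
  square_integrable Omega g ->
  (forall phi, test_function Omega phi ->
    (\int[mu]_(x in Omega) (g x * phi x)%:E = 0)%E) ->
  {ae mu, forall x, Omega x -> g x = 0}.
Proof.
move=> oO sg g0; have mO := open_measurable_rV oO.
have : {ae mu, forall x, forall p : 'rV[rat]_n * nat,
    rat_ball p 2 `<=` Omega -> rat_ball p 1 x -> g x = 0}.
  apply: (@ae_countable _ (fun p x => rat_ball p 2 `<=` Omega -> rat_ball p 1 x -> g x = 0)) => p.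
  have [pO|pO] := pselect (rat_ball p 2 `<=` Omega); last by apply: aeW.
  have [a [b [-> ab2]]] := rat_ball_box p.
  have := fundamental_lemma_box mO sg g0 (subset_trans ab2 pO).
  by apply: filterS => x h _; exact: h.
apply: filterS => x H Ox; have [p [pO px]] := open_rat_ball oO Ox.
exact: H pO px.
Qed.

End fundamental_lemma.

(** * Calculus of weak gradients and squared H^1 norms *)

Section weak_gradient.
Context {R : realType} {n : nat}.
Variable Omega : set 'rV[R]_n.
Hypothesis oO : open Omega.
Implicit Types (f g h phi : 'rV[R]_n -> R) (G H : 'I_n -> 'rV[R]_n -> R) (i : 'I_n).
Local Notation mu := (lebesgue_rV R n).

Let mO : measurable Omega := open_measurable_rV oO.

Lemma test_function_out phi x : test_function Omega phi -> ~ Omega x ->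
  phi x = 0.
Proof.
by move=> [_ _ pO] nO; apply: contrapT => /eqP px; apply/nO/pO/subset_closure.
Qed.

Lemma test_function_partial_out phi x i : test_function Omega phi ->
  ~ Omega x -> partial i phi x = 0.
Proof.
move=> [_ _ pO] nO; rewrite /partial.
have -> : 'D_(delta_mx ord0 i) phi x = 'D_(delta_mx ord0 i) (cst (0:R)) x.
  apply: near_eq_derive.
  have : nbhs x (~` closure [set x | phi x != 0]).
    apply: open_nbhs_nbhs; split; first exact/closed_openC/closed_closure.
    by move=> /pO.
  apply: filterS => y /= ny; apply: contrapT => /eqP py.
  by apply: ny; exact: subset_closure.
exact: derive_cst.
Qed.

Lemma integral_vanish_out (F : 'rV[R]_n -> \bar R) :
  (forall x, ~ Omega x -> F x = 0%E) ->
  (\int[mu]_(x in Omega) F x = \int[mu]_x F x)%E.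
Proof.
move=> F0; rewrite integral_mkcond; apply: eq_integral => x _.
by rewrite patchE; case: ifPn => //; rewrite notin_setE => /F0.
Qed.

Lemma is_weak_partial_smooth f i : smooth f ->
  is_weak_partial Omega i f (partial i f).
Proof.
move=> sf phi tp; have [M pM] := test_function_bounded_support tp.
rewrite !integral_vanish_out.
- by apply: integration_by_parts pM => //; case: tp.
- by move=> x /(test_function_out tp) ->; rewrite mulr0.
- by move=> x /(test_function_partial_out i tp) ->; rewrite mulr0.
Qed.

(** The integrability that makes the extended real integrals of [is_weak_partial] additive. It
    covers L^2 functions as well as the constant 1, which need not be L^2 on an unbounded domain. *)
Definition test_integrable i f := forall phi, test_function Omega phi ->
  mu.-integrable Omega (fun x => (f x * partial i phi x)%:E).

Lemma test_integrable_L2 i f : square_integrable Omega f -> test_integrable i f.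
Proof.
by move=> sf phi tp; apply: integrable_mul_L2 => //; exact: square_integrable_test_partial.
Qed.

Lemma test_integrable_smooth i f : smooth f -> test_integrable i f.
Proof.
move=> sf phi tp; have [M pM] := test_function_bounded_support tp.
have sp : smooth phi by case: tp.
apply: (@integrableS _ _ _ _ setT) => //.
exact: (smooth_integrable (smoothM sf (smooth_partial i sp))
  (bounded_supportMr _ (bounded_support_partial i pM))).
Qed.

Lemma is_weak_partialD i f1 f2 g1 g2 :
  test_integrable i f1 -> test_integrable i f2 ->
  square_integrable Omega g1 -> square_integrable Omega g2 ->
  is_weak_partial Omega i f1 g1 -> is_weak_partial Omega i f2 g2 ->
  is_weak_partial Omega i (f1 \+ f2) (g1 \+ g2).
Proof.
move=> t1 t2 s1 s2 w1 w2 phi tp.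
have sp := square_integrable_test mO tp.
have i1 := integrable_mul_L2 mO s1 sp.
have i2 := integrable_mul_L2 mO s2 sp.
under eq_integral do rewrite /= mulrDl EFinD.
rewrite (integralD mO (t1 _ tp) (t2 _ tp)) w1// w2//.
under [in RHS]eq_integral do rewrite /= mulrDl EFinD.
rewrite (integralD mO i1 i2) fin_num_oppeD//.
exact: (integrable_fin_num mO i2).
Qed.

Lemma is_weak_partialZ i (c : R) f g :
  test_integrable i f -> square_integrable Omega g ->
  is_weak_partial Omega i f g ->
  is_weak_partial Omega i (fun x => c * f x) (fun x => c * g x).
Proof.
move=> t1 s1 w1 phi tp; have sp := square_integrable_test mO tp.
under eq_integral do rewrite -mulrA EFinM.
rewrite (integralZl mO (t1 _ tp)) w1//.
under [in RHS]eq_integral do rewrite -mulrA EFinM.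
by rewrite (integralZl mO (integrable_mul_L2 mO s1 sp)) muleN.
Qed.

Lemma is_weak_partial_unique i f g1 g2 :
  square_integrable Omega g1 -> square_integrable Omega g2 ->
  is_weak_partial Omega i f g1 -> is_weak_partial Omega i f g2 ->
  {ae mu, forall x, Omega x -> g1 x = g2 x}.
Proof.
move=> s1 s2 w1 w2.
have : {ae mu, forall x, Omega x -> (g1 \- g2) x = 0}.
  apply: fundamental_lemma => //; first exact: square_integrableB.
  move=> phi tp; have sp := square_integrable_test mO tp.
  have i1 := integrable_mul_L2 mO s1 sp.
  have i2 := integrable_mul_L2 mO s2 sp.
  under eq_integral do rewrite /= mulrBl EFinB.
  rewrite (integralB mO i1 i2); have := w2 _ tp; rewrite w1// => /eqP.
  rewrite eqe_opp => /eqP ->; apply: subee.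
  exact: (integrable_fin_num mO i2).
by apply: filterS => x /[apply] /eqP; rewrite /= subr_eq0 => /eqP.
Qed.

(** Any weak derivative found by hand may replace the chosen one under an integral. *)
Lemma weak_partialP i f g :
  square_integrable Omega g -> is_weak_partial Omega i f g ->
  [/\ square_integrable Omega (weak_partial Omega i f),
      is_weak_partial Omega i f (weak_partial Omega i f) &
      {ae mu, forall x, Omega x -> weak_partial Omega i f x = g x}].
Proof.
move=> sg wg; have [s w] : square_integrable Omega (weak_partial Omega i f) /\
    is_weak_partial Omega i f (weak_partial Omega i f).
  by rewrite /weak_partial; case: xgetP => [y _ []//|/(_ g)]; case.
by split=> //; exact: is_weak_partial_unique w wg.
Qed.

(** The gradient is an argument so that sums and multiples of functions come with literal sums and
    multiples of gradients. *)
Definition weak_grad f G := square_integrable Omega f /\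
  forall i, square_integrable Omega (G i) /\ is_weak_partial Omega i f (G i).

Lemma weak_gradD f1 f2 G1 G2 : weak_grad f1 G1 -> weak_grad f2 G2 ->
  weak_grad (f1 \+ f2) (fun i => G1 i \+ G2 i).
Proof.
move=> [s1 w1] [s2 w2]; split=> [|i]; first exact: square_integrableD.
have [? ?] := w1 i; have [? ?] := w2 i; split; first exact: square_integrableD.
by apply: is_weak_partialD => //; exact: test_integrable_L2.
Qed.

Lemma weak_gradZ (c : R) f G : weak_grad f G ->
  weak_grad (fun x => c * f x) (fun i x => c * G i x).
Proof.
move=> [s w]; split=> [|i]; first exact: square_integrableZ.
have [? ?] := w i; split; first exact: square_integrableZ.
by apply: is_weak_partialZ => //; exact: test_integrable_L2.
Qed.

Lemma weak_gradB f1 f2 G1 G2 : weak_grad f1 G1 -> weak_grad f2 G2 ->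
  weak_grad (f1 \- f2) (fun i => G1 i \- G2 i).
Proof.
move=> w1 w2; have := weak_gradD w1 (weak_gradZ (-1) w2).
rewrite (_ : f1 \+ _ = f1 \- f2); last first.
  by apply/funext => x /=; rewrite mulN1r.
rewrite (_ : (fun i => G1 i \+ _) = (fun i => G1 i \- G2 i))//.
by apply/funext => i; apply/funext => x /=; rewrite mulN1r.
Qed.

Lemma weak_grad_test phi : test_function Omega phi ->
  weak_grad phi (fun i => partial i phi).
Proof.
move=> tp; split=> [|i]; first exact: square_integrable_test.
split; first exact: square_integrable_test_partial.
by apply: is_weak_partial_smooth; case: tp.
Qed.

Lemma weak_gradP f : sobolev_H1_real Omega f ->
  weak_grad f (fun i => weak_partial Omega i f).
Proof.
move=> [sf wf]; split=> // i; have [g sg wg] := wf i.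
by have [] := weak_partialP sg wg.
Qed.

Lemma weak_grad_H1 f G : weak_grad f G -> sobolev_H1_real Omega f.
Proof. by move=> [sf wf]; split=> // i; have [] := wf i; exists (G i). Qed.

Definition sq f : R := fine (\int[mu]_(x in Omega) (f x ^+ 2)%:E)%E.

Lemma sqE f : square_integrable Omega f ->
  (\int[mu]_(x in Omega) (f x ^+ 2)%:E = (sq f)%:E)%E.
Proof.
move=> /(square_integrableP _ mO)[_ fi]; rewrite fineK//.
exact: (integrable_fin_num mO fi).
Qed.

Lemma sq_ge0 f : 0 <= sq f.
Proof. by apply: fine_ge0; apply: integral_ge0 => x _; rewrite lee_fin sqr_ge0. Qed.

Lemma ae_eq_sq f g : square_integrable Omega f -> square_integrable Omega g ->
  {ae mu, forall x, Omega x -> f x = g x} -> sq f = sq g.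
Proof.
move=> [mf _] [mg _] fg; congr fine; apply: ae_eq_integral => //.
- by apply/measurable_EFinP; exact: measurable_funX.
- by apply/measurable_EFinP; exact: measurable_funX.
- by apply: filterS fg => x /[apply] ->.
Qed.

Lemma sqZ (c : R) f : square_integrable Omega f ->
  sq (fun x => c * f x) = c ^+ 2 * sq f.
Proof.
move=> sf; apply: EFin_inj; rewrite EFinM -!sqE//; last exact: square_integrableZ.
under eq_integral do rewrite exprMn EFinM.
rewrite ge0_integralZl_EFin//; last exact: sqr_ge0.
- by move=> x _; rewrite lee_fin sqr_ge0.
- by apply/measurable_EFinP; apply: measurable_funX; case: sf.
Qed.

(** Young's inequality inside the integral. Keeping the weight free makes Minkowski's inequality
    available later, by optimising over [e] in [le_sqr_add_sqrt]. *)
Lemma sqD_le (e : R) f g : 0 < e ->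
  square_integrable Omega f -> square_integrable Omega g ->
  sq (f \+ g) <= (1 + e) * sq f + (1 + e^-1) * sq g.
Proof.
move=> e0 sf sg; rewrite -lee_fin EFinD !EFinM -!sqE//; last exact: square_integrableD.
have m2 h : square_integrable Omega h -> measurable_fun Omega (fun x => (h x ^+ 2)%:E).
  by case=> mh _; apply/measurable_EFinP; exact: measurable_funX.
have ie0 : 0 < e^-1 by rewrite invr_gt0.
rewrite -ge0_integralZl_EFin//; last 3 first.
- by move=> x _; rewrite lee_fin sqr_ge0.
- exact: m2.
- lra.
rewrite -ge0_integralZl_EFin//; last 3 first.
- by move=> x _; rewrite lee_fin sqr_ge0.
- exact: m2.
- lra.
rewrite -ge0_integralD//; last 4 first.
- by move=> x _; rewrite -EFinM lee_fin mulr_ge0 ?sqr_ge0//; lra.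
- by apply: measurable_funeM; exact: m2.
- by move=> x _; rewrite -EFinM lee_fin mulr_ge0 ?sqr_ge0//; lra.
- by apply: measurable_funeM; exact: m2.
apply: ge0_le_integral => //.
- by move=> x _; rewrite lee_fin sqr_ge0.
- by apply: m2; exact: square_integrableD.
- by apply: emeasurable_funD; apply: measurable_funeM; exact: m2.
move=> x _; rewrite -!EFinM -EFinD lee_fin /=.
have ei : e * e^-1 = 1 by rewrite divff// gt_eqF.
have h1 : 0 <= e * (f x - e^-1 * g x) ^+ 2 by rewrite mulr_ge0 ?sqr_ge0// ltW.
have E1 : e * (f x - e^-1 * g x) ^+ 2 = e * f x ^+ 2 - 2 * (e * e^-1) * (f x * g x) +
    (e * e^-1) * e^-1 * g x ^+ 2 by ring.
rewrite E1 ei in h1.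
have E2 : (f x + g x) ^+ 2 = f x ^+ 2 + 2 * (f x * g x) + g x ^+ 2 by ring.
rewrite E2; lra.
Qed.

Definition h1sq f G : R := sq f + \sum_i sq (G i).

Lemma h1sq_ge0 f G : 0 <= h1sq f G.
Proof. by rewrite addr_ge0 ?sq_ge0// sumr_ge0// => i _; exact: sq_ge0. Qed.

Lemma sq_le_h1sq f G : sq f <= h1sq f G.
Proof. by rewrite lerDl sumr_ge0// => i _; exact: sq_ge0. Qed.

Lemma sq_grad_le_h1sq f G i : sq (G i) <= h1sq f G.
Proof.
rewrite /h1sq (bigD1 i)//= addrCA lerDl addr_ge0 ?sq_ge0//.
by rewrite sumr_ge0// => j _; exact: sq_ge0.
Qed.

Lemma h1sqD_le (e : R) f g G H : 0 < e -> weak_grad f G -> weak_grad g H ->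
  h1sq (f \+ g) (fun i => G i \+ H i) <=
  (1 + e) * h1sq f G + (1 + e^-1) * h1sq g H.
Proof.
move=> e0 [sf wf] [sg wg]; rewrite /h1sq !mulrDr addrACA lerD ?sqD_le//.
rewrite !mulr_sumr -big_split/=; apply: ler_sum => i _.
by apply: sqD_le => //; [case: (wf i)|case: (wg i)].
Qed.

Lemma h1sqZ (c : R) f G : weak_grad f G ->
  h1sq (fun x => c * f x) (fun i x => c * G i x) = c ^+ 2 * h1sq f G.
Proof.
move=> [sf wf]; rewrite /h1sq mulrDr sqZ// mulr_sumr; congr +%R.
by apply: eq_bigr => i _; rewrite sqZ//; case: (wf i).
Qed.

End weak_gradient.

(** * Functions of H^1_0 *)

Section h10.
Context {R : realType}.
Local Notation mu := (lebesgue_rV R).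

Definition h10 n (Omega : set 'rV[R]_n) (f : 'rV[R]_n -> R)
    (G : 'I_n -> 'rV[R]_n -> R) :=
  weak_grad Omega f G /\ forall e : R, 0 < e ->
    exists2 phi, test_function Omega phi &
      h1sq Omega (f \- phi) (fun i => G i \- partial i phi) < e.

Lemma measurable_superlevel_on n (Omega : set 'rV[R]_n) (f : 'rV[R]_n -> R) (d : R) :
  measurable Omega -> measurable_fun Omega f ->
  measurable (Omega `&` [set x | d <= `|f x|]).
Proof.
move=> mO mf; rewrite [X in _ `&` X](_ : _ = (Num.norm \o f) @^-1` `[d, +oo[%classic).
  by apply: (measurableT_comp _ mf) => //; exact: measurable_itv.
by apply/seteqP; split => x /=; rewrite in_itv/= andbT.
Qed.

Lemma chebyshev_L2 n (Omega : set 'rV[R]_n) (f : 'rV[R]_n -> R) (d : R) :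
  open Omega -> square_integrable Omega f -> 0 < d ->
  (mu n (Omega `&` [set x | (d <= `|f x|)%R]) <= (d ^- 2 * sq Omega f)%:E)%E.
Proof.
move=> oO sf d0; have mO := open_measurable_rV oO; have [mf _] := sf.
have mE := measurable_superlevel_on d mO mf.
have d2 : 0 < d ^- 2 by rewrite invr_gt0 exprn_gt0.
rewrite EFinM -sqE// -ge0_integralZl_EFin//; last 3 first.
- by move=> x _; rewrite lee_fin sqr_ge0.
- by apply/measurable_EFinP; exact: measurable_funX.
- exact: ltW.
set E := Omega `&` _ in mE *.
have -> : mu n E = (\int[mu n]_(x in Omega) (\1_E x)%:E)%E.
  by rewrite integral_indic// /E setIAC setIid.
apply: ge0_le_integral => //.
- exact/measurable_EFinP/measurable_indic.
- by apply: measurable_funeM; apply/measurable_EFinP; exact: measurable_funX.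
move=> x _; rewrite -EFinM lee_fin indicE; case: (boolP (_ \in _)) => [|_].
  rewrite inE => -[_ /= dx]; rewrite mulrC ler_pdivlMr ?exprn_gt0// mul1r.
  by rewrite -[(f x) ^+ 2]real_normK ?num_real// ler_pXn2r// nnegrE ltW.
by rewrite mulr_ge0 ?sqr_ge0// ltW.
Qed.

Lemma test_function_h1 n (Omega : set 'rV[R]_n) phi : open Omega ->
  test_function Omega phi ->
  (\int[mu n]_x (phi x ^+ 2)%:E + \sum_(i < n) \int[mu n]_x (partial i phi x ^+ 2)%:E
   = (h1sq Omega phi (fun i => partial i phi))%:E)%E.
Proof.
move=> oO tp; have [sp wp] := weak_grad_test oO tp.
rewrite /h1sq EFinD -sumEFin -sqE//; congr +%E.
  rewrite -(@integral_vanish_out _ _ Omega)// => x nO.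
  by rewrite (test_function_out tp nO) expr0n.
apply: eq_bigr => i _; rewrite -sqE//; last by case: (wp i).
rewrite -(@integral_vanish_out _ _ Omega)// => x nO.
by rewrite (test_function_partial_out i tp nO) expr0n.
Qed.

Lemma h1sq_test_le n (Omega : set 'rV[R]_n) f G phi : open Omega ->
  weak_grad Omega f G -> test_function Omega phi ->
  h1sq Omega phi (fun i => partial i phi) <= 2 * h1sq Omega f G +
   2 * h1sq Omega (f \- phi) (fun i => G i \- partial i phi).
Proof.
move=> oO wf tp; have wp := weak_grad_test oO tp.
have wd := weak_gradB oO wf wp.
have := h1sqD_le oO ltr01 wf (weak_gradZ oO (-1) wd).
rewrite h1sqZ// sqrrN expr1n mul1r invr1.
rewrite (_ : f \+ _ = phi); last by apply/funext => x /=; ring.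
rewrite (_ : (fun i => G i \+ _) = (fun i => partial i phi))//.
by apply/funext => i; apply/funext => x /=; ring.
Qed.

(** Where |f| >= d, either a nearby test function is at least d/2 or its difference with [f] is. The
    first set has measure of order Q^((n+2)/(n+1)), which is small compared with Q; the second is
    handled by Chebyshev's inequality and a close enough approximation. The bound Q, unlike the norm
    itself, is positive and so allows an approximation error proportional to it. *)
Lemma h10_small_superlevel n (d kappa : R) : 0 < d -> 0 < kappa ->
  exists2 r : R, 0 < r & forall (Omega : set 'rV[R]_n) f G Q, open Omega ->
    h10 Omega f G -> h1sq Omega f G <= Q -> 0 < Q <= r ->
    (mu n (Omega `&` [set x | (d <= `|f x|)%R]) <= (kappa * Q)%:E)%E.
Proof.
move=> d0 k0; pose C : R := 16 * n.+1%:R / d ^+ 2.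
have C0 : 0 < C by rewrite divr_gt0 ?exprn_gt0 ?mulr_gt0.
have k20 : 0 < kappa / 2 by rewrite divr_gt0.
(* For Q below this radius, (C * Q)^(n+2) <= (kappa / 2 * Q)^(n+1). The 16 in C combines the level
   d/2 with the bound 4 Q for the test function. *)
exists ((kappa / 2) ^+ n.+1 / C ^+ n.+2); first by rewrite divr_gt0 ?exprn_gt0.
move=> Omega f G Q oO [wf Hf] fQ /andP[Q0 Qr].
have mO := open_measurable_rV oO.
(* The first bound keeps the squared norm of the test function below 4 Q; the second makes
   Chebyshev's bound 4 e / d^2 at most kappa / 2 * Q. *)
pose e := Num.min Q (kappa * Q * d ^+ 2 / 8).
have e0 : 0 < e by rewrite lt_min Q0 divr_gt0 ?mulr_gt0 ?exprn_gt0.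
have [phi tp phie] := Hf _ e0.
have [M pM] := test_function_bounded_support tp.
have sp : smooth phi by case: tp.
have d20 : 0 < d / 2 by rewrite divr_gt0.
have wd := weak_gradB oO wf (weak_grad_test oO tp).
have eQ : e <= Q by rewrite ge_min lexx.
have ek : e <= kappa * Q * d ^+ 2 / 8 by rewrite ge_min lexx orbT.
have hphi : h1sq Omega phi (fun i => partial i phi) <= 4 * Q.
  by have := h1sq_test_le oO wf tp; lra.
have := weak_sobolev sp pM d20 (q := 4 * Q).
rewrite (test_function_h1 oO tp) lee_fin => /(_ hphi)[m1fin m1].
set E1 := [set x | d / 2 <= `|phi x|] in m1fin m1.
have mE1 : measurable E1.
  apply: measurable_superlevel; apply: measurableT_comp => //.
  exact: smooth_measurable.
pose E2 := Omega `&` [set x | d / 2 <= `|(f \- phi) x|].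
have mfp : measurable_fun Omega (f \- phi) by case: wd => -[].
have mE2 : measurable E2 by exact: measurable_superlevel_on.
have mE : measurable (Omega `&` [set x | d <= `|f x|]).
  by apply: measurable_superlevel_on => //; case: wf => -[].
apply: (@le_trans _ _ (mu n E1 + mu n E2)%E).
  apply: le_trans (measureU2 _ mE1 mE2); apply: le_measure; rewrite ?inE//.
    exact: measurableU.
  move=> x [Ox /= dx]; have [h|h] := leP (d / 2) `|phi x|; [by left|right].
  by split=> //=; have := lerB_dist (f x) (phi x); lra.
have m2 : (mu n E2 <= (kappa / 2 * Q)%:E)%E.
  apply: le_trans (chebyshev_L2 oO (proj1 wd) d20) _; rewrite lee_fin.
  have dd : 0 < (d / 2) ^+ 2 by rewrite exprn_gt0.
  rewrite mulrC ler_pdivrMr//.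
  have := sq_le_h1sq Omega (f \- phi) (fun i => G i \- partial i phi).
  have -> : kappa / 2 * Q * (d / 2) ^+ 2 = kappa * Q * d ^+ 2 / 8 by field.
  lra.
have m1' : (mu n E1 <= (kappa / 2 * Q)%:E)%E.
  rewrite -[leLHS]fineK; last by rewrite ge0_fin_numE.
  have kQ0 : 0 <= kappa / 2 * Q by rewrite mulr_ge0// ltW.
  rewrite lee_fin -(@ler_pXn2r _ n.+1)// ?nnegrE ?fine_ge0//.
  apply: le_trans m1 _.
  have -> : n.+1%:R / (d / 2) ^+ 2 * (4 * Q) = C * Q.
    by rewrite /C; field; rewrite gt_eqF.
  rewrite exprMn [Q ^+ n.+2]exprS mulrA [leRHS]exprMn.
  apply: ler_wpM2r; first by rewrite exprn_ge0// ltW.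
  by rewrite mulrC -ler_pdivlMr ?exprn_gt0.
apply: le_trans (leeD m1' m2) _; rewrite -EFinD lee_fin.
by rewrite -mulrDl -splitr.
Qed.

End h10.

Section slab_poincare.
Context {R : realType} {m : nat}.
Local Notation mu := (lebesgue_rV R m.+1).

Lemma open_slab N : open (@slab R m N).
Proof.
rewrite (_ : slab N = (fun x : 'rV[R]_m.+1 => x ord0 ord0) @^-1` `]- N%:R, N%:R[%classic).
  apply: open_comp; last exact: interval_open.
  by move=> x _; exact: coord_continuous.
by apply/seteqP; split=> x; rewrite /slab /= in_itv.
Qed.

(** By density. Comparing [f] and its derivative with those of a test function costs a factor 2
    each, whence 64 = 4 * 16, with a total error (64 N^2 + 2) * h. *)
Lemma poincare_h10 N f G : (0 < N)%N -> h10 (@slab R m N) f G ->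
  sq (slab N) f <= 64 * N%:R ^+ 2 * sq (slab N) (G ord0).
Proof.
move=> N0 [wf Hf]; have oO : open (@slab R m N) by exact: open_slab.
set Omega := @slab R m N in oO wf Hf *.
have N1 : (0:R) < N%:R by rewrite ltr0n.
apply/ler_addgt0Pl => e e0.
pose K : R := 64 * N%:R ^+ 2 + 2.
have K0 : 0 < K by rewrite ltr_wpDl// mulr_ge0// exprn_ge0// ltW.
have eK : 0 < e / K by rewrite divr_gt0.
have [phi tp phie] := Hf _ eK.
have [M pM] := test_function_bounded_support tp.
have sp : smooth phi by case: tp.
have wp := weak_grad_test oO tp; have wd := weak_gradB oO wf wp.
have [s0 w0] := wp; have [s1 w1] := wd; have [s2 w2] := wf.
have [s3 _] := w0 ord0; have [s4 _] := w1 ord0; have [s5 _] := w2 ord0.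
have := poincare_slab sp pM N1.
have pN (x : 'rV[R]_m.+1) : N%:R <= `|x ord0 ord0| -> phi x = 0.
  by move=> Nx; apply: (test_function_out tp); rewrite /Omega /slab /= -ltr_norml ltNge Nx.
move=> /(_ pN).
rewrite -!(@integral_vanish_out _ _ Omega); last 2 first.
- by move=> x /(test_function_partial_out ord0 tp) ->; rewrite expr0n.
- by move=> x /(test_function_out tp) ->; rewrite expr0n.
rewrite !sqE// -EFinM lee_fin => P.
have A : sq Omega f <= 2 * sq Omega phi + 2 * sq Omega (f \- phi).
  have := sqD_le oO ltr01 s0 s1; rewrite invr1.
  by rewrite (_ : phi \+ _ = f)//; apply/funext => x /=; ring.
have B : sq Omega (partial ord0 phi) <= 2 * sq Omega (G ord0) +
     2 * sq Omega (G ord0 \- partial ord0 phi).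
  have := sqD_le oO ltr01 s5 (square_integrableZ (-1) (open_measurable_rV oO) s4).
  rewrite invr1 sqZ// sqrrN expr1n mul1r.
  by rewrite (_ : G ord0 \+ _ = partial ord0 phi)//; apply/funext => x /=; ring.
have D1 := sq_le_h1sq Omega (f \- phi) (fun i => G i \- partial i phi).
have D2 := sq_grad_le_h1sq Omega (f \- phi) (fun i => G i \- partial i phi) ord0.
have E1 : K * (e / K) = e by rewrite mulrC divfK// gt_eqF.
have N2 : (0:R) < N%:R ^+ 2 by rewrite exprn_gt0.
set h := h1sq _ _ _ in phie D1 D2.
have E2 : K * h <= K * (e / K) by rewrite ler_wpM2l// ltW.
have E3 : 16 * N%:R ^+ 2 * sq Omega (partial ord0 phi) <=
    16 * N%:R ^+ 2 * (2 * sq Omega (G ord0) + 2 * h).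
  by rewrite ler_wpM2l ?mulr_ge0 ?(ltW N2)//; lra.
move: E2; rewrite E1 /K.
have -> : 64 * N%:R ^+ 2 * sq Omega (G ord0) = 32 * N%:R ^+ 2 * (2 * sq Omega (G ord0)) by ring.
have -> : (64 * N%:R ^+ 2 + 2) * h = 32 * N%:R ^+ 2 * (2 * h) + 2 * h by ring.
by move=> E2; nra.
Qed.

End slab_poincare.

(** * Coercivity of the energy near 1 *)

(** Monotonicity through positive and negative parts; the upper function is only measurable because
    it will be the potential, whose integral may be infinite. *)
Lemma le_integral_lower d (T : measurableType d) (R : realType)
    (mu : {measure set T -> \bar R}) (D : set T) (g f : T -> \bar R) :
  measurable D -> mu.-integrable D g -> measurable_fun D f ->
  (forall x, D x -> (g x <= f x)%E) ->
  (\int[mu]_(x in D) g x <= \int[mu]_(x in D) f x)%E.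
Proof.
move=> mD gi mf gf; have mg := measurable_int _ gi.
rewrite integralE [leRHS]integralE; apply: leeB; apply: ge0_le_integral => //.
- exact: measurable_funepos.
- exact: measurable_funepos.
- move=> x Dx; by rewrite !funeposE ge_max !le_max (gf _ Dx)/= lexx orbT.
- exact: measurable_funeneg.
- exact: measurable_funeneg.
- by move=> x Dx; rewrite !funenegE ge_max !le_max leeN2 (gf _ Dx)/= lexx orbT.
Qed.

Lemma sqr_normc (R : realType) (z : R[i]) :
  Normc.normc z ^+ 2 = complex.Re z ^+ 2 + complex.Im z ^+ 2.
Proof. by case: z => a b /=; rewrite sqr_sqrtr// addr_ge0 ?sqr_ge0. Qed.

Section potential.
Context {R : realType}.
Variable A : R.
Hypothesis hA : 0 < A < 1.

Definition potential (s : R) := (s - 1) ^+ 2 * (s - A).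

(** With w = u^2 + v^2 and s = 2 u + w, the potential is s^2 (1 - A + s), whose leading part is 4 (1
    - A) u^2. The bounds on d give w <= d, leave 12 d below the gap 4 (1 - A) - alpha, and make the
    cross term 4 d w at most eps * w. *)
Lemma potential_near1 (alpha eps : R) : 0 <= alpha -> alpha < 4 * (1 - A) -> 0 < eps ->
  exists2 d : R, 0 < d & forall u v : R, `|u| < d -> `|v| < d ->
    alpha * u ^+ 2 - eps * (u ^+ 2 + v ^+ 2) <= potential ((1 + u) ^+ 2 + v ^+ 2).
Proof.
move: hA => /andP[A0 A1] a0 ha e0.
pose d : R := Num.min (1/4) (Num.min ((4 * (1 - A) - alpha) / 32) (eps / 16)).
have d0 : 0 < d by rewrite !lt_min; apply/andP; split; [|apply/andP; split]; lra.
have d1 : d <= 1/4 by rewrite ge_min lexx.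
have d2 : d <= (4 * (1 - A) - alpha) / 32 by rewrite !ge_min lexx orbT.
have d3 : d <= eps / 16 by rewrite !ge_min lexx !orbT.
exists d => // u v; rewrite !ltr_norml => /andP[u1 u2] /andP[v1 v2].
pose w : R := u ^+ 2 + v ^+ 2.
have u20 : 0 <= u ^+ 2 by exact: sqr_ge0.
have v20 : 0 <= v ^+ 2 by exact: sqr_ge0.
have w0 : 0 <= w by rewrite addr_ge0.
have wd : w <= 2 * d ^+ 2.
  have : 0 <= (d - u) * (d + u) by rewrite mulr_ge0//; lra.
  have : 0 <= (d - v) * (d + v) by rewrite mulr_ge0//; lra.
  rewrite /w => ? ?; nra.
have dd : d ^+ 2 <= d / 4 by rewrite expr2 ler_pM2l//; lra.
have wd' : w <= d by lra.
pose s : R := 2 * u + w.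
have -> : potential ((1 + u) ^+ 2 + v ^+ 2) = s ^+ 2 * (1 - A + s).
  by rewrite /potential /s /w; ring.
have s1 : - (3 * d) <= s by rewrite /s; lra.
have s2 : 4 * u ^+ 2 - 4 * d * w <= s ^+ 2.
  have -> : s ^+ 2 = 4 * u ^+ 2 + 4 * u * w + w ^+ 2 by rewrite /s; ring.
  have : - (d * w) <= u * w by rewrite -mulNr ler_wpM2r// ltW.
  have := sqr_ge0 w; lra.
have k0 : 0 <= 1 - A - 3 * d by lra.
apply: (@le_trans _ _ (s ^+ 2 * (1 - A - 3 * d))); last first.
  by rewrite ler_wpM2l ?sqr_ge0//; lra.
apply: (@le_trans _ _ ((4 * u ^+ 2 - 4 * d * w) * (1 - A - 3 * d))); last first.
  by rewrite ler_wpM2r.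
have dw : 4 * d * w * (1 - A - 3 * d) <= 4 * d * w.
  by rewrite -[leRHS]mulr1 ler_wpM2l ?mulr_ge0 ?(ltW d0)//; lra.
have dew : 4 * d * w <= eps * w by rewrite ler_wpM2r//; lra.
have au : alpha * u ^+ 2 <= 4 * (1 - A - 3 * d) * u ^+ 2.
  by rewrite ler_wpM2r//; lra.
by rewrite -/w mulrBl; lra.
Qed.

(** alpha * u^2 is at most linear in s, while the potential is at least (s - 1)^3 for s > 1 and at
    least -1 otherwise. The constant 50 is generous; the cubic is bounded below by its tangent at s
    - 1 = 2. *)
Lemma potential_ge (alpha u v : R) : 0 <= alpha -> alpha < 4 * (1 - A) ->
  alpha * u ^+ 2 - 50 <= potential ((1 + u) ^+ 2 + v ^+ 2).
Proof.
move: hA => /andP[A0 A1] a0 ha.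
set s := (1 + u) ^+ 2 + v ^+ 2; have s0 : 0 <= s by rewrite addr_ge0 ?sqr_ge0.
have us : u ^+ 2 <= 2 * s + 2.
  have h1 : 0 <= (u + 2) ^+ 2 by exact: sqr_ge0.
  have h2 : 0 <= v ^+ 2 by exact: sqr_ge0.
  by rewrite /s; nra.
have u20 : 0 <= u ^+ 2 by exact: sqr_ge0.
have au : alpha * u ^+ 2 <= 8 * s + 8.
  have : alpha * u ^+ 2 <= 4 * u ^+ 2 by rewrite ler_wpM2r//; lra.
  lra.
rewrite /potential; have [s1|s1] := leP s 1.
  have h1 : (s - 1) ^+ 2 <= 1 by nra.
  have h2 : 0 <= (s - 1) ^+ 2 by exact: sqr_ge0.
  nra.
have h : (s - 1) ^+ 3 <= (s - 1) ^+ 2 * (s - A).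
  by rewrite exprSr ler_wpM2l ?sqr_ge0//; lra.
apply: le_trans h; pose x := s - 1.
have -> : s = x + 1 by rewrite /x; ring.
have x0 : 0 < x by rewrite /x; lra.
rewrite -/x in au *; have -> : x + 1 - 1 = x by ring.
have : 0 <= (x - 2) ^+ 2 * (x + 4) by rewrite mulr_ge0 ?sqr_ge0//; lra.
have : (x - 2) ^+ 2 * (x + 4) = x ^+ 3 - 12 * x + 16 by ring.
by move: au; rewrite /x; lra.
Qed.

End potential.

Section energies.
Context {R : realType} {n : nat}.
Variable Omega : set 'rV[R]_n.
Hypothesis oO : open Omega.
Implicit Types (f g h phi : 'rV[R]_n -> R) (G H : 'I_n -> 'rV[R]_n -> R) (i : 'I_n).
Local Notation mu := (lebesgue_rV R n).

Let mO : measurable Omega := open_measurable_rV oO.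

(** Unlike [weak_grad], this applies to [psi] itself, which is close to 1 and so need not be L^2 on
    a slab. *)
Definition weak_partials f G := forall i,
  square_integrable Omega (G i) /\ is_weak_partial Omega i f (G i).

Lemma weak_partials_cstD (a : R) f G : weak_grad Omega f G ->
  weak_partials (fun x => a + f x) G.
Proof.
move=> [sf wf] i; have [si wi] := wf i; split=> //.
have s0 : square_integrable Omega (cst (0:R) : 'rV[R]_n -> R).
  have := square_integrableZ 0 mO sf; rewrite (_ : (fun x => _) = cst 0)//.
  by apply/funext => x; rewrite mul0r.
have wa := @is_weak_partial_smooth _ _ Omega _ i (smooth_cst a).
have := is_weak_partialD oO (test_integrable_smooth oO i (smooth_cst a))
  (test_integrable_L2 oO i sf) _ si wa wi.
rewrite partial_cst => /(_ s0).
rewrite (_ : cst 0 \+ G i = G i)//.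
by apply/funext => x /=; rewrite add0r.
Qed.

Lemma sum_sqE (I : finType) (F : I -> 'rV[R]_n -> R) :
  (forall k, square_integrable Omega (F k)) ->
  (\int[mu]_(x in Omega) (\sum_k F k x ^+ 2)%:E = (\sum_k sq Omega (F k))%:E)%E.
Proof.
move=> sF; under eq_integral do rewrite -sumEFin.
rewrite ge0_integral_sum//; last 2 first.
- by move=> k; apply/measurable_EFinP; apply: measurable_funX; case: (sF k).
- by move=> k x _; rewrite lee_fin sqr_ge0.
by rewrite -sumEFin; apply: eq_bigr => k _; exact: sqE.
Qed.

Lemma integral_sqnorm_grad (u : 'rV[R]_n -> R[i]) G H :
  weak_partials (fun x => complex.Re (u x)) G ->
  weak_partials (fun x => complex.Im (u x)) H ->
  (\int[mu]_(x in Omega) (sqnorm_grad Omega u x)%:E =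
    (\sum_i sq Omega (G i) + \sum_i sq Omega (H i))%:E)%E.
Proof.
move=> wG wH.
(* Derivatives of both real components in one family, so that the squared gradient is a single sum
   of squares. *)
pose F (ib : 'I_n * bool) := weak_partial Omega ib.1
  (if ib.2 then (fun x => complex.Re (u x)) else (fun x => complex.Im (u x))).
have sF ib : square_integrable Omega (F ib).
  case: ib => i []; rewrite /F/=; [have [s w] := wG i|have [s w] := wH i];
  by case: (weak_partialP oO s w).
transitivity (\int[mu]_(x in Omega) (\sum_ib F ib x ^+ 2)%:E)%E.
  apply: eq_integral => x _; congr EFin; rewrite /sqnorm_grad.
  rewrite (eq_bigr (fun i => \sum_b F (i, b) x ^+ 2)); last first.
    by move=> i _; rewrite sqr_normc big_bool.
  by rewrite pair_big/=; apply: eq_bigr => -[].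
rewrite sum_sqE//; congr EFin; rewrite -big_split/=.
rewrite (eq_bigr (fun ib => (fun i b => sq Omega (F (i, b))) ib.1 ib.2)); last by case.
rewrite -(pair_big xpredT xpredT (fun i b => sq Omega (F (i, b))))/=.
apply: eq_bigr => i _; rewrite big_bool.
have [s1 w1] := wG i; have [_ _ e1] := weak_partialP oO s1 w1.
have [s2 w2] := wH i; have [_ _ e2] := weak_partialP oO s2 w2.
by congr +%R; apply: ae_eq_sq => //; exact: sF.
Qed.

Lemma H1_normE (u : 'rV[R]_n -> R[i]) G H :
  weak_grad Omega (fun x => complex.Re (u x)) G ->
  weak_grad Omega (fun x => complex.Im (u x)) H ->
  H1_norm Omega u = (Num.sqrt (h1sq Omega (fun x => complex.Re (u x)) G +
                               h1sq Omega (fun x => complex.Im (u x)) H))%:E.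
Proof.
move=> [sR wG] [sI wH]; rewrite /H1_norm.
set I := (\int[_]_(_ in _) _)%E.
suff -> : I = (h1sq Omega (fun x => complex.Re (u x)) G +
               h1sq Omega (fun x => complex.Im (u x)) H)%:E.
  by rewrite poweR_EFin powR12_sqrt// addr_ge0 ?h1sq_ge0.
rewrite /I; under eq_integral do rewrite EFinD.
have [mR _] := sR; have [mI _] := sI.
have msg : measurable_fun Omega (sqnorm_grad Omega u).
  apply: measurable_sum => i.
  under eq_fun do rewrite sqr_normc.
  apply: measurable_funD; apply: measurable_funX.
    by have [s w] := wG i; case: (weak_partialP oO s w) => -[].
  by have [s w] := wH i; case: (weak_partialP oO s w) => -[].
have mn : measurable_fun Omega (fun x => Normc.normc (u x) ^+ 2).
  by under eq_fun do rewrite sqr_normc; apply: measurable_funD; exact: measurable_funX.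
rewrite ge0_integralD//; last 4 first.
- by move=> x _; rewrite lee_fin sqr_ge0.
- exact/measurable_EFinP.
- by move=> x _; rewrite lee_fin sumr_ge0// => i _; rewrite sqr_ge0.
- exact/measurable_EFinP.
rewrite (integral_sqnorm_grad wG wH).
under eq_integral do rewrite sqr_normc EFinD.
rewrite ge0_integralD//; last 4 first.
- by move=> x _; rewrite lee_fin sqr_ge0.
- by apply/measurable_EFinP; exact: measurable_funX.
- by move=> x _; rewrite lee_fin sqr_ge0.
- by apply/measurable_EFinP; exact: measurable_funX.
by rewrite !sqE// -!EFinD /h1sq; congr EFin; rewrite addrACA.
Qed.

Definition ip f g : R := fine (\int[mu]_(x in Omega) (f x * g x)%:E)%E.

Lemma ipE f g : square_integrable Omega f -> square_integrable Omega g ->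
  (\int[mu]_(x in Omega) (f x * g x)%:E = (ip f g)%:E)%E.
Proof.
move=> sf sg; rewrite fineK//.
exact: (integrable_fin_num mO (integrable_mul_L2 mO sf sg)).
Qed.

(** The squared norm of f + k g, expanded; it is the integrated Young inequality for the momentum
    term. *)
Lemma ip_ge (k : R) f g : square_integrable Omega f -> square_integrable Omega g ->
  0 <= sq Omega f + 2 * k * ip f g + k ^+ 2 * sq Omega g.
Proof.
move=> sf sg; rewrite -lee_fin.
have [_ i1] := (square_integrableP f mO).1 sf.
have [_ i2] := (square_integrableP g mO).1 sg.
have i3 := integrable_mul_L2 mO sf sg.
have i23 := integrableZl mO (2 * k) i3.
have i22 := integrableZl mO (k ^+ 2) i2.
have <- : (\int[mu]_(x in Omega) ((f x ^+ 2)%:E +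
    (2 * k)%:E * (f x * g x)%:E + (k ^+ 2)%:E * (g x ^+ 2)%:E) =
    (sq Omega f + 2 * k * ip f g + k ^+ 2 * sq Omega g)%:E)%E.
  rewrite (integralD mO (integrableD mO i1 i23) i22) (integralD mO i1 i23).
  rewrite (integralZl mO i3) (integralZl mO i2).
  by rewrite !sqE// ipE.
apply: integral_ge0 => x _; rewrite /= -!EFinM -!EFinD lee_fin.
have -> : f x ^+ 2 + 2 * k * (f x * g x) + k ^+ 2 * g x ^+ 2 = (f x + k * g x) ^+ 2 by ring.
exact: sqr_ge0.
Qed.

End energies.

Section lagrangian.
Context {R : realType} {m : nat}.
Local Notation mu := (lebesgue_rV R m.+1).

(** The gradient and momentum terms become real numbers; the potential term stays an extended real
    integral, since it may be infinite. *)
Lemma lagrangianE (A : R) (N : nat) (c : R) (psi : 'rV[R]_m.+1 -> R[i]) G H :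
  weak_grad (slab N) (fun x => complex.Re (psi x - 1)) G ->
  weak_grad (slab N) (fun x => complex.Im (psi x - 1)) H ->
  lagrangian A N c psi =
    ((2^-1 * (\sum_i sq (slab N) (G i) + \sum_i sq (slab N) (H i)))%:E
    + (2^-1)%:E * \int[mu]_(x in slab N)
      (potential A ((1 + complex.Re (psi x - 1)) ^+ 2 + complex.Im (psi x - 1) ^+ 2))%:E
    + (c * ip (slab N) (H ord0) (fun x => complex.Re (psi x - 1)))%:E)%E.
Proof.
move=> wR wI; have oO : open (@slab R m N) by exact: open_slab.
have mO := open_measurable_rV oO.
have eR x : complex.Re (psi x) = 1 + complex.Re (psi x - 1).
  by case: (psi x) => a b /=; rewrite subr0 || ring.
have eI x : complex.Im (psi x) = complex.Im (psi x - 1).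
  by case: (psi x) => a b /=; ring.
have wR1 : weak_partials (slab N) (fun x => complex.Re (psi x)) G.
  by rewrite (funext eR); exact: weak_partials_cstD.
have wI1 : weak_partials (slab N) (fun x => complex.Im (psi x)) H.
  by rewrite (funext eI); case: wI.
rewrite /lagrangian (integral_sqnorm_grad oO wR1 wI1) -EFinM.
congr (_ + _ + _)%E.
  congr (_ * _)%E; apply: eq_integral => x _.
  by rewrite /potential sqr_normc -eR -eI.
have [sH w0] := wI1 ord0; have [s0 _ e0] := weak_partialP oO sH w0.
have [su _] := wR.
rewrite EFinM -ipE//; congr (_ * _)%E; apply: ae_eq_integral => //.
- have := measurable_int _ (integrable_mul_L2 mO s0 su).
  apply: eq_measurable_fun => x _; congr (_ * _)%:E.
  by rewrite eR; ring.
- exact: measurable_int _ (integrable_mul_L2 mO sH su).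
- by apply: filterS e0 => x h Ox; rewrite h// eR; congr EFin; ring.
Qed.

End lagrangian.

Section complex_h10.
Context {R : realType} {n : nat}.
Implicit Types (Omega : set 'rV[R]_n) (w : 'rV[R]_n -> R[i]).

Definition re_grad Omega w i := weak_partial Omega i (fun x => complex.Re (w x)).
Definition im_grad Omega w i := weak_partial Omega i (fun x => complex.Im (w x)).

Definition h1sqC Omega w : R :=
  h1sq Omega (fun x => complex.Re (w x)) (re_grad Omega w) +
  h1sq Omega (fun x => complex.Im (w x)) (im_grad Omega w).

Lemma h1sqC_ge0 Omega w : 0 <= h1sqC Omega w.
Proof. by rewrite addr_ge0 ?h1sq_ge0. Qed.

Lemma H1_norm_h1sqC Omega w : open Omega -> sobolev_H1 Omega w ->
  H1_norm Omega w = (Num.sqrt (h1sqC Omega w))%:E.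
Proof.
by move=> oO [wR wI]; apply: H1_normE => //; exact: weak_gradP.
Qed.

Lemma sobolev_H10_h10 Omega w : open Omega -> sobolev_H10 Omega w ->
  h10 Omega (fun x => complex.Re (w x)) (re_grad Omega w) /\
  h10 Omega (fun x => complex.Im (w x)) (im_grad Omega w).
Proof.
move=> oO [[wR wI] Hw].
have gR := weak_gradP oO wR; have gI := weak_gradP oO wI.
have approx (e : R) : 0 < e -> exists2 phi, test_functionC Omega phi &
    h1sq Omega ((fun x => complex.Re (w x)) \- (fun x => complex.Re (phi x)))
      (fun i => re_grad Omega w i \- partial i (fun x => complex.Re (phi x))) +
    h1sq Omega ((fun x => complex.Im (w x)) \- (fun x => complex.Im (phi x)))
      (fun i => im_grad Omega w i \- partial i (fun x => complex.Im (phi x))) < e.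
  move=> e0; have se0 : 0 < Num.sqrt e by rewrite sqrtr_gt0.
  have [phi [tR tI] phie] := Hw _ se0; exists phi; first by split.
  have dR := weak_gradB oO gR (weak_grad_test oO tR).
  have dI := weak_gradB oO gI (weak_grad_test oO tI).
  have eR x : complex.Re (w x - phi x) = complex.Re (w x) - complex.Re (phi x).
    by case: (w x) => ? ?; case: (phi x).
  have eI x : complex.Im (w x - phi x) = complex.Im (w x) - complex.Im (phi x).
    by case: (w x) => ? ?; case: (phi x).
  have := H1_normE oO (u := fun x => w x - phi x)
    (G := fun i => re_grad Omega w i \- partial i (fun x => complex.Re (phi x)))
    (H := fun i => im_grad Omega w i \- partial i (fun x => complex.Im (phi x))).
  rewrite (funext eR) (funext eI) => /(_ dR dI) E.
  by move: phie; rewrite E lte_fin ltr_sqrt.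
split.
  split=> [|e e0]; first exact: gR.
  have [phi [tR _] phie] := approx e e0.
  exists (fun x => complex.Re (phi x)); first exact: tR.
  by apply: le_lt_trans phie; rewrite lerDl h1sq_ge0.
split=> [|e e0]; first exact: gI.
have [phi [_ tI] phie] := approx e e0.
exists (fun x => complex.Im (phi x)); first exact: tI.
by apply: le_lt_trans phie; rewrite lerDr h1sq_ge0.
Qed.

End complex_h10.

(** * Positivity of the energy on small spheres around 1 *)

Section lower_bound.
Context {R : realType} {m : nat}.
Local Notation mu := (lebesgue_rV R m.+1).

(** Pointwise, the local minorant holds off the two superlevel sets and the global one on them,
    where the loss C is paid at most once per set. *)
Lemma potential_lower (Omega : set 'rV[R]_m.+1) (A alpha eps C d : R) (u v : 'rV[R]_m.+1 -> R) :
  open Omega -> square_integrable Omega u -> square_integrable Omega v ->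
  (mu (Omega `&` [set x | (d <= `|u x|)%R]) < +oo)%E ->
  (mu (Omega `&` [set x | (d <= `|v x|)%R]) < +oo)%E -> 0 <= eps -> 0 <= C ->
  (forall a b : R, `|a| < d -> `|b| < d ->
    alpha * a ^+ 2 - eps * (a ^+ 2 + b ^+ 2) <= potential A ((1 + a) ^+ 2 + b ^+ 2)) ->
  (forall a b : R, alpha * a ^+ 2 - C <= potential A ((1 + a) ^+ 2 + b ^+ 2)) ->
  ((alpha * sq Omega u - eps * (sq Omega u + sq Omega v))%:E
    - C%:E * (mu (Omega `&` [set x | (d <= `|u x|)%R]) +
              mu (Omega `&` [set x | (d <= `|v x|)%R])) <=
   \int[mu]_(x in Omega) (potential A ((1 + u x) ^+ 2 + v x ^+ 2))%:E)%E.
Proof.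
move=> oO su sv; set Eu := Omega `&` _; set Ev := Omega `&` _ => fu fv e0 C0 Hs Hl.
have mO := open_measurable_rV oO.
have [mu' iu] := (square_integrableP u mO).1 su.
have [mv' iv] := (square_integrableP v mO).1 sv.
have mEu : measurable Eu by exact: measurable_superlevel_on.
have mEv : measurable Ev by exact: measurable_superlevel_on.
have iE (E : set 'rV[R]_m.+1) : measurable E -> E `<=` Omega -> (mu E < +oo)%E ->
    mu.-integrable Omega (fun x => (\1_E x)%:E) /\
    (\int[mu]_(x in Omega) (\1_E x)%:E = mu E)%E.
  move=> mE EO Efin.
  have I : (\int[mu]_(x in Omega) (\1_E x)%:E = mu E)%E.
    by rewrite integral_indic// setIidl.
  split=> //; apply/integrableP; split; first exact/measurable_EFinP/measurable_indic.
  by under eq_integral do rewrite gee0_abs//; rewrite I.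
have [iEu IEu] := iE _ mEu (@subIsetl _ _ _) fu.
have [iEv IEv] := iE _ mEv (@subIsetl _ _ _) fv.
have i1 := integrableZl mO alpha iu.
have i2 := integrableZl mO eps (integrableD mO iu iv).
have i3 := integrableZl mO C (integrableD mO iEu iEv).
have i12 := integrableB mO i1 i2.
have i123 := integrableB mO i12 i3.
have <- : (\int[mu]_(x in Omega) ((alpha%:E * (u x ^+ 2)%:E -
     eps%:E * ((u x ^+ 2)%:E + (v x ^+ 2)%:E)) - C%:E * ((\1_Eu x)%:E + (\1_Ev x)%:E)) =
   (alpha * sq Omega u - eps * (sq Omega u + sq Omega v))%:E - C%:E * (mu Eu + mu Ev))%E.
  rewrite (integralB mO i12 i3) (integralB mO i1 i2).
  rewrite (integralZl mO iu) (integralZl mO (integrableD mO iu iv)).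
  rewrite (integralZl mO (integrableD mO iEu iEv)).
  rewrite (integralD mO iu iv) (integralD mO iEu iEv).
  by rewrite !sqE// IEu IEv.
apply: le_integral_lower => //.
  apply/measurable_EFinP; rewrite /potential.
  have ms : measurable_fun Omega (fun x => (1 + u x) ^+ 2 + v x ^+ 2).
    apply: measurable_funD; apply: measurable_funX => //.
    by apply: measurable_funD => //; exact: measurable_cst.
  apply: measurable_funM.
    by apply: measurable_funX; apply: measurable_funB => //; exact: measurable_cst.
  by apply: measurable_funB => //; exact: measurable_cst.
move=> x Ox; rewrite -[X in (X <= _)%E]/((alpha * u x ^+ 2 -
  eps * (u x ^+ 2 + v x ^+ 2) - C * (\1_Eu x + \1_Ev x))%:E) lee_fin !indicE.
have u2 : 0 <= u x ^+ 2 by exact: sqr_ge0.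
have v2 : 0 <= v x ^+ 2 by exact: sqr_ge0.
have Hl' := Hl (u x) (v x).
have euv : 0 <= eps * (u x ^+ 2 + v x ^+ 2) by rewrite mulr_ge0// addr_ge0.
case: (boolP (x \in Eu)) => [_|].
  apply: le_trans Hl'; case: (_ \in _) => /=; lra.
rewrite notin_setE => nEu; case: (boolP (x \in Ev)) => [_|].
  by apply: le_trans Hl' => /=; lra.
rewrite notin_setE => nEv.
have du : `|u x| < d by rewrite ltNge; apply/negP => h; apply: nEu.
have dv : `|v x| < d by rewrite ltNge; apply/negP => h; apply: nEv.
by have := Hs _ _ du dv; rewrite /= addr0 mulr0 subr0.
Qed.

(* Choosing [theta] with [c^2 / (4 (1 - A)) < theta < 1], Young's inequality
   splits the momentum term between [theta / 2 * |grad v|^2] and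
   [alpha / 2 * u^2], where [alpha = c^2 / theta < 4 (1 - A)] is controlled by
   the potential near 1. The part of the potential lost far from 1 is
   proportional to a superlevel measure, hence small compared with [Q]. *)
Lemma coercive_near1 (A : R) (N : nat) (c : R) : 0 < A < 1 -> (0 < N)%N ->
  0 < c < 2 * Num.sqrt (1 - A) ->
  exists r kappa : R, [/\ 0 < r, 0 < kappa & forall u v G H Q,
    h10 (@slab R m N) u G -> h10 (slab N) v H ->
    h1sq (slab N) u G + h1sq (slab N) v H <= Q -> 0 < Q <= r ->
    ((kappa * (h1sq (slab N) u G + h1sq (slab N) v H) - kappa / 2 * Q)%:E <=
     (2^-1 * (\sum_i sq (slab N) (G i) + \sum_i sq (slab N) (H i)))%:E +
     (2^-1)%:E * \int[mu]_(x in slab N)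
       (potential A ((1 + u x) ^+ 2 + v x ^+ 2))%:E +
     (c * ip (slab N) (H ord0) u)%:E)%E].
Proof.
move=> hA N0 /andP[c0 cA]; have /andP[A0 A1] := hA.
have c2 : c ^+ 2 < 4 * (1 - A).
  rewrite -[X in _ < _ * X]sqr_sqrtr; last by lra.
  have -> : 4 * Num.sqrt (1 - A) ^+ 2 = (2 * Num.sqrt (1 - A)) ^+ 2 by ring.
  by rewrite ltr_pXn2r// nnegrE; lra.
have A10 : 0 < 4 * (1 - A) by lra.
have c20 : 0 < c ^+ 2 by rewrite exprn_gt0.
pose q : R := c ^+ 2 / (4 * (1 - A)).
have q0 : 0 < q by rewrite divr_gt0.
have q1 : q < 1 by rewrite ltr_pdivrMr// mul1r.
pose theta : R := (1 + q) / 2.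
have t0 : 0 < theta by rewrite /theta; lra.
have t1 : theta < 1 by rewrite /theta; lra.
have qt : q < theta by rewrite /theta; lra.
pose alpha : R := c ^+ 2 / theta.
have al0 : 0 <= alpha by rewrite divr_ge0// ltW.
have al4 : alpha < 4 * (1 - A).
  by rewrite ltr_pdivrMr// mulrC -ltr_pdivrMr.
pose K : R := 64 * N%:R ^+ 2.
have K0 : 0 < K by rewrite mulr_gt0// exprn_gt0// ltr0n.
(* Budget of gradient coefficients: (1 - theta) / 2 survives the momentum term, and by Poincare the
   eps term takes at most (1 - theta) / 4. The remaining (1 - theta) / 4 controls kappa times the
   full squared norm. *)
pose eps : R := (1 - theta) / (2 * K).
have th0 : 0 < 1 - theta by rewrite subr_gt0.
have eps0 : 0 < eps by rewrite divr_gt0// mulr_gt0.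
have [d d0 Hs] := potential_near1 hA al0 al4 eps0.
pose kappa : R := (1 - theta) / (4 * (K + 1)).
have K1 : 0 < K + 1 by rewrite ltr_wpDl// ltW.
have kappa0 : 0 < kappa by rewrite divr_gt0// mulr_gt0.
(* Two superlevel sets, each with loss 50 and the factor 1/2 of the energy, cost 50 * k0 * Q = kappa
   / 2 * Q. *)
pose k0 : R := kappa / 100.
have k00 : 0 < k0 by rewrite divr_gt0.
have [r r0 Hr] := @h10_small_superlevel R m.+1 d k0 d0 k00.
exists r, kappa; split=> // u v G H Q hR hI QQ Qr.
have oO : open (@slab R m N) by exact: open_slab.
have [gR _] := hR; have [gI _] := hI.
have [su wG] := gR; have [sv wH] := gI.
have hQR : h1sq (slab N) u G <= Q.
  by apply: le_trans QQ; rewrite lerDl h1sq_ge0.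
have hQI : h1sq (slab N) v H <= Q.
  by apply: le_trans QQ; rewrite lerDr h1sq_ge0.
have mEu := Hr _ _ _ _ oO hR hQR Qr; have mEv := Hr _ _ _ _ oO hI hQI Qr.
have := @potential_lower (slab N) A alpha eps 50 d u v oO su sv
  (le_lt_trans mEu (ltry _)) (le_lt_trans mEv (ltry _)) (ltW eps0) (ler0n _ _) Hs
  (fun a b => @potential_ge R A hA alpha a b al0 al4).
set V := (\int[_]_(_ in _) _)%E => HV.
have HV' : ((alpha * sq (slab N) u - eps * (sq (slab N) u + sq (slab N) v) -
    50 * (k0 * Q + k0 * Q))%:E <= V)%E.
  apply: le_trans HV; rewrite EFinB; apply: leeB => //.
  by rewrite EFinM; apply: lee_wpmul2l => //; rewrite EFinD; exact: leeD.
set U := sq _ u in HV'; set W := sq _ v in HV'.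
set SG := \sum_i sq _ (G i); set SH := \sum_i sq _ (H i).
have U0 : 0 <= U by exact: sq_ge0.
have PU : U <= K * SG.
  apply: le_trans (poincare_h10 N0 hR) _; rewrite ler_wpM2l ?(ltW K0)//.
  by rewrite /SG (bigD1 ord0)//= lerDl sumr_ge0// => i _; exact: sq_ge0.
have HSH : sq (slab N) (H ord0) <= SH.
  by rewrite /SH (bigD1 ord0)//= lerDl sumr_ge0// => i _; exact: sq_ge0.
have PW : W <= K * SH.
  by apply: le_trans (poincare_h10 N0 hI) _; rewrite ler_wpM2l ?(ltW K0).
have SG0 : 0 <= SG by apply: sumr_ge0 => i _; exact: sq_ge0.
have [sH0 _] := wH ord0.
(* Multiplied by theta / 2, this has c * P as cross term and c^2 / (2 theta) = alpha / 2 as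
   coefficient of U. *)
have := ip_ge oO (c / theta) sH0 su; set P := ip _ _ _; rewrite -/U => HP.
have HP' : - (theta / 2) * SH - alpha / 2 * U <= c * P.
  have : 0 <= theta / 2 * (sq (slab N) (H ord0) + 2 * (c / theta) * P + (c / theta) ^+ 2 * U).
    by rewrite mulr_ge0// divr_ge0// ltW.
  have -> : theta / 2 * (sq (slab N) (H ord0) + 2 * (c / theta) * P + (c / theta) ^+ 2 * U) =
    theta / 2 * sq (slab N) (H ord0) + c * P + alpha / 2 * U.
    by rewrite /alpha; field; rewrite gt_eqF.
  have : theta / 2 * sq (slab N) (H ord0) <= theta / 2 * SH.
    by rewrite ler_wpM2l// divr_ge0// ltW.
  by rewrite mulNr; lra.
rewrite /h1sq -/U -/W -/SG -/SH.
apply: (@le_trans _ _ ((2^-1 * (SG + SH))%:E + (2^-1)%:E *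
  (alpha * U - eps * (U + W) - 50 * (k0 * Q + k0 * Q))%:E + (c * P)%:E)%E); last first.
  by rewrite leeD2r// leeD2l//; apply: lee_wpmul2l => //; rewrite lee_fin.
rewrite -EFinM -!EFinD lee_fin.
have eK : eps * (U + W) <= (1 - theta) / 2 * (SG + SH).
  apply: (@le_trans _ _ (eps * (K * (SG + SH)))).
    by rewrite ler_wpM2l ?(ltW eps0)//; lra.
  rewrite mulrA ler_wpM2r ?addr_ge0//; first by apply: sumr_ge0 => i _; exact: sq_ge0.
  rewrite /eps le_eqVlt; apply/orP; left; apply/eqP; field.
  by rewrite gt_eqF.
have kK : kappa * (U + SG + (W + SH)) <= (1 - theta) / 4 * (SG + SH).
  apply: (@le_trans _ _ (kappa * ((K + 1) * (SG + SH)))).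
    by rewrite ler_wpM2l ?(ltW kappa0)//; lra.
  rewrite mulrA ler_wpM2r ?addr_ge0//; first by apply: sumr_ge0 => i _; exact: sq_ge0.
  rewrite /kappa le_eqVlt; apply/orP; left; apply/eqP; field.
  by rewrite gt_eqF.
have -> : 50 * (k0 * Q + k0 * Q) = kappa * Q by rewrite /k0; field.
have tt : theta / 2 * SG >= 0 by rewrite mulr_ge0// divr_ge0// ltW.
by move: HP' eK kK; clearbody theta alpha eps kappa K; lra.
Qed.

(* [Q] is only an upper bound of the squared norm, so that the estimate can be
   used when the latter is zero. *)
Lemma lagrangian_lower (A : R) (N : nat) (c : R) : 0 < A < 1 -> (0 < N)%N ->
  0 < c < 2 * Num.sqrt (1 - A) ->
  exists r kappa : R, [/\ 0 < r, 0 < kappa & forall psi Q,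
    one_plus_H10 (@slab R m N) psi ->
    h1sqC (slab N) (fun x => psi x - 1) <= Q -> 0 < Q <= r ->
    ((kappa * h1sqC (slab N) (fun x => psi x - 1) - kappa / 2 * Q)%:E <=
     lagrangian A N c psi)%E].
Proof.
move=> hA N0 hc; have [r [kappa [r0 kappa0 H]]] := coercive_near1 hA N0 hc.
exists r, kappa; split=> [||psi Q Hpsi QQ Qr]; [exact: r0|exact: kappa0|].
have oO : open (@slab R m N) by exact: open_slab.
have [hR hI] := sobolev_H10_h10 oO Hpsi.
have [gR _] := hR; have [gI _] := hI.
rewrite (lagrangianE A c gR gI).
exact: H hR hI QQ Qr.
Qed.

End lower_bound.

(** * The test path *)

Section line_path.
Context {R : realType} {n : nat}.
Implicit Types (Omega : set 'rV[R]_n) (eta : 'rV[R]_n -> R).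

Definition line eta (t : R) (x : 'rV[R]_n) : R[i] := Complex (1 - t * eta x) 0.

Lemma line_sub1 eta t x : line eta t x - 1 = Complex (- t * eta x) 0.
Proof. by rewrite /line; apply/eqP; rewrite eq_complex/=; apply/andP; split; apply/eqP; ring. Qed.

Lemma line_sub eta s t x : line eta s x - line eta t x = Complex ((t - s) * eta x) 0.
Proof. by rewrite /line; apply/eqP; rewrite eq_complex/=; apply/andP; split; apply/eqP; ring. Qed.

Lemma test_function0 Omega : test_function Omega (cst 0).
Proof.
have E : [set x : 'rV[R]_n | (cst 0 : 'rV[R]_n -> R) x != 0] = set0.
  by apply/seteqP; split=> x //=; rewrite eqxx.
split; [exact: smooth_cst| |]; rewrite E closure0; [exact: compact0|by []].
Qed.

Lemma test_functionZ Omega (c : R) eta : test_function Omega eta ->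
  test_function Omega (fun x => c * eta x).
Proof.
move=> [se ce eO].
have sub : closure [set x | c * eta x != 0] `<=` closure [set x | eta x != 0].
  by apply: closure_subset => x /=; rewrite mulf_eq0 negb_or => /andP[].
split; first exact: smoothZ.
  by apply: subclosed_compact ce sub; exact: closed_closure.
exact: subset_trans eO.
Qed.

Lemma test_functionS Omega Omega' eta : Omega `<=` Omega' ->
  test_function Omega eta -> test_function Omega' eta.
Proof. by move=> OO [se ce eO]; split=> //; exact: subset_trans OO. Qed.

Variable Omega : set 'rV[R]_n.
Hypothesis oO : open Omega.

Lemma weak_gradZ_test (c : R) eta : test_function Omega eta ->
  weak_grad Omega (fun x => c * eta x) (fun i x => c * partial i eta x).
Proof. by move=> te; apply: weak_gradZ => //; exact: weak_grad_test. Qed.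

Lemma weak_grad0 : weak_grad Omega (cst 0) (fun i => cst 0).
Proof.
have := weak_gradZ_test 0 (test_function0 Omega).
rewrite (_ : (fun x => _) = cst 0); last by apply/funext => x; rewrite mul0r.
rewrite (_ : (fun i x => _) = fun i => cst 0)//.
by apply/funext => i; apply/funext => x; rewrite mul0r.
Qed.

Lemma sq0 : sq Omega (cst 0) = 0.
Proof.
rewrite /sq (eq_integral (cst 0%E)) ?integral0// => x _.
by rewrite /= expr0n.
Qed.

Lemma h1sq0 : h1sq Omega (cst 0) (fun i => cst 0) = 0.
Proof. by rewrite /h1sq sq0 big1 ?addr0// => i _; exact: sq0. Qed.

Lemma H1_norm_line (c : R) eta : test_function Omega eta ->
  H1_norm Omega (fun x => Complex (c * eta x) 0) =
  (`|c| * Num.sqrt (h1sq Omega eta (fun i => partial i eta)))%:E.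
Proof.
move=> te; rewrite (H1_normE oO (u := fun x => Complex (c * eta x) 0)
  (weak_gradZ_test c te) weak_grad0) /=.
rewrite [X in _ + X]h1sq0 addr0.
rewrite (h1sqZ oO c (weak_grad_test oO te)) sqrtrM ?sqr_ge0//.
by rewrite sqrtr_sqr.
Qed.

Lemma line_one_plus_H10 eta t : test_function Omega eta ->
  one_plus_H10 Omega (line eta t).
Proof.
move=> te; rewrite /one_plus_H10.
rewrite (funext (line_sub1 eta t)); split.
  split => /=; first exact: weak_grad_H1 (weak_gradZ_test (- t) te).
  exact: weak_grad_H1 weak_grad0.
move=> e e0; exists (fun x => Complex (- t * eta x) 0).
  by split; [exact: test_functionZ|exact: test_function0].
rewrite (_ : (fun x => _) = fun x => Complex (0 * eta x) 0).
  by rewrite H1_norm_line// normr0 mul0r lte_fin.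
apply/funext => x; apply/eqP; rewrite eq_complex/=.
by apply/andP; split; apply/eqP; ring.
Qed.

Lemma path_between_line eta psi : test_function Omega eta ->
  (forall x, psi x = line eta 1 x) ->
  path_between Omega (fun=> 1) psi (line eta).
Proof.
move=> te psiE; split.
- by move=> t _; exact: line_one_plus_H10.
- move=> t _; apply: cvg_within_filter.
  under eq_fun do rewrite (funext (line_sub eta _ t)) H1_norm_line//.
  apply: cvg_EFin; first exact: nearW.
  set K := Num.sqrt _.
  rewrite -[X in _ --> X](mul0r K); apply: cvgMl.
  rewrite -[X in _ --> X](normr0 R); apply: cvg_norm.
  rewrite -[X in _ --> X](subrr t); apply: cvgB; [exact: cvg_cst|exact: cvg_id].
- by apply: aeW => x _; rewrite /line mul0r subr0.
- by apply: aeW => x _; rewrite psiE.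
Qed.

End line_path.

Section line_energy.
Context {R : realType} {m : nat}.
Local Notation mu := (lebesgue_rV R m.+1).
Implicit Types eta : 'rV[R]_m.+1 -> R.

Lemma lagrangian_line (A : R) N c eta t : test_function (slab N) eta ->
  lagrangian A N c (line eta t) =
  ((t ^+ 2 / 2 * \sum_i sq (slab N) (partial i eta))%:E +
   (2^-1)%:E * \int[mu]_(x in slab N) (potential A ((1 - t * eta x) ^+ 2))%:E)%E.
Proof.
move=> te; have oO : open (@slab R m N) by exact: open_slab.
have eR x : complex.Re (line eta t x - 1) = - t * eta x by rewrite line_sub1.
have eI x : complex.Im (line eta t x - 1) = 0 by rewrite line_sub1.
have wR := weak_gradZ_test oO (- t) te.
have wI := weak_grad0 oO.
have := @lagrangianE R m A N c (line eta t) (fun i x => - t * partial i eta x) (fun i => cst 0).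
rewrite (funext eR) (funext eI) => /(_ wR wI) ->.
have -> : ip (slab N) (cst 0) (fun x => - t * eta x) = 0.
  rewrite /ip (eq_integral (cst 0%E)) ?integral0// => x _.
  by rewrite /= mul0r.
rewrite mulr0 adde0; congr (_ + _)%E.
  congr EFin; rewrite [X in _ * (_ + X)]big1 ?addr0; last first.
    by move=> i _; exact: sq0.
  rewrite [in RHS]mulrAC mulrC; congr (_ * _); rewrite mulr_sumr.
  apply: eq_bigr => i _; rewrite sqZ ?sqrrN//.
  by have [_ w] := weak_grad_test oO te; case: (w i).
congr (_ * _)%E; apply: eq_integral => x _; congr (potential A _)%:E.
by rewrite eI eR expr0n addr0 mulNr.
Qed.

(** A bound by e^2 integrates to the L^2 norm of the profile, which is finite and the same on every
    larger slab. *)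
Lemma potential_line_le (A t e : R) : 0 < A < 1 -> 0 <= t <= 1 -> 0 <= e <= 1 ->
  potential A ((1 - t * e) ^+ 2) <= 4 * e ^+ 2.
Proof.
move=> /andP[A0 A1] /andP[t0 t1] /andP[e0 e1].
have te0 : 0 <= t * e by rewrite mulr_ge0.
have tee : t * e <= e by rewrite ler_piMl.
set a := t * e in te0 tee *.
have s1 : (1 - a) ^+ 2 <= 1 by nra.
rewrite /potential; apply: (@le_trans _ _ (((1 - a) ^+ 2 - 1) ^+ 2)).
  by rewrite -[leRHS]mulr1 ler_wpM2l ?sqr_ge0//; lra.
have -> : ((1 - a) ^+ 2 - 1) ^+ 2 = a ^+ 2 * (2 - a) ^+ 2 by ring.
have -> : 4 * e ^+ 2 = e ^+ 2 * 2 ^+ 2 by ring.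
by apply: ler_pM; rewrite ?sqr_ge0// ler_pXn2r ?nnegrE//; lra.
Qed.

Lemma potential_line_norm (A t e : R) : 0 < A < 1 -> 0 <= t <= 1 -> 0 <= e <= 1 ->
  `|potential A ((1 - t * e) ^+ 2)| <= 1.
Proof.
move=> /andP[A0 A1] /andP[t0 t1] /andP[e0 e1].
have te0 : 0 <= t * e by rewrite mulr_ge0.
have tee : t * e <= 1 by rewrite mulr_ile1.
set a := t * e in te0 tee *.
have s0 : 0 <= (1 - a) ^+ 2 by exact: sqr_ge0.
have s1 : (1 - a) ^+ 2 <= 1 by nra.
set s := _ ^+ 2 in s0 s1 *.
rewrite /potential normrM -[leRHS]mulr1 ler_pM//.
  by rewrite ger0_norm ?sqr_ge0//; nra.
by rewrite ler_norml; apply/andP; split; lra.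
Qed.

Lemma integrable_potential_line (A t : R) N eta : 0 < A < 1 -> 0 <= t <= 1 ->
  (forall x, 0 <= eta x <= 1) -> test_function (slab N) eta ->
  mu.-integrable (slab N) (fun x => (potential A ((1 - t * eta x) ^+ 2))%:E).
Proof.
move=> hA ht he te; have [M eM] := test_function_bounded_support te.
have me : measurable_fun setT eta by case: te => se _ _; exact: smooth_measurable.
have mO : measurable (@slab R m N) by apply: open_measurable_rV; exact: open_slab.
apply: (@integrableS _ _ _ _ setT) => //.
apply: (@integrable_bounded_support _ _ 1 M).
- have ms : measurable_fun setT (fun x => (1 - t * eta x) ^+ 2).
    by apply: measurable_funX; apply: measurable_funB => //; exact: measurable_funM.
  rewrite /potential; apply: measurable_funM; last exact: measurable_funB.
  by apply: measurable_funX; exact: measurable_funB.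
- by move=> x; exact: potential_line_norm.
- by move=> x i Mx; rewrite (eM x i)// /potential; ring.
Qed.

Lemma slab_subset N N0 : (N0 <= N)%N -> @slab R m N0 `<=` slab N.
Proof.
move=> NN x; rewrite /slab /= => /andP[h1 h2]; apply/andP; split.
  by apply: le_lt_trans h1; rewrite lerN2 ler_nat.
by apply: lt_le_trans h2 _; rewrite ler_nat.
Qed.

Lemma sq_slab N N0 f : (forall x : 'rV[R]_m.+1, ~ slab N0 x -> f x = 0) -> (N0 <= N)%N ->
  sq (slab N) f = sq (slab N0) f.
Proof.
move=> f0 NN; rewrite /sq.
have -> : (\int[mu]_(x in slab N) (f x ^+ 2)%:E = \int[mu]_x (f x ^+ 2)%:E)%E.
  apply: integral_vanish_out => x nx; rewrite f0 ?expr0n// => h.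
  exact/nx/(slab_subset NN).
have -> // : (\int[mu]_(x in slab N0) (f x ^+ 2)%:E = \int[mu]_x (f x ^+ 2)%:E)%E.
by apply: integral_vanish_out => x /f0 ->; rewrite expr0n.
Qed.

Lemma lagrangian_line_le (A t : R) N N0 c eta : 0 < A < 1 -> 0 <= t <= 1 ->
  (N0 <= N)%N -> (forall x, 0 <= eta x <= 1) -> test_function (slab N0) eta ->
  (lagrangian A N c (line eta t) <=
   (2^-1 * (\sum_i sq (slab N0) (partial i eta)) + 2 * sq (slab N0) eta)%:E)%E.
Proof.
move=> hA ht NN he te0.
have te := test_functionS (slab_subset NN) te0.
have oO : open (@slab R m N) by exact: open_slab.
have mO := open_measurable_rV oO.
rewrite lagrangian_line// EFinD; apply: leeD.
  rewrite lee_fin; apply: ler_pM.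
  - by rewrite divr_ge0 ?sqr_ge0.
  - by apply: sumr_ge0 => i _; exact: sq_ge0.
  - have /andP[t0 t1] := ht; have : t ^+ 2 <= 1 by rewrite exprn_ile1.
    lra.
  - apply: ler_sum => i _; rewrite (sq_slab _ NN)// => x.
    exact: test_function_partial_out.
rewrite -(sq_slab _ NN); last by move=> x; exact: test_function_out.
have -> : 2 * sq (slab N) eta = 2^-1 * (4 * sq (slab N) eta) by field.
rewrite EFinM; apply: lee_wpmul2l; first by rewrite lee_fin.
have se := square_integrable_test mO te.
have [_ ie] := (square_integrableP _ mO).1 se.
have i4 := integrableZl mO 4 ie.
rewrite EFinM -sqE// -(integralZl mO ie).
apply: le_integral_lower => //.
- exact: integrable_potential_line.
- exact: measurable_int i4.
- by move=> x _; rewrite -EFinM lee_fin potential_line_le.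
Qed.

End line_energy.

(** * A plateau of negative energy *)

Section plateau.
Context {R : realType} {m : nat}.
Local Notation mu := (lebesgue_rV R m.+1).
Local Notation cube r := (cbox (const_mx (- r) : 'rV[R]_m.+1) (const_mx r)).

(** On the line through [x] in direction [j] the other factors form a constant in [0, 1]; each of
    the two remaining factors contributes k * C. *)
Lemma partial_bump_le (C k : R) (a b x : 'rV[R]_m.+1) j :
  (forall t, `|flat (flat' (1 : {poly R})) t| <= C) -> 0 < k ->
  `|partial j (bump k a b) x| <= 2 * k * C.
Proof.
move=> hC k0; have C0 : 0 <= C by exact: le_trans (hC 0).
pose h t := flat 1 (k * (t - a ord0 j)) * flat 1 (k * (b ord0 j - t)).
pose c := \prod_(i | i != j) (flat 1 (k * (x ord0 i - a ord0 i)) *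
  flat 1 (k * (b ord0 i - x ord0 i))).
have c01 : 0 <= c <= 1.
  apply/andP; split.
    by apply: prodr_ge0 => i _; rewrite mulr_ge0 ?flat1_ge0.
  apply: prodr_ile1 => i _; rewrite mulr_ge0 ?flat1_ge0//=.
  by rewrite -[leRHS]mulr1 ler_pM ?flat1_ge0 ?flat1_le1.
have E : (fun t => bump k a b (upd x j t)) = (fun t => c * h t).
  apply/funext => t; rewrite /bump (bigD1 j)//= upd_coord mulrC; congr (_ * _).
  by apply: eq_bigr => i ij; rewrite !mxE (negbTE ij).
pose dh t := flat (flat' 1) (k * (t - a ord0 j)) * k * flat 1 (k * (b ord0 j - t)) -
  flat 1 (k * (t - a ord0 j)) * (flat (flat' 1) (k * (b ord0 j - t)) * k).
have Dh t : is_derive t (1:R) h (dh t).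
  have d1 : is_derive t (1:R) (fun s => k * (s - a ord0 j)) k.
    have d : is_derive t (1:R) (k \*: (id - cst (a ord0 j))) (k *: (1 - 0)).
      by apply: is_deriveZ; apply: is_deriveB.
    by apply: (is_derive_eq d); rewrite subr0 [_ *: _]mulr1.
  have d2 : is_derive t (1:R) (fun s => k * (b ord0 j - s)) (- k).
    have d : is_derive t (1:R) (k \*: (cst (b ord0 j) - id)) (k *: (0 - 1)).
      by apply: is_deriveZ; apply: is_deriveB.
    by apply: (is_derive_eq d); rewrite sub0r [_ *: _]mulrN mulr1.
  have e1 := @is_derive1_comp R (flat 1) _ t _ _ (is_derive_flat 1 _) d1.
  have e2 := @is_derive1_comp R (flat 1) _ t _ _ (is_derive_flat 1 _) d2.
  apply: (is_derive_eq (is_deriveM e1 e2)).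
  by rewrite /dh /GRing.scale/=; ring.
have := @is_derive_upd R m.+1 (bump k a b) x j (x ord0 j)
  (fun y => smooth_derivable (smooth_bump k a b)).
rewrite upd_same E => -[_ <-].
have [_] := is_deriveZ c (Dh (x ord0 j)).
rewrite (_ : c \*: h = fun t => c * h t)// => ->.
rewrite [_ *: _]/(_ * _) normrM -[leRHS]mul1r; case/andP: c01 => c0 c1.
apply: ler_pM => //; first by rewrite ger0_norm.
apply: le_trans (ler_normB _ _) _; rewrite !normrM (ger0_norm (ltW k0)).
have f0 t : `|flat (1 : {poly R}) t| <= 1 by rewrite ger0_norm ?flat1_ge0 ?flat1_le1.
set y1 := flat (flat' 1) _; set y2 := flat 1 _; set y3 := flat 1 _; set y4 := flat (flat' 1) _.
have h1 : `|y1| * k * `|y2| <= C * k * 1 by rewrite !ler_pM ?mulr_ge0 ?(ltW k0) ?hC ?f0.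
have h2 : `|y3| * (`|y4| * k) <= 1 * (C * k) by rewrite !ler_pM ?mulr_ge0 ?(ltW k0) ?hC ?f0.
lra.
Qed.

Lemma cube_volume (r : R) : 0 <= r -> mu (cube r) = ((2 * r) ^+ m.+1)%:E.
Proof.
move=> r0; rewrite (_ : cube r = [set x | forall i, `[- r, r]%classic (x ord0 i)]).
  rewrite (lebesgue_rV_prod (A := fun=> `[- r, r]%classic))//.
  rewrite (eq_bigr (fun=> (2 * r)%:E)).
    by rewrite prodEFin prodr_const card_ord.
  move=> i _; rewrite lebesgue_measure_itv/= lte_fin.
  case: ifPn => [_|]; first by rewrite -EFinB; congr EFin; ring.
  by rewrite -leNgt => rr; have -> : r = 0 by [lra]; rewrite mulr0.
by apply/seteqP; split=> x + i => /(_ i); rewrite /= !mxE.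
Qed.

Lemma measurable_cube (r : R) : measurable (cube r).
Proof.
by apply: (@measurable_rV_forall _ _ (fun i : 'I_m.+1 =>
  `[(const_mx (- r) : 'rV[R]_m.+1) ord0 i, (const_mx r : 'rV[R]_m.+1) ord0 i]%classic)).
Qed.

Lemma flat1_le (s t : R) : 0 < s -> s <= t -> flat 1 s <= flat 1 t.
Proof.
move=> s0 st; have t0 : 0 < t by exact: lt_le_trans st.
by rewrite !flat1E// ler_expR lerN2 lef_pV2.
Qed.

(** Each of the 2 (m+1) factors is at least exp(-1/(k d)), and exp(-t) >= 1 - t. Steepness k / L
    keeps the bound independent of L while the gradient decays like 1 / L. *)
Lemma bump_cube_ge (k d L : R) (x : 'rV[R]_m.+1) : 0 < k -> 0 < d < 1 -> 0 < L ->
  cube ((1 - d) * L) x ->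
  1 - 2 * m.+1%:R / (k * d) <= bump (k / L) (const_mx (- L)) (const_mx L) x.
Proof.
move=> k0 /andP[d0 d1] L0 xc; have kd : 0 < k * d by rewrite mulr_gt0.
pose s := flat (1 : {poly R}) (k * d).
have sE : s ^+ 2 ^+ m.+1 = expR (- (2 * m.+1%:R / (k * d))).
  rewrite /s flat1E// -exprM -expRM_natl; congr expR.
  by rewrite natrM; ring.
apply: (@le_trans _ _ (s ^+ 2 ^+ m.+1)).
  by rewrite sE; have := expR_ge1Dx (- (2 * m.+1%:R / (k * d))).
rewrite -[X in _ ^+ X](card_ord m.+1) -prodr_const; apply: ler_prod => i _.
rewrite sqr_ge0/= expr2.
have := xc i; rewrite /= in_itv/= !mxE => /andP[x1 x2].
have kL : 0 < k / L by rewrite divr_gt0.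
have kdE : k * d = k / L * (d * L) by field; rewrite gt_eqF.
by apply: ler_pM; rewrite ?flat1_ge0//; apply: flat1_le => //; rewrite kdE ler_pM2l//; lra.
Qed.

Lemma bernoulli_le (d : R) n : 0 <= d <= 1 -> 1 - n%:R * d <= (1 - d) ^+ n.
Proof.
move=> /andP[d0 d1]; elim: n => [|n IH]; first by rewrite mul0r subr0 expr0.
rewrite exprSr; apply: (@le_trans _ _ ((1 - n%:R * d) * (1 - d))).
  rewrite -natr1; have : 0 <= n%:R * d * d by rewrite !mulr_ge0.
  lra.
by rewrite ler_wpM2r//; lra.
Qed.

Lemma potential_plateau_le (A e : R) : 0 < A < 1 -> 1 - A / 2 <= e <= 1 ->
  potential A ((1 - e) ^+ 2) <= - (A / 8).
Proof.
move=> /andP[A0 A1] /andP[e1 e2]; set s := (1 - e) ^+ 2.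
have s0 : 0 <= s by exact: sqr_ge0.
have sA : s <= A / 2.
  have : s <= A / 2 * (A / 2) by rewrite /s expr2 ler_pM//; lra.
  have : A / 2 * (A / 2) <= A / 2 by rewrite ler_piMr//; lra.
  lra.
have h1 : 4^-1 <= (s - 1) ^+ 2.
  have : 0 <= (2^-1 - s) * (3 / 2 - s) by rewrite mulr_ge0//; lra.
  have -> : (2^-1 - s) * (3 / 2 - s) = (s - 1) ^+ 2 - 4^-1 by field.
  by rewrite subr_ge0.
rewrite /potential -lerN2 opprK -mulrN.
have -> : A / 8 = 4^-1 * (A / 2) by field.
by apply: ler_pM => //; lra.
Qed.

Lemma negative_plateau (A : R) : 0 < A < 1 ->
  exists (N0 : nat) eta, [/\ (0 < N0)%N, test_function (@slab R m N0) eta,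
    forall x, 0 <= eta x <= 1 &
    forall N c, (N0 <= N)%N -> (lagrangian A N c (line eta 1) < 0)%E].
Proof.
move=> hA; have /andP[A0 A1] := hA.
have [C C0 hC] := flat_bounded (flat' (1 : {poly R})).
pose D : R := m.+1%:R.
have D1 : 1 <= D by rewrite ler1n.
(* By Bernoulli's inequality the inner cube of side (1 - d) L keeps a fraction at least 1 - A/32 of
   the volume; [k] then makes the profile at least 1 - A/2 there. *)
pose d : R := A / (32 * D).
have D0 : 0 < D by lra.
have d0 : 0 < d by rewrite divr_gt0 ?mulr_gt0.
have dD : D * d = A / 32 by rewrite /d; field; rewrite gt_eqF.
have dDd : d <= D * d by rewrite ler_peMl ?(ltW d0).
have d1 : d < 1 by lra.
pose k : R := 4 * D / (d * A).
have k0 : 0 < k by apply: divr_gt0; apply: mulr_gt0 => //; lra.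
have kd : 2 * D / (k * d) = A / 2.
  by rewrite /k; clearbody d; field; rewrite !gt_eqF.
(* The condition L^2 > B says exactly that the gradient density D (2 k C / L)^2 is below A/16. *)
pose B : R := 64 * D * k ^+ 2 * C ^+ 2 / A.
have B0 : 0 <= B.
  apply: divr_ge0; last exact: ltW.
  apply: mulr_ge0; last exact: sqr_ge0.
  apply: mulr_ge0; last exact: sqr_ge0.
  by apply: mulr_ge0 => //; exact: ltW.
pose l := (Num.bound B).+1.
pose L : R := l%:R.
have L1 : 1 <= L by rewrite ler1n.
have L0 : 0 < L by lra.
have BL : B < L by apply: lt_trans (archi_boundP B0) _; rewrite ltr_nat.
have LB : B < L ^+ 2 by apply: lt_le_trans BL _; rewrite expr2 ler_peMl.
pose eta := bump (k / L) (const_mx (- L)) (const_mx L : 'rV[R]_m.+1).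
have kL0 : 0 < k / L by rewrite divr_gt0.
have eta01 x : 0 <= eta x <= 1 by rewrite bump_ge0 bump_le1.
have cubeS : cube L `<=` @slab R m l.+1.
  move=> x /(_ ord0); rewrite /slab /= in_itv/= !mxE -natr1 -/L; lra.
have te : test_function (slab l.+1) eta by exact: test_function_bump.
have tc : test_function (cube L) eta by exact: test_function_bump.
exists l.+1, eta; split=> // N c lN.
have teN := test_functionS (slab_subset lN) te.
have oO : open (@slab R m N) by exact: open_slab.
have mO := open_measurable_rV oO.
have cubeN : cube L `<=` @slab R m N by exact: subset_trans cubeS (slab_subset lN).
rewrite lagrangian_line// expr1n.
pose L' := (1 - d) * L.
have L'0 : 0 <= L' by rewrite mulr_ge0//; lra.
have L'L : cube L' `<=` cube L.
  move=> x xc i; have := xc i; rewrite /= !in_itv/= !mxE => /andP[h1 h2].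
  have : L' <= L by rewrite /L' ler_piMl//; lra.
  by move=> h3; apply/andP; split; lra.
have I1 (r : R) : 0 <= r -> cube r `<=` slab N ->
    mu.-integrable (slab N) (fun x => (\1_(cube r) x)%:E) /\
    (\int[mu]_(x in slab N) (\1_(cube r) x)%:E = ((2 * r) ^+ m.+1)%:E)%E.
  move=> r0 rN; have mc := measurable_cube r.
  have I : (\int[mu]_(x in slab N) (\1_(cube r) x)%:E = ((2 * r) ^+ m.+1)%:E)%E.
    by rewrite integral_indic// setIidl//; exact: cube_volume.
  split=> //; apply/integrableP; split; first exact/measurable_EFinP/measurable_indic.
  by under eq_integral do rewrite gee0_abs//; rewrite I ltry.
have [iL IL] := I1 _ (ltW L0) cubeN.
have [iL' IL'] := I1 _ L'0 (subset_trans L'L cubeN).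
set V := (2 * L) ^+ m.+1 in IL.
have V0 : 0 < V by rewrite exprn_gt0// mulr_gt0.
have VL' : (2 * L') ^+ m.+1 = (1 - d) ^+ m.+1 * V.
  by rewrite /V /L' -exprMn; congr (_ ^+ _); ring.
have grad i : sq (slab N) (partial i eta) <= (2 * (k / L) * C) ^+ 2 * V.
  have [_ /(_ i)[sg _]] := weak_grad_test oO teN.
  rewrite -lee_fin -sqE// EFinM -IL -(integralZl mO iL).
  apply: le_integral_lower => //.
  - by have [_] := (square_integrableP _ mO).1 sg.
  - exact: measurable_int (integrableZl mO _ iL).
  move=> x Ox; rewrite -EFinM lee_fin indicE; case: (boolP (_ \in _)) => [_|].
    rewrite mulr1 -[leLHS]real_normK ?num_real//.
    apply: lerXn2r; rewrite ?nnegrE//; last exact: partial_bump_le.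
    by apply: mulr_ge0 => //; apply: mulr_ge0 => //; exact: ltW.
  by rewrite notin_setE => nx; rewrite (test_function_partial_out i tc nx) expr0n mulr0.
(* The potential is at most -A/8 on the inner cube, at most 1 on the surrounding shell and 0
   outside, where psi = 1. *)
have pot : (\int[mu]_(x in slab N) (potential A ((1 - 1 * eta x) ^+ 2))%:E <=
    (V - (1 + A / 8) * ((1 - d) ^+ m.+1 * V))%:E)%E.
  rewrite EFinB EFinM -VL' -IL -IL' -(integralZl mO iL').
  rewrite -(integralB mO iL (integrableZl mO _ iL')).
  have t01 : 0 <= (1:R) <= 1 by rewrite ler01 lexx.
  apply: le_integral_lower => //.
  - exact: integrable_potential_line.
  - exact: measurable_int (integrableB mO iL (integrableZl mO _ iL')).
  move=> x Ox; rewrite -[X in (_ <= X)%E]/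
    ((\1_(cube L) x - (1 + A / 8) * \1_(cube L') x)%:E) lee_fin.
  rewrite !indicE; case: (boolP (x \in cube L')) => [|_].
    rewrite inE => xL'; rewrite mem_set; last exact: L'L.
    rewrite mul1r /=; apply: le_trans (potential_plateau_le hA (e := eta x) _) _; last by lra.
    rewrite bump_le1 andbT -kd; apply: bump_cube_ge => //.
    by rewrite d0.
  case: (boolP (x \in cube L)) => [_|].
    rewrite mulr0 subr0; apply: le_trans (ler_norm _) _.
    exact: potential_line_norm.
  rewrite notin_setE => xL; rewrite (test_function_out tc xL)/= mulr0 subr0 expr1n.
  by rewrite /potential; lra.
have bern := bernoulli_le m.+1 (d := d).
have bern' : 1 - A / 32 <= (1 - d) ^+ m.+1.
  by rewrite -dD; apply: bern; rewrite (ltW d0) (ltW d1).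
have gradsum : \sum_i sq (slab N) (partial i eta) <= D * ((2 * (k / L) * C) ^+ 2 * V).
  apply: le_trans (ler_sum _ (fun i _ => grad i)) _.
  by rewrite sumr_const card_ord -[leLHS]mulr_natl.
have small : D * (2 * (k / L) * C) ^+ 2 < A / 16.
  have -> : D * (2 * (k / L) * C) ^+ 2 = A / 16 * (B / L ^+ 2).
    rewrite /B; move: (gt_eqF A0) (gt_eqF L0).
    move: (D) (k) (L) => x y z An zn.
    by field; rewrite An zn.
  by rewrite -[ltRHS]mulr1 ltr_pM2l ?divr_gt0// ltr_pdivrMr ?exprn_gt0// mul1r.
apply: (@le_lt_trans _ _ ((1 / 2 * (D * ((2 * (k / L) * C) ^+ 2 * V)))%:E +
  (2^-1)%:E * (V - (1 + A / 8) * ((1 - d) ^+ m.+1 * V))%:E)%E).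
  apply: leeD; first by rewrite lee_fin ler_wpM2l.
  by apply: lee_wpmul2l => //; rewrite lee_fin.
rewrite -EFinM -EFinD lte_fin.
set g := (2 * (k / L) * C) ^+ 2 in small *.
set b := (1 - d) ^+ m.+1 in bern' *.
have -> : 1 / 2 * (D * (g * V)) + 2^-1 * (V - (1 + A / 8) * (b * V)) =
  V / 2 * (D * g + 1 - (1 + A / 8) * b) by field.
rewrite pmulr_rlt0 ?divr_gt0//.
(* The bracket is below A/16 - 3 A/32 + A^2/256, which is negative as A < 1. *)
have : (1 + A / 8) * (1 - A / 32) <= (1 + A / 8) * b by rewrite ler_wpM2l//; lra.
have : A * A <= A by rewrite ler_piMr//; lra.
by move=> ? ?; nra.
Qed.

End plateau.

(** * Crossing the sphere *)

Section H1_distance.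
Context {R : realType} {n : nat}.
Variable Omega : set 'rV[R]_n.
Hypothesis oO : open Omega.
Implicit Types (w : 'rV[R]_n -> R[i]).
Local Notation mu := (lebesgue_rV R n).

Let mO : measurable Omega := open_measurable_rV oO.

Lemma ReB w1 w2 : (fun x => complex.Re (w1 x - w2 x)) =
  (fun x => complex.Re (w1 x)) \- (fun x => complex.Re (w2 x)).
Proof. by apply/funext => x /=; case: (w1 x) => ? ?; case: (w2 x). Qed.

Lemma ImB w1 w2 : (fun x => complex.Im (w1 x - w2 x)) =
  (fun x => complex.Im (w1 x)) \- (fun x => complex.Im (w2 x)).
Proof. by apply/funext => x /=; case: (w1 x) => ? ?; case: (w2 x). Qed.

Lemma sobolev_H1B w1 w2 : sobolev_H1 Omega w1 -> sobolev_H1 Omega w2 ->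
  sobolev_H1 Omega (fun x => w1 x - w2 x).
Proof.
move=> [r1 i1] [r2 i2]; rewrite /sobolev_H1 ReB ImB; split.
  exact: weak_grad_H1 (weak_gradB oO (weak_gradP oO r1) (weak_gradP oO r2)).
exact: weak_grad_H1 (weak_gradB oO (weak_gradP oO i1) (weak_gradP oO i2)).
Qed.

Lemma h1sqC_eq w G H : sobolev_H1 Omega w ->
  weak_grad Omega (fun x => complex.Re (w x)) G ->
  weak_grad Omega (fun x => complex.Im (w x)) H ->
  h1sqC Omega w =
    h1sq Omega (fun x => complex.Re (w x)) G + h1sq Omega (fun x => complex.Im (w x)) H.
Proof.
move=> hw gG gH; have := H1_normE oO gG gH; rewrite (H1_norm_h1sqC oO hw) => -[] /eqP.
rewrite (eqr_sqrt (h1sqC_ge0 _ _) (addr_ge0 (h1sq_ge0 _ _ _) (h1sq_ge0 _ _ _))).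
by move=> /eqP.
Qed.

Lemma lerD_mulD (X Y a b c d x y : R) : X <= x * a + y * b -> Y <= x * c + y * d ->
  X + Y <= x * (a + c) + y * (b + d).
Proof. lra. Qed.

Definition H1_dist w1 w2 : R := Num.sqrt (h1sqC Omega (fun x => w1 x - w2 x)).

(* The right-hand side of the hypothesis is least at
   [e = Num.sqrt b / Num.sqrt a]. *)
Lemma le_sqr_add_sqrt (X a b : R) : 0 <= a -> 0 <= b ->
  (forall e, 0 < e -> X <= (1 + e) * a + (1 + e^-1) * b) ->
  X <= (Num.sqrt a + Num.sqrt b) ^+ 2.
Proof.
move=> a0 b0 H; set x := Num.sqrt a; set y := Num.sqrt b.
have x0 : 0 <= x by exact: sqrtr_ge0.
have y0 : 0 <= y by exact: sqrtr_ge0.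
have aE : a = x ^+ 2 by rewrite sqr_sqrtr.
have bE : b = y ^+ 2 by rewrite sqr_sqrtr.
apply/ler_addgt0Pl => d d0.
(* The optimal weight degenerates when a root vanishes; shifting both roots by z keeps it positive
   and costs z * (4 (x + y) + 4 z) <= d. *)
pose z : R := Num.min 1 (d / (4 * (x + y) + 4)).
have k0 : 0 < 4 * (x + y) + 4 by lra.
have z0 : 0 < z by rewrite lt_min ltr01 divr_gt0.
have z1 : z <= 1 by rewrite ge_min lexx.
have zd : z * (4 * (x + y) + 4) <= d.
  by rewrite -ler_pdivlMr// ge_min lexx orbT.
have xz : 0 < x + z by lra. have yz : 0 < y + z by lra.
have e0 : 0 < (y + z) / (x + z) by rewrite divr_gt0.
apply: le_trans (H _ e0) _; rewrite aE bE invf_div.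
have h1 : x ^+ 2 <= (x + z) ^+ 2 by rewrite ler_pXn2r// ?nnegrE; lra.
have h2 : y ^+ 2 <= (y + z) ^+ 2 by rewrite ler_pXn2r// ?nnegrE; lra.
have h3 : (1 + (y + z) / (x + z)) * x ^+ 2 <= (1 + (y + z) / (x + z)) * (x + z) ^+ 2.
  by rewrite ler_wpM2l// addr_ge0// ltW.
have h4 : (1 + (x + z) / (y + z)) * y ^+ 2 <= (1 + (x + z) / (y + z)) * (y + z) ^+ 2.
  by rewrite ler_wpM2l// addr_ge0// divr_ge0// ltW.
have E : (1 + (y + z) / (x + z)) * (x + z) ^+ 2 + (1 + (x + z) / (y + z)) * (y + z) ^+ 2 =
    (x + y) ^+ 2 + z * (4 * (x + y) + 4 * z).
  by field; rewrite !gt_eqF.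
have h5 : z * (4 * (x + y) + 4 * z) <= z * (4 * (x + y) + 4).
  by rewrite ler_pM2l//; lra.
lra.
Qed.

Lemma H1_triangle w1 w2 : sobolev_H1 Omega w1 -> sobolev_H1 Omega w2 ->
  Num.sqrt (h1sqC Omega w1) <= Num.sqrt (h1sqC Omega w2) + H1_dist w1 w2.
Proof.
move=> h1 h2; have hd := sobolev_H1B h1 h2.
have [r2 i2] := h2; have [rd id] := hd.
have gr2 := weak_gradP oO r2; have gi2 := weak_gradP oO i2.
have grd := weak_gradP oO rd; have gid := weak_gradP oO id.
rewrite -(ler_pXn2r (n := 2))// ?nnegrE ?addr_ge0 ?sqrtr_ge0//.
rewrite sqr_sqrtr ?h1sqC_ge0//.
apply: le_sqr_add_sqrt; [exact: h1sqC_ge0|exact: h1sqC_ge0|move=> e e0].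
have gr1 := weak_gradD oO gr2 grd; have gi1 := weak_gradD oO gi2 gid.
have er : (fun x => complex.Re (w2 x)) \+ (fun x => complex.Re (w1 x - w2 x)) =
    (fun x => complex.Re (w1 x)).
  by rewrite ReB; apply/funext => x /=; ring.
have ei : (fun x => complex.Im (w2 x)) \+ (fun x => complex.Im (w1 x - w2 x)) =
    (fun x => complex.Im (w1 x)).
  by rewrite ImB; apply/funext => x /=; ring.
rewrite er in gr1; rewrite ei in gi1.
rewrite (h1sqC_eq h1 gr1 gi1).
have lr := h1sqD_le oO e0 gr2 grd; have li := h1sqD_le oO e0 gi2 gid.
rewrite er in lr; rewrite ei in li.
exact: lerD_mulD lr li.
Qed.

Lemma add_sqrN1 (x y a b : R) : x = (-1) ^+ 2 * a -> y = (-1) ^+ 2 * b -> x + y = a + b.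
Proof. by rewrite sqrrN expr1n !mul1r => -> ->. Qed.

Lemma H1_distC w1 w2 : sobolev_H1 Omega w1 -> sobolev_H1 Omega w2 ->
  H1_dist w1 w2 = H1_dist w2 w1.
Proof.
move=> h1 h2; rewrite /H1_dist.
have [rd id] := sobolev_H1B h1 h2.
have gr := weak_gradZ oO (-1) (weak_gradP oO rd).
have gi := weak_gradZ oO (-1) (weak_gradP oO id).
have er : (fun x => -1 * complex.Re (w1 x - w2 x)) = (fun x => complex.Re (w2 x - w1 x)).
  by rewrite ReB; apply/funext => x; have /(congr1 (fun f => f x)) := ReB w1 w2 => /= ->; ring.
have ei : (fun x => -1 * complex.Im (w1 x - w2 x)) = (fun x => complex.Im (w2 x - w1 x)).
  by rewrite ImB; apply/funext => x; have /(congr1 (fun f => f x)) := ImB w1 w2 => /= ->; ring.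
rewrite er in gr; rewrite ei in gi.
have E := h1sqC_eq (sobolev_H1B h2 h1) gr gi; rewrite -er -ei in E.
have zr := h1sqZ oO (-1) (weak_gradP oO rd).
have zi := h1sqZ oO (-1) (weak_gradP oO id).
exact: (congr1 Num.sqrt (esym (etrans E (add_sqrN1 zr zi)))).
Qed.

Lemma norm_sub_le (a b e : R) : a <= b + e -> b <= a + e -> `|a - b| <= e.
Proof. by move=> h1 h2; rewrite ler_norml; apply/andP; split; lra. Qed.

Lemma H1_norm_lipschitz w1 w2 : sobolev_H1 Omega w1 -> sobolev_H1 Omega w2 ->
  `|Num.sqrt (h1sqC Omega w1) - Num.sqrt (h1sqC Omega w2)| <= H1_dist w1 w2.
Proof.
move=> h1 h2; have t1 := H1_triangle h1 h2; have t2 := H1_triangle h2 h1.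
rewrite (H1_distC h2 h1) in t2; exact: norm_sub_le t1 t2.
Qed.

Lemma weak_grad_ae0 f : square_integrable Omega f ->
  {ae mu, forall x, Omega x -> f x = 0} -> weak_grad Omega f (fun i => cst 0).
Proof.
move=> sf f0; split=> // i; have [s0 w0] := weak_grad0 oO.
split=> // phi tp; have := (w0 i).2 phi tp => <-.
apply: ae_eq_integral => //.
- exact: measurable_int _ (test_integrable_L2 oO i sf tp).
- exact: measurable_int _ (test_integrable_L2 oO i s0 tp).
- by apply: filterS f0 => x /[apply] ->.
Qed.

(** The end points of a path are prescribed only almost everywhere; this turns such equalities into
    zero H^1 distance. *)
Lemma h1sqC_ae0 w : sobolev_H1 Omega w ->
  {ae mu, forall x, Omega x -> w x = 0} -> h1sqC Omega w = 0.
Proof.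
move=> hw w0; have [[sr _] [si _]] := hw.
have r0 : {ae mu, forall x, Omega x -> complex.Re (w x) = 0}.
  by apply: filterS w0 => x /[apply] ->.
have i0 : {ae mu, forall x, Omega x -> complex.Im (w x) = 0}.
  by apply: filterS w0 => x /[apply] ->.
have [s0 _] := weak_grad0 oO.
rewrite (h1sqC_eq hw (weak_grad_ae0 sr r0) (weak_grad_ae0 si i0)) /h1sq.
rewrite (ae_eq_sq oO sr s0 r0) (ae_eq_sq oO si s0 i0).
by have := h1sq0 Omega; rewrite /h1sq => ->; rewrite addr0.
Qed.

Lemma path_H1_continuous psi0 psi1 g :
  path_between Omega psi0 psi1 g ->
  {within `[0, 1], continuous
    (fun t : R => Num.sqrt (h1sqC Omega (fun x => g t x - 1)))}.
Proof.
move=> [gH gc _ _]; apply/subspace_continuousP => t t01.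
have /gc /fine_cvgP[_ gt] : t \in `[0, 1] by exact: t01.
have H1 s : s \in `[0, 1] -> sobolev_H1 Omega (fun x => g s x - 1).
  by move=> /gH[].
have H1B s : s \in `[0, 1] -> H1_norm Omega (fun x => g s x - g t x) =
    (H1_dist (fun x => g s x - 1) (fun x => g t x - 1))%:E.
  move=> s01; rewrite -(H1_norm_h1sqC oO (sobolev_H1B (H1 _ s01) (H1 _ t01))).
  by congr (H1_norm _ _); apply/funext => x; rewrite opprB addrA subrK.
apply/cvgrPdist_le => e e0.
have /cvgrPdist_le /(_ e e0) gte := gt; rewrite near_withinE in gte.
rewrite near_withinE; apply: filterS gte => s ge s01; move: (ge s01) => /=.
rewrite (H1B _ s01) sub0r normrN; apply: le_trans.
apply: le_trans (H1_norm_lipschitz (H1 _ t01) (H1 _ s01)) _.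
rewrite (H1_distC (H1 _ t01) (H1 _ s01)); exact: ler_norm.
Qed.

End H1_distance.

(** * Positivity of the mountain pass level and conclusion *)

Section mountain_pass.
Context {R : realType} {m : nat}.

Lemma mountain_pass_level_gt0 (A : R) (N : nat) (c : R) (psi : 'rV[R]_m.+1 -> R[i]) :
  0 < A < 1 -> (0 < N)%N -> 0 < c < 2 * Num.sqrt (1 - A) ->
  one_plus_H10 (slab N) psi -> (lagrangian A N c psi < 0)%E ->
  (0 < mountain_pass_level A N c psi)%E.
Proof.
move=> hA N0 hc Hpsi Ineg.
have oO : open (@slab R m N) by exact: open_slab.
have [r [kappa [r0 k0 HI]]] := @lagrangian_lower R m A N c hA N0 hc.
(* If 0 < q <= r, the lower bound with Q = q gives energy at least kappa / 2 * q > 0. *)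
have far : r < h1sqC (slab N) (fun x => psi x - 1).
  rewrite ltNge; apply/negP => q_le_r; set q := h1sqC _ _ in q_le_r.
  have q0 : 0 <= q by exact: h1sqC_ge0.
  have bound Q : q <= Q -> 0 < Q -> Q <= r -> kappa * q < kappa / 2 * Q.
    move=> qQ Q0 Qr; have := HI psi Q Hpsi qQ; rewrite Q0 Qr => /(_ isT) h.
    by have := le_lt_trans h Ineg; rewrite lte_fin subr_lt0.
  have [qpos|] := ltP 0 q.
    have := bound q (lexx _) qpos q_le_r.
    by rewrite ltr_pM2r//; lra.
  (* When q = 0 every small Q > 0 is allowed, and the energy is at least -kappa / 2 * Q; the choice
     of Q below makes this exceed the negative value [a]. *)
  move=> q_le0; have qE : q = 0 by apply/eqP; rewrite eq_le q_le0 q0.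
  have h := HI psi r Hpsi q_le_r; rewrite r0 lexx in h.
  move: (h isT) Ineg bound HI; rewrite -/q qE mulr0 sub0r.
  case E : (lagrangian A N c psi) => [a| |] //= ha.
  rewrite lte_fin => a0 _ HI.
  pose Q : R := Num.min r (- a / kappa).
  have Q0 : 0 < Q by rewrite lt_min r0 divr_gt0// oppr_gt0.
  have Qr : Q <= r by rewrite ge_min lexx.
  have Qa : Q <= - a / kappa by rewrite ge_min lexx orbT.
  have := HI psi Q Hpsi; rewrite -/q qE (ltW Q0) Q0 Qr => /(_ isT isT).
  rewrite mulr0 sub0r E lee_fin.
  have : kappa * Q <= - a by rewrite mulrC -ler_pdivlMr.
  lra.
(* The height of the barrier: the lower bound on the sphere where both the squared norm and Q equal
   r. *)
have kr : (0 < (kappa / 2 * r)%:E)%E by rewrite lte_fin !mulr_gt0.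
apply: (lt_le_trans kr); apply: le_ereal_inf_tmp => _ [g gpath <-].
have [gH gc g0 g1] := gpath.
have H1 s : s \in `[0, 1] -> sobolev_H1 (slab N) (fun x => g s x - 1).
  by move=> /gH[].
have in0 : (0 : R) \in `[0, 1] by rewrite in_itv/= lexx ler01.
have in1 : (1 : R) \in `[0, 1] by rewrite in_itv/= lexx ler01.
pose f (t : R) := Num.sqrt (h1sqC (slab N) (fun x => g t x - 1)).
have f0 : f 0 = 0.
  rewrite /f (h1sqC_ae0 oO (H1 _ in0)) ?sqrtr0//.
  by apply: filterS g0 => x /[apply] ->; rewrite subrr.
have f1 : f 1 = Num.sqrt (h1sqC (slab N) (fun x => psi x - 1)).
  apply/eqP; rewrite -subr_eq0 -normr_eq0; apply/eqP/le_anti.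
  rewrite normr_ge0 andbT.
  have [hpsi _] := Hpsi.
  apply: le_trans (H1_norm_lipschitz oO (H1 _ in1) hpsi) _.
  rewrite /H1_dist (h1sqC_ae0 oO (sobolev_H1B oO (H1 _ in1) hpsi)) ?sqrtr0//.
  by apply: filterS g1 => x /[apply] ->; rewrite subrr.
have [t t01 ft] : exists2 t, t \in `[0, 1] & f t = Num.sqrt r.
  have fc : {within `[0, 1], continuous f} by exact: (path_H1_continuous oO gpath).
  apply: (IVT ler01 fc).
  rewrite f0 f1 ge_min le_max sqrtr_ge0/=.
  by apply/orP; right; exact: ler_wsqrtr (ltW far).
have ht : h1sqC (slab N) (fun x => g t x - 1) = r.
  by move/eqP: ft; rewrite /f (eqr_sqrt (h1sqC_ge0 _ _) (ltW r0)) => /eqP.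
apply: (@le_trans _ _ (lagrangian A N c (g t))); last first.
  by apply: ereal_sup_ubound; exists t.
have := HI (g t) r (gH _ t01); rewrite ht r0 lexx => /(_ isT isT).
have -> : kappa * r - kappa / 2 * r = kappa / 2 * r by field.
exact: id.
Qed.

End mountain_pass.

Theorem proposition1 (R : realType) (d : nat) (A : R)
    (hd : (2 <= d)%N) (hA : 0 < A < 1)
    (c0 : R) (hc0 : 0 < c0 < 2 * Num.sqrt (1 - A)) :
  exists (N0 : nat) (psi0 : 'rV[R]_d.-1.+1 -> R[i]) (chi : R),
    [/\ (0 < N0)%N, one_plus_H10 (slab N0) psi0, 0 < chi &
      forall (N : nat) (c : R), (N0 <= N)%N ->
        c0 <= c < 2 * Num.sqrt (1 - A) ->
        let psi := extend_by_one (slab N0) psi0 in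
        (lagrangian A N c psi < 0)%E /\
        (0 < mountain_pass_level A N c psi <= chi%:E)%E].
Proof.
have [N0 [eta [N00 te eta01 neg]]] := @negative_plateau R d.-1 A hA.
pose E := 2^-1 * (\sum_i sq (slab N0) (partial i eta)) + 2 * sq (slab N0) eta.
have E0 : 0 <= E.
  rewrite addr_ge0 ?mulr_ge0 ?sq_ge0//.
  by apply: sumr_ge0 => i _; exact: sq_ge0.
(* [E] bounds the energy along the segment for all N, c and t; adding 1 makes the constant positive
   at once. *)
exists N0, (line eta 1), (E + 1); split=> //.
- by apply: line_one_plus_H10 => //; exact: open_slab.
- by rewrite ltr_wpDl.
move=> N c NN /andP[c0c cA].
(* [eta] vanishes off the small slab, so the profile already equals 1 there and one formula serves
   on all larger slabs. *)
have -> /= : extend_by_one (slab N0) (line eta 1) = line eta 1.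
  apply/funext => x; rewrite /extend_by_one; case: ifPn => //.
  by rewrite notin_setE => nx; rewrite /line (test_function_out te nx) mulr0 subr0.
have oO : open (@slab R d.-1 N) by exact: open_slab.
have teN := test_functionS (slab_subset NN) te.
split; first exact: neg.
apply/andP; split.
  apply: mountain_pass_level_gt0 => //.
  - exact: leq_trans NN.
  - by case/andP: hc0 => c00 _; rewrite cA (lt_le_trans c00).
  - exact: line_one_plus_H10.
  - exact: neg.
apply: (@le_trans _ _ (ereal_sup [set lagrangian A N c (line eta t) | t in `[0, 1]])).
  apply: ereal_inf_lbound; exists (line eta) => //.
  exact: path_between_line.
apply: ge_ereal_sup => _ [t t01 <-].
apply: le_trans (lagrangian_line_le c hA _ NN eta01 te) _.
  by move: t01; rewrite /= in_itv.
by rewrite lee_fin lerDl.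
Qed.
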